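(* Let $C=\{c_1,\dots,c_d\}$ with $d\ge 2$ and let $\mathcal T_d=C^*$ be the $d$-regular rooted tree. Suppose that we are given a finite symmetric set $X$ of bounded automaton automorphisms acting on $\mathcal T_d$, and words $a,b\in C^*$ with $|b|\ge 1$. Put $G=\langle X\rangle$ and $\eta=ab^\omega$. Then we can effectively compute, uniformly over all $X$, $a$ and $b$, an ET0L grammar which generates the language $\mathrm{WP}(G,X,\mathrm{Stab}(\eta))$, and an ET0L grammar which generates the complement of this language, i.e. $X^*\setminus \mathrm{WP}(G,X,\mathrm{Stab}(\eta))$. Moreover, in both cases the grammars are unambiguous limiting.
   Context: **Tree automorphisms.** The vertices of $\mathcal T_d$ are the words in $C^*$; the root is the empty word $\varepsilon$ and the children of $v$ are $vc_1,\dots,vc_d$. $\mathrm{Aut}(\mathcal T_d)$ is the group of rooted-tree automorphisms, acting on the right, $v\mapsto v\cdot\alpha$; the action extends to infinite rays (infinite words) in $C^\omega$. For $\alpha\in \mathrm{Aut}(\mathcal T_d)$ and $v\in C^*$, the section $\alpha@v\in\mathrm{Aut}(\mathcal T_d)$ is the unique automorphism with $(vw)\cdot\alpha=(v\cdot\alpha)(w\cdot(\alpha@v))$ for all $w\in C^*$. An automorphism $\alpha$ is an automaton automorphism if $\{\alpha@v : v\in C^*\}$ is finite; such an automorphism is determined by finite data (a finite automaton whose states are its sections) and is given to algorithms in this form. It is a bounded automaton automorphism if moreover there is a constant $N_\alpha$ with $\#\{v\in C^* : \alpha@v\ne 1,\ |v|=k\}<N_\alpha$ for every positive integer $k$. **Membership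 language.** $\mathrm{Stab}(\eta)=\{g\in G:\eta\cdot g=\eta\}$. For $w\in X^*$, $\overline w\in G$ is the product of its letters. For a subgroup $H\le G$, $\mathrm{WP}(G,X,H)=\{w\in X^* : \overline w\in H\}$. **ET0L grammars.** Let $\Sigma$ (terminals) and $V$ (nonterminals) be disjoint finite alphabets. A table is a function $\tau$ from $\Sigma\cup V$ to the regular languages over $\Sigma\cup V$ with $\tau(\sigma)=\{\sigma\}$ for $\sigma\in\Sigma$. Write $w\to^\tau w'$ if $w=w_1\cdots w_m$ with each $w_i\in\Sigma\cup V$, and $w'=w_1'\cdots w_m'$ with each $w_i'\in\tau(w_i)$; write $w\to^{\tau_1\cdots\tau_k}w'$ if $w'$ is obtained from $w$ by successively applying $\tau_1,\dots,\tau_k$ in this way. An ET0L grammar is a tuple $E=(\Sigma,V,T,\mathcal R,S)$ where $T$ is a finite set of tables, $\mathcal R\subseteq T^*$ is a regular language (the rational control) and $S\in V$ is the start symbol. It generates $L(E)=\{w\in\Sigma^* : S\to^{r}w\text{ for some }r\in\mathcal R\}$. **Derivation trees.** A derivation tree labelled by $\tau_1\cdots\tau_n$ is a finite ordered rooted tree with root labelled $S$ at level $0$, in which every node at level $i-1$ ($1\le i\le n$) labelled by a nonterminal $v$ is expanded by children at level $i$ which spell from left to right a word in $\tau_i(v)$ (a single child labelled $\varepsilon$ if that word is empty), while nodes labelled by terminals or $\varepsilon$ are leaves; it is a derivation tree for the word in $(\Sigma\cup V)^*$ read off its leaves from left to right. **Unambiguous.** $E$ is unambiguous if for every $r\in\mathcal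 R$ and every $w\in(\Sigma\cup V)^*$ there is at most one derivation tree for $w$ labelled by $r$. **Limiting.** $E$ is limiting if: (1) $T=\{\alpha,\beta,\gamma\}$ consists of three tables; (2) $\mathcal R=\alpha\beta^*\gamma$; (3) $\varepsilon\notin\beta(v)$ for each $v\in V$; (4) $\gamma(v)\neq\emptyset$ for each $v\in V$; (5) if $S\to^{\rho_n}w$ for some $w\in(\Sigma\cup V)^*$, where $\rho_n=\alpha\beta^n\gamma$, then there exists $K\ge n$ such that $S\to^{\rho_k}w$ for each $k\ge K$. $E$ is unambiguous limiting if it is both unambiguous and limiting. *)

(* Defs.v *)
From Stdlib Require List.
From HB Require Import structures.
From mathcomp Require Import all_boot.
From mathcomp Require Import boolp classical_sets functions cardinality.

Set Implicit Arguments.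
Unset Strict Implicit.
Unset Printing Implicit Defensive.

Local Open Scope classical_set_scope.

Section TreeAutomorphisms.
Variable d : nat.
Notation C := 'I_d.
Implicit Types (u v w : seq C) (f : seq C -> seq C).

Definition child u v := exists c, v = rcons u c.

Definition is_tree_aut f :=
  [/\ bijective f, f [::] = [::] & forall u v, child u v <-> child (f u) (f v)].

Record taut := Taut { act :> seq C -> seq C; tautP : is_tree_aut act }.

Lemma taut_ext (g h : taut) : g =1 h -> g = h.
Proof.
case: g h => [g gP] [h hP] /= /funext gh; subst h.
by congr Taut; exact: Prop_irrelevance.
Qed.

Lemma size_act (g : taut) v : size (g v) = size v.
Proof.
case: g => f [_ f0 fc] /=.
elim/last_ind: v => [|v c IH]; first by rewrite f0.
have [c' ->] : child (f v) (f (rcons v c)) by apply: (proj1 (fc _ _)); exists c.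
by rewrite !size_rcons IH.
Qed.

Lemma act_cat (g : taut) v w : exists w', g (v ++ w) = g v ++ w'.
Proof.
elim/last_ind: w => [|w c [w' IH]]; first by exists [::]; rewrite !cats0.
case: g IH => f [_ _ fc] /= IH.
have [c' E] : child (f (v ++ w)) (f (v ++ rcons w c)).
  by apply: (proj1 (fc _ _)); exists c; rewrite rcons_cat.
by exists (rcons w' c'); rewrite E IH rcons_cat.
Qed.

Lemma id_tree_aut : is_tree_aut id.
Proof. by split=> //; exists id. Qed.

Lemma comp_tree_aut (g h : taut) : is_tree_aut (h \o g).
Proof.
case: g h => g [gb g0 gc] [h [hb h0 hc]] /=; split; first exact: bij_comp.
  by rewrite /= g0.
by move=> u v; rewrite gc hc.
Qed.

Lemma inv_ex (g : taut) : exists f, cancel g f /\ cancel f g.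
Proof. by case: g => g [[f gK fK] _ _] /=; exists f. Qed.

Definition inv_fun (g : taut) := projT1 (cid (inv_ex g)).

Lemma inv_funK (g : taut) : cancel g (inv_fun g).
Proof. by rewrite /inv_fun; case: cid => f []. Qed.

Lemma inv_funVK (g : taut) : cancel (inv_fun g) g.
Proof. by rewrite /inv_fun; case: cid => f []. Qed.

Lemma inv_tree_aut (g : taut) : is_tree_aut (inv_fun g).
Proof.
have [_ g0 gc] := tautP g; split.
- by exists g; [exact: inv_funVK | exact: inv_funK].
- by rewrite -{1}g0 inv_funK.
- move=> u v; have := gc (inv_fun g u) (inv_fun g v).
  by rewrite !inv_funVK => -[? ?]; split.
Qed.

(** The group acts on the right: [v] is sent by [g * h] to [h (g v)]. *)
Definition taut1 := Taut id_tree_aut.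
Definition taut_mul (g h : taut) := Taut (comp_tree_aut g h).
Definition taut_inv (g : taut) := Taut (inv_tree_aut g).

HB.instance Definition _ := gen_eqMixin taut.
HB.instance Definition _ := gen_choiceMixin taut.

Fact taut_mulA : associative taut_mul.
Proof. by move=> f g h; exact: taut_ext. Qed.
Fact taut_mul1g : left_id taut1 taut_mul.
Proof. by move=> g; exact: taut_ext. Qed.
Fact taut_mulg1 : right_id taut1 taut_mul.
Proof. by move=> g; exact: taut_ext. Qed.
Fact taut_mulVg : left_inverse taut1 taut_inv taut_mul.
Proof. by move=> g; apply: taut_ext => v /=; rewrite inv_funVK. Qed.
Fact taut_mulgV : right_inverse taut1 taut_inv taut_mul.
Proof. by move=> g; apply: taut_ext => v /=; rewrite inv_funK. Qed.

HB.instance Definition _ :=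
  isGroup.Build taut taut_mulA taut_mul1g taut_mulg1 taut_mulVg taut_mulgV.

Definition section_fun (g : taut) v w := drop (size v) (g (v ++ w)).

Lemma section_funE (g : taut) v w : g (v ++ w) = g v ++ section_fun g v w.
Proof.
by rewrite /section_fun; have [w' ->] := act_cat g v w; rewrite -(size_act g v) drop_size_cat.
Qed.

Lemma child_cat u v w : child (u ++ v) (u ++ w) <-> child v w.
Proof.
split=> [[c E]|[c ->]]; exists c; last by rewrite rcons_cat.
by move/eqP: E; rewrite rcons_cat eqseq_cat // eqxx => /eqP.
Qed.

Lemma section_tree_aut (g : taut) v : is_tree_aut (section_fun g v).
Proof.
have [_ _ gc] := tautP g; split.
- exists (section_fun (taut_inv g) (g v)) => w; rewrite /section_fun.
    by rewrite -section_funE /= inv_funK size_act drop_size_cat.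
  have gvE : taut_inv g (g v) = v by rewrite /= inv_funK.
  rewrite -{2}gvE -section_funE /= inv_funVK.
  by rewrite -(size_act g v) drop_size_cat.
- by rewrite /section_fun cats0 -(size_act g v) drop_size.
- move=> u w; rewrite -(child_cat v) gc !section_funE.
  exact: child_cat.
Qed.

Definition section g v : taut := Taut (section_tree_aut g v).

Lemma sectionP (g h : taut) v :
  (forall w, g (v ++ w) = g v ++ h w) <-> h = section g v.
Proof.
split=> [E|-> w]; last exact: section_funE.
apply: taut_ext => w; rewrite /= /section_fun E.
by rewrite -(size_act g v) drop_size_cat.
Qed.

Definition automaton_aut (g : taut) := finite_set (range (section g)).

Definition bounded_automaton_aut (g : taut) :=
  automaton_aut g /\
  exists N, forall k, 0 < k ->
    #|[set v : k.-tuple C | section g v != 1%g]%SET| < N.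

(** A ray is the sequence of its letters; letter number [m] of the image is
    read off from the image of the prefix of length [m.+1]. *)
Definition ray_act (eta : nat -> C) (g : taut) : nat -> C :=
  fun m => last (eta m) (g (mkseq eta m.+1)).

(** The ray [a b b b ...], for nonempty [b]; then the default letter [c0] is
    never used, since [a ++ b ^ m.+1] has more than [m] letters. *)
Definition periodic_ray (c0 : C) (a b : seq C) : nat -> C :=
  fun m => nth c0 (a ++ flatten (nseq m.+1 b)) m.

Definition subgroup : set (set taut) :=
  [set H | [/\ H 1%g, forall g h, H g -> H h -> H (g * h)%g
             & forall g, H g -> H (g^-1)%g]].

Definition generated (X : set taut) : set taut := smallest subgroup X.

Definition Stab (G : set taut) (eta : nat -> C) : set taut :=
  [set g | G g /\ ray_act eta g =1 eta].

(** The alphabet is given as an indexed set of automorphisms, and words are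
    words in the indices. *)
Definition WP (n : nat) (X : 'I_n -> taut) (H : set taut) : set (seq 'I_n) :=
  [set w | H (\big[*%g/1%g]_(i <- w) X i)].

Record mealy := Mealy {
  nstates : nat;
  next : 'I_nstates -> C -> 'I_nstates;
  out : 'I_nstates -> C -> C;
  init : 'I_nstates }.

(** [M] is the automaton whose states are the sections of [g], up to the naming
    [phi] of the sections by the states of [M]. *)
Definition section_automaton (M : mealy) (g : taut) :=
  exists phi : 'I_(nstates M) -> taut,
    [/\ injective phi, range phi = range (section g), phi (init M) = g
      & forall q c, phi q [:: c] = [:: out q c] /\
                    section (phi q) [:: c] = phi (next q c)].

End TreeAutomorphisms.

Section Regular.
Variable A : Type.

Inductive regex :=
  | Void | Eps | Chr of A
  | Alt of regex & regex | Cat of regex & regex | Star of regex.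

Fixpoint lang (r : regex) : set (seq A) :=
  match r with
  | Void => set0
  | Eps => [set [::]]
  | Chr x => [set [:: x]]
  | Alt r1 r2 => lang r1 `|` lang r2
  | Cat r1 r2 => [set u ++ v | u in lang r1 & v in lang r2]
  | Star r1 => [set flatten us | us in List.Forall (lang r1)]
  end.

End Regular.
Arguments Void {A}.
Arguments Eps {A}.

(** Nonterminals and tables are named by ordinals; regular languages are given
    by regular expressions. The value of a table at a terminal is forced, so
    only its values at nonterminals are recorded. *)
Record et0l (Sigma : Type) := ET0L {
  nonterms : nat;
  ntables : nat;
  rule : 'I_ntables -> 'I_nonterms -> regex (Sigma + 'I_nonterms);
  control : regex 'I_ntables;
  start : 'I_nonterms }.

Inductive ltree (A : Type) := LNode of A & seq (ltree A).

Section Grammar.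
Variables (Sigma : Type) (E : et0l Sigma).

Definition symbol := (Sigma + 'I_(nonterms E))%type.
Definition table_name := 'I_(ntables E).
Implicit Types (w u : seq symbol) (t : table_name) (r : seq table_name).

Definition table t (s : symbol) : set (seq symbol) :=
  match s with
  | inl x => [set [:: inl x]]
  | inr v => lang (rule t v)
  end.

Definition step t w w' :=
  exists2 us, List.Forall2 (table t) w us & w' = flatten us.

Fixpoint rewrites r w w' : Prop :=
  match r with
  | [::] => w' = w
  | t :: r' => exists2 w1, step t w w1 & rewrites r' w1 w'
  end.

Definition et0l_lang : set (seq Sigma) :=
  [set w | exists2 r, lang (control E) r &
                      rewrites r [:: inr (start E)] (map inl w)].

(** Nodes are labelled by symbols or by the empty word, written [None]. *)
Definition label (T : ltree (option symbol)) := let: LNode l _ := T in l.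
Definition children (T : ltree (option symbol)) := let: LNode _ Ts := T in Ts.

Definition spell u : seq (option symbol) :=
  if u is [::] then [:: None] else map Some u.

(** [expanded r T]: the subtree [T] hangs at a level from which the tables [r]
    remain to be applied. *)
Fixpoint expanded r (T : ltree (option symbol)) : Prop :=
  match r, label T with
  | t :: r', Some (inr v) =>
      (exists2 u, table t (inr v) u & map label (children T) = spell u) /\
      List.Forall (expanded r') (children T)
  | _, _ => children T = [::]
  end.

Fixpoint yield (T : ltree (option symbol)) : seq symbol :=
  match T with
  | LNode (Some s) [::] => [:: s]
  | LNode None [::] => [::]
  | LNode _ Ts => flatten (map yield Ts)
  end.

Definition derivation_tree r w (T : ltree (option symbol)) :=
  [/\ label T = Some (inr (start E)), expanded r T & yield T = w].

Definition unambiguous :=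
  forall r w T T', lang (control E) r ->
    derivation_tree r w T -> derivation_tree r w T' -> T = T'.

Definition limiting :=
  exists al be ga : table_name,
    let rho k := al :: rcons (nseq k be) ga in
    [/\ [/\ forall t, t \in [:: al; be; ga], table al <> table be,
            table al <> table ga & table be <> table ga],
        lang (control E) = range rho,
        forall v, ~ table be (inr v) [::],
        forall v, table ga (inr v) !=set0
      & forall n w, rewrites (rho n) [:: inr (start E)] w ->
          exists2 K, n <= K &
            forall k, K <= k -> rewrites (rho k) [:: inr (start E)] w].

End Grammar.

(** A model of effective computation: the partial recursive functions on binary
    trees, a Turing-complete analogue of the recursive functions on [nat].
    [Rec] is primitive recursion on the second component of a pair, the first
    one being a parameter; [While] is unbounded iteration. *)

Inductive data := Nil | Pair of data & data.

Definition hd x := if x is Pair y _ then y else Nil.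
Definition tl x := if x is Pair _ y then y else Nil.

Inductive prog :=
  | Id | Quote of data | Hd | Tl
  | Cons of prog & prog
  | Comp of prog & prog
  | If of prog & prog & prog
  | Rec of prog & prog
  | While of prog & prog.

Inductive computes : prog -> data -> data -> Prop :=
  | ev_id x : computes Id x x
  | ev_quote c x : computes (Quote c) x c
  | ev_hd x : computes Hd x (hd x)
  | ev_tl x : computes Tl x (tl x)
  | ev_cons P Q x y z :
      computes P x y -> computes Q x z -> computes (Cons P Q) x (Pair y z)
  | ev_comp P Q x y z :
      computes Q x y -> computes P y z -> computes (Comp P Q) x z
  | ev_if_nil B P Q x y :
      computes B x Nil -> computes Q x y -> computes (If B P Q) x y
  | ev_if_pair B P Q x b b' y :
      computes B x (Pair b b') -> computes P x y -> computes (If B P Q) x y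
  | ev_rec_nil P Q p y :
      computes P p y -> computes (Rec P Q) (Pair p Nil) y
  | ev_rec_pair P Q p x1 x2 y1 y2 y :
      computes (Rec P Q) (Pair p x1) y1 ->
      computes (Rec P Q) (Pair p x2) y2 ->
      computes Q (Pair p (Pair (Pair x1 x2) (Pair y1 y2))) y ->
      computes (Rec P Q) (Pair p (Pair x1 x2)) y
  | ev_while_nil B P x :
      computes B x Nil -> computes (While B P) x x
  | ev_while_pair B P x b b' y z :
      computes B x (Pair b b') -> computes P x y ->
      computes (While B P) y z -> computes (While B P) x z.

Lemma computes_det P x y z : computes P x y -> computes P x z -> y = z.
Proof.
move=> Py; elim: Py z => {P x y}.
1-4: by move=> > H; inversion H.
- by move=> > _ IH1 _ IH2 z' H; inversion H; subst; f_equal; auto.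
- move=> > _ IH1 _ IH2 z' H; inversion H; subst; apply: IH2.
  by match goal with K : computes _ _ ?m |- _ => rewrite -?(IH1 _ K) end;
     match goal with K : computes _ _ _, L : computes _ _ _ |- _ =>
       by rewrite (IH1 _ K) || by rewrite (IH1 _ L) end.
- move=> > _ IH1 _ IH2 z' H; inversion H; subst; first exact: IH2.
  by match goal with K : computes _ _ (Pair _ _) |- _ => by have := IH1 _ K end.
- move=> > _ IH1 _ IH2 z' H; inversion H; subst; last exact: IH2.
  by match goal with K : computes _ _ Nil |- _ => by have := IH1 _ K end.
- by move=> > _ IH z' H; inversion H; subst; exact: IH.
- move=> P Q p x1 x2 y1 y2 y _ IH1 _ IH2 _ IH3 z' H; inversion H; subst.
  apply: IH3.
  by rewrite (IH1 y0) // (IH2 y3).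
- move=> > _ IH1 z' H; inversion H; subst=> //.
  by match goal with K : computes _ _ (Pair _ _) |- _ => by have := IH1 _ K end.
- move=> B P x b b' y z _ IH1 _ IH2 _ IH3 z' H; inversion H; subst.
    by match goal with K : computes _ _ Nil |- _ => by have := IH1 _ K end.
  by apply: IH3; rewrite (IH2 y0).
Qed.

Definition enc_nat (n : nat) : data := iter n (Pair Nil) Nil.
Definition enc_ord n (i : 'I_n) : data := enc_nat i.
Definition enc_seq A (e : A -> data) (s : seq A) : data :=
  foldr (fun x => Pair (e x)) Nil s.
(** A map on ['I_n] is encoded by the list of its values. *)
Definition enc_map n A (e : A -> data) (f : 'I_n -> A) : data :=
  enc_seq e (map f (enum 'I_n)).
Definition enc_sum A B (eA : A -> data) (eB : B -> data) (x : A + B) : data :=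
  match x with
  | inl a => Pair Nil (eA a)
  | inr b => Pair (Pair Nil Nil) (eB b)
  end.
Definition enc_prod A B (eA : A -> data) (eB : B -> data) (x : A * B) : data :=
  Pair (eA x.1) (eB x.2).

Fixpoint enc_regex A (e : A -> data) (r : regex A) : data :=
  match r with
  | Void => Pair (enc_nat 0) Nil
  | Eps => Pair (enc_nat 1) Nil
  | Chr x => Pair (enc_nat 2) (e x)
  | Alt r1 r2 => Pair (enc_nat 3) (Pair (enc_regex e r1) (enc_regex e r2))
  | Cat r1 r2 => Pair (enc_nat 4) (Pair (enc_regex e r1) (enc_regex e r2))
  | Star r1 => Pair (enc_nat 5) (enc_regex e r1)
  end.

Definition enc_et0l n (E : et0l 'I_n) : data :=
  Pair (enc_nat (nonterms E))
    (Pair (enc_map (fun f => enc_map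
              (enc_regex (enc_sum (@enc_ord n) (@enc_ord (nonterms E)))) f)
              (@rule _ E))
      (Pair (enc_regex (@enc_ord (ntables E)) (control E))
            (enc_ord (start E)))).

Definition enc_mealy d (M : mealy d) : data :=
  Pair (enc_map (fun f => enc_map
           (enc_prod (@enc_ord (nstates M)) (@enc_ord d)) f)
           (fun q c => (@next d M q c, @out d M q c)))
       (enc_ord (init M)).

Definition enc_input d n (M : 'I_n -> mealy d) (a b : seq 'I_d) : data :=
  Pair (enc_map (@enc_mealy d) M)
       (Pair (enc_seq (@enc_ord d) a) (enc_seq (@enc_ord d) b)).

Lemma enc_nat_inj : injective enc_nat.
Proof. by elim=> [|m IH] [|k] //= [/IH ->]. Qed.

Lemma enc_ord_inj n : injective (@enc_ord n).
Proof. by move=> i j /enc_nat_inj/val_inj. Qed.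

Lemma enc_seq_inj A (e : A -> data) : injective e -> injective (enc_seq e).
Proof. by move=> eI; elim=> [|x s IH] [|y t] //= [/eI -> /IH ->]. Qed.

Lemma enc_map_size n m A B (e : A -> data) (e' : B -> data)
  (f : 'I_n -> A) (f' : 'I_m -> B) : enc_map e f = enc_map e' f' -> n = m.
Proof.
suff sz k C (e0 : C -> data) (s : seq C) l D (e1 : D -> data) (t : seq D) :
    size s = k -> size t = l -> enc_seq e0 s = enc_seq e1 t -> k = l.
  by apply: sz; rewrite size_map size_enum_ord.
move=> <- <- {k l}; elim: s t => [|x s IH] [|y t] //= [_ E].
by rewrite (IH t).
Qed.

Lemma enc_map_inj n A (e : A -> data) : injective e -> injective (@enc_map n A e).
Proof.
move=> eI f f' /(enc_seq_inj eI)/eq_in_map E; apply/funext => i.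
by apply: E; rewrite mem_enum.
Qed.

Lemma enc_sum_inj A B (eA : A -> data) (eB : B -> data) :
  injective eA -> injective eB -> injective (enc_sum eA eB).
Proof. by move=> aI bI [x|x] [y|y] //= [] => [/aI|/bI] ->. Qed.

Lemma enc_prod_inj A B (eA : A -> data) (eB : B -> data) :
  injective eA -> injective eB -> injective (enc_prod eA eB).
Proof. by move=> aI bI [x y] [x' y'] /= [] /aI /= -> /bI /= ->. Qed.

Lemma enc_regex_inj A (e : A -> data) : injective e -> injective (enc_regex e).
Proof.
move=> eI; elim=> [||x|r1 IH1 r2 IH2|r1 IH1 r2 IH2|r1 IH1] [||y|s1 s2|s1 s2|s1] //=.
- by case=> /eI ->.
- by case=> /IH1 -> /IH2 ->.
- by case=> /IH1 -> /IH2 ->.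
- by case=> /IH1 ->.
Qed.

Lemma enc_et0l_inj n : injective (@enc_et0l n).
Proof.
move=> [nV nT tb ct st] [nV' nT' tb' ct' st'] [/enc_nat_inj /= nVE]; subst nV'.
move=> tbE; have /= nTE := enc_map_size tbE; subst nT'; move: tbE.
have rI := enc_regex_inj (enc_sum_inj (@enc_ord_inj n) (@enc_ord_inj nV)).
move=> /(enc_map_inj (enc_map_inj rI)) -> /(enc_regex_inj (@enc_ord_inj nT)) ->.
by move=> /enc_ord_inj ->.
Qed.

Lemma enc_mealy_inj d : injective (@enc_mealy d).
Proof.
move=> [s nx ou ini] [s' nx' ou' ini'] [E]; have /= sE := enc_map_size E; subst s'.
move: E => /(enc_map_inj (enc_map_inj (enc_prod_inj (@enc_ord_inj s) (@enc_ord_inj d)))) E.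
move=> /enc_ord_inj ->.
suff [-> ->] : nx = nx' /\ ou = ou' by [].
by split; apply/funext => q; apply/funext => c;
  have := congr1 (fun h => h q c) E => -[].
Qed.

Lemma enc_input_inj d n (M M' : 'I_n -> mealy d) a a' b b' :
  enc_input M a b = enc_input M' a' b' -> [/\ M = M', a = a' & b = b'].
Proof.
by case=> /(enc_map_inj (@enc_mealy_inj d)) -> /(enc_seq_inj (@enc_ord_inj d)) ->
  /(enc_seq_inj (@enc_ord_inj d)) ->.
Qed.

(* Main.v *)
Require Import Defs.
From mathcomp Require Import all_boot.
From mathcomp Require Import boolp classical_sets functions cardinality.

(** Cut words over the alphabet of the tree into blocks of one length, a common
    multiple of all the numbers up to a bound on the sizes of the automata and
    of [a] and [b]. On blocks, boundedness becomes rigid. If [s] is the section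
    of a generator at a nonempty word of blocks, then every block [z] satisfies
    s@z = s, or s@z@y = 1 for all blocks [y] ([cycle_or_finite]); and if s <> 1,
    then s@z = s for at most one block [z] ([cycle_uniq]). Otherwise two
    different cycles of sections could be traversed one after the other, and
    the number of nontrivial sections of one level would be unbounded
    ([no_pump]). Hence a vertex of level m + 3 at which some generator has a
    nontrivial section has the form u z^(m+1) t ([unmarked_triv]). Such
    vertices are called marked; the name [:: u; z; t] of a marked vertex does
    not depend on [m]. The prefixes of the ray are marked, with z = t.

    A word of generators traces a path in the graph of the action on level
    m + 3. Cut it at its visits to marked vertices. A piece either is one edge
    with a nontrivial section, or runs from one marked vertex to the next one
    along edges with trivial sections. The nonterminal (p, q) stands for the
    pieces of the second kind from [p] to [q]; if [q] is missing, the piece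
    ends at an unmarked vertex. The vertices of the next level are v c with [v]
    of the present level and [c] a block, and an edge with trivial section
    leaves [c] unchanged. Therefore a piece (p, q) of the next level cuts
    uniquely into pieces of the present level and edges whose section is
    nontrivial at [v] and trivial at v c. The possible sequences label the paths
    of a finite graph on words of four blocks, the same for all [m], because
    the middle part z^(m+1) can be stretched ([special_stretch]). Kleene's
    construction turns these paths into the table beta ([beta_decomp]). At
    level 3 every vertex is marked, so a piece is one edge: this is gamma.

    The table alpha cuts the whole path. For the complement it allows the paths
    from the prefix of the ray to another vertex ([alpha_decomp]). For the
    stabiliser it allows the loops through vertices u z^(m+2) whose pieces keep
    [z]; such a loop fixes the ray itself, not only a prefix ([wp_sound]).
    Conversely, the image of the ray under a word of length l is constant after
    1 + 2l blocks, so that for large [m] every loop at a prefix of the ray is of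
    this kind ([wp_complete]).

    Since cutting is forced, there is one derivation tree for each word
    ([parse_uniq], [tree_uniq]). Limiting also concerns words that contain
    nonterminals, and gamma must have no empty value. Both are arranged by
    letting gamma keep a nonterminal as a possible result and by reading a
    nonterminal (p, q) as one more, partially defined, generator: it replaces
    the first three blocks [p] by [q] and has a trivial section, or it leads to
    an absorbing sink if [q] is missing. All of the above holds for words over
    this larger alphabet, and then limiting says that a word which moves a
    prefix of the ray moves all longer ones, and that a word which fixes the ray
    fixes all its prefixes.

    The grammar is computed from the automata by list functions defined with
    folds. Closure lemmas ([computable_foldr] and its consequences) produce the
    programs; each rule is a finite union of matrix entries of Kleene's
    construction. *)

Local Open Scope classical_set_scope.

Set Implicit Arguments.
Unset Strict Implicit.
Unset Printing Implicit Defensive.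

(** * Walks in deterministic labelled graphs *)

Section Walks.
Variables (N S : eqType) (move : S -> N -> N).
Implicit Types (enabled : S -> N -> bool) (ok : pred N) (a b k : N) (s : S) (us : seq S).

(** A walk in a deterministic graph is given by its start and its labels. The
    predicate [ok] restricts the interior vertices only. The empty word has no
    endpoint: first returns to a set of vertices, the main use, are nonempty. *)
Fixpoint endpoint (enabled : S -> N -> bool) (ok : pred N) us a : option N :=
  if us is s :: us' then
    if enabled s a then
      let a' := move s a in
      if us' is [::] then Some a'
      else if ok a' then endpoint enabled ok us' a' else None
    else None
  else None.

Lemma endpoint_cons enabled ok s us a : us != [::] ->
  endpoint enabled ok (s :: us) a =
    if enabled s a && ok (move s a) then endpoint enabled ok us (move s a) else None.
Proof. by case: us => [|t us] //= _; case: (enabled s a). Qed.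

Lemma endpoint_nilN enabled ok us a b : endpoint enabled ok us a = Some b -> us != [::].
Proof. by case: us. Qed.

Lemma endpoint_consP enabled ok s us a b : endpoint enabled ok (s :: us) a = Some b ->
  enabled s a /\ ((us = [::] /\ b = move s a) \/
             (ok (move s a) /\ endpoint enabled ok us (move s a) = Some b)).
Proof.
case: us => [|t us]; first by rewrite /=; case: (enabled s a) => // -[<-]; split=> //; left.
rewrite endpoint_cons //; case: (enabled s a) => //=; case: ifP => // o h.
by split=> //; right.
Qed.

Lemma endpoint_cons1 enabled ok s a : enabled s a -> endpoint enabled ok [:: s] a = Some (move s a).
Proof. by move=> /= ->. Qed.

Lemma endpoint_consS enabled ok s us a b : enabled s a -> ok (move s a) ->
  endpoint enabled ok us (move s a) = Some b -> endpoint enabled ok (s :: us) a = Some b.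
Proof.
move=> es o h; have un := endpoint_nilN h.
by rewrite endpoint_cons // es o.
Qed.

Lemma endpoint_cat enabled ok us1 us2 a k b :
  endpoint enabled ok us1 a = Some k -> ok k -> endpoint enabled ok us2 k = Some b ->
  endpoint enabled ok (us1 ++ us2) a = Some b.
Proof.
elim: us1 a => [|s us1 IH] a //= /endpoint_consP [es [[-> kE]|[o h]]] ok_k h2.
  by apply: endpoint_consS => //; rewrite -kE.
by apply: endpoint_consS => //; exact: IH.
Qed.

Lemma endpoint_catP enabled ok us1 us2 a b : us1 != [::] -> us2 != [::] ->
  endpoint enabled ok (us1 ++ us2) a = Some b ->
  exists k, [/\ endpoint enabled ok us1 a = Some k, ok k & endpoint enabled ok us2 k = Some b].
Proof.
elim: us1 a => [|s us1 IH] a // _ n2 /= /endpoint_consP [es].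
case: us1 IH => [|t us1] IH.
  by case=> [[/= E _]|[o h]]; [rewrite E in n2 | exists (move s a); rewrite /= es].
case=> [[]//|[o h]].
have [k [h1 ok_k h2]] := IH _ isT n2 h.
by exists k; split=> //; rewrite es o.
Qed.

Lemma endpoint_mono (enabled en' : S -> N -> bool) (ok ok' : pred N) us a b :
  (forall s c, enabled s c -> en' s c) -> (forall c, ok c -> ok' c) ->
  endpoint enabled ok us a = Some b -> endpoint en' ok' us a = Some b.
Proof.
move=> ee oo; elim: us a => [|s us IH] a // /endpoint_consP [es [[-> ->]|[o h]]].
  by apply: endpoint_cons1; exact: ee.
by apply: endpoint_consS; [exact: ee | exact: oo | exact: IH].
Qed.

End Walks.

(** * Kleene's construction *)

Section Kleene.
Variables (N : eqType) (S : eqType) (enabled : S -> N -> bool) (move : S -> N -> N).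
Variable syms : seq S.
Implicit Types (a b k : N) (l : seq N) (us : seq S).

Definition edge a b : regex S :=
  foldr (fun s r => if enabled s a && (move s a == b) then Alt (Chr s) r else r)
        Void syms.

Lemma lang_edge a b us : lang (edge a b) us <->
  exists s, [/\ s \in syms, us = [:: s], enabled s a & move s a = b].
Proof.
rewrite /edge; elim: syms => [|t ss IH] /=; first by split=> [[]|[s []]].
case: ifP => [/andP [et /eqP mt]|etN].
  split=> [[/= ->|/IH [s [ss_s -> es ms]]]|[s [+ usE es ms]]].
  - by exists t; rewrite mem_head.
  - by exists s; rewrite inE ss_s orbT.
  - rewrite inE => /orP [/eqP <-|ss_s]; first by left.
    by right; apply/IH; exists s.
split=> [/IH [s [ss_s -> es ms]]|[s [+ usE es ms]]].
  by exists s; rewrite inE ss_s orbT.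
rewrite inE => /orP [/eqP sE|ss_s]; last by apply/IH; exists s.
by move: etN; rewrite -sE es ms eqxx.
Qed.

Fixpoint kleene l a b : regex S :=
  if l is k :: l' then
    Alt (kleene l' a b) (Cat (kleene l' a k) (Cat (Star (kleene l' k k)) (kleene l' k b)))
  else edge a b.

(** A walk is cut at all its visits to [k]. *)
Lemma endpoint_split k l us a b :
  endpoint move enabled [in k :: l] us a = Some b ->
  endpoint move enabled [in l] us a = Some b \/
  exists us1 uss us2, [/\ us = us1 ++ (flatten uss ++ us2),
    endpoint move enabled [in l] us1 a = Some k,
    List.Forall (fun v => endpoint move enabled [in l] v k = Some k) uss
    & endpoint move enabled [in l] us2 k = Some b].
Proof.
elim: us a => [|s us IH] a // /endpoint_consP [es [[-> ->]|[+ h]]].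
  by left; exact: endpoint_cons1.
rewrite inE => /orP [/eqP mk|ml].
  right; rewrite mk in h; have [h1|[v1 [vs [v2 [-> h1 hs h2]]]]] := IH _ h.
    by exists [:: s], [::], us; rewrite /= es mk.
  exists [:: s], (v1 :: vs), v2; rewrite /= es mk catA; split=> //.
  by constructor.
have [h1|[v1 [vs [v2 [-> h1 hs h2]]]]] := IH _ h.
  by left; apply: endpoint_consS.
by right; exists (s :: v1), vs, v2; split=> //; apply: endpoint_consS.
Qed.

Hypothesis symsP : forall s, s \in syms.

Lemma lang_kleene l a b us : lang (kleene l a b) us <-> endpoint move enabled [in l] us a = Some b.
Proof.
elim: l a b us => [|k l IH] a b us /=.
  rewrite lang_edge; split=> [[s [_ -> es <-]]|].
    by rewrite /= es.
  case: us => // s us /endpoint_consP [es [[-> ->]|[]//]].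
  by exists s.
have sub c : c \in l -> c \in k :: l by rewrite inE orbC => ->.
have weak us0 c e : endpoint move enabled [in l] us0 c = Some e ->
    endpoint move enabled [in k :: l] us0 c = Some e by exact: endpoint_mono.
split.
  case=> [/IH /weak //|[us1 /IH/weak h1 [_ [_ [uss hs <-] [us3 /IH/weak h3 <-]] <-]]].
  have kk : k \in k :: l by exact: mem_head.
  apply: (endpoint_cat h1 kk).
  elim: hs => [|v vs /IH/weak hv _ h] //=.
  by rewrite -catA; exact: (endpoint_cat hv kk h).
move=> /endpoint_split [/IH|[us1 [uss [us2 [-> h1 hs h2]]]]]; first by left.
right; exists us1; first exact/IH.
exists (flatten uss ++ us2) => //; exists (flatten uss).
  by exists uss => //; apply: List.Forall_impl hs => v /IH.
by exists us2 => //; exact/IH.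
Qed.

Fixpoint alts (rs : seq (regex S)) := if rs is r :: rs' then Alt r (alts rs') else Void.

Lemma lang_alts (T : eqType) (f : T -> regex S) (s : seq T) us :
  lang (alts [seq f x | x <- s]) us <-> exists2 x, x \in s & lang (f x) us.
Proof.
elim: s => [|y s IH] /=; first by split=> // -[].
split=> [[h|/IH [x xs h]]|[x + h]].
- by exists y; rewrite ?mem_head.
- by exists x => //; rewrite inE xs orbT.
- by rewrite inE => /orP [/eqP <-|xs]; [left | right; apply/IH; exists x].
Qed.

(** In [kleene] the endpoints vary in the recursive calls. The matrix of all
    expressions for one list of interior vertices is computed by a plain fold
    instead, which is what [computable_kleene_matrix] needs. *)
Definition lookup (M : seq ((N * N) * regex S)) (ab : N * N) : regex S :=
  foldr (fun e r => if e.1 == ab then e.2 else r) Void M.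

Definition elim_node (k : N) (M : seq ((N * N) * regex S)) :=
  [seq (e.1, Alt (lookup M e.1)
         (Cat (lookup M (e.1.1, k))
              (Cat (Star (lookup M (k, k))) (lookup M (k, e.1.2))))) | e <- M].

Definition edge_matrix (nodes : seq N) :=
  [seq ((a, b), edge a b) | a <- nodes, b <- nodes].

Definition kleene_matrix nodes l := foldr elim_node (edge_matrix nodes) l.

Lemma lookup_map (ks : seq (N * N)) (f : N * N -> regex S) ab :
  ab \in ks -> lookup [seq (e, f e) | e <- ks] ab = f ab.
Proof.
elim: ks => [|e ks IH] //=; rewrite inE eq_sym.
by case: eqP => [->|] //= _; exact: IH.
Qed.

Lemma kleene_matrixE nodes l : {subset l <= nodes} ->
  kleene_matrix nodes l =
    [seq (e, kleene l e.1 e.2) | e <- [seq (a, b) | a <- nodes, b <- nodes]].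
Proof.
elim: l => [|k l IH] ln.
  by rewrite /= /edge_matrix map_allpairs.
have kn : k \in nodes by rewrite ln ?mem_head.
rewrite /= -/(kleene_matrix nodes l) IH => [|c cl]; last by rewrite ln // inE cl orbT.
rewrite /elim_node -map_comp; apply/eq_in_map => -[a b] /allpairsP [[a' b'] /= [an bn [-> ->]]].
congr (_, _); congr Alt; rewrite ?lookup_map //=; apply/allpairsP;
 by [exists (a', b') | exists (a', k) | exists (k, k) | exists (k, b')].
Qed.

Lemma lookup_kleene nodes l a b : {subset l <= nodes} -> a \in nodes -> b \in nodes ->
  lookup (kleene_matrix nodes l) (a, b) = kleene l a b.
Proof.
move=> ln an bn; rewrite kleene_matrixE // lookup_map //=.
by apply/allpairsP; exists (a, b).
Qed.

End Kleene.

(** * Mealy machines *)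

Section Mealy.
Variables (Q A B : Type) (step : Q -> A -> Q * B).

Definition transduce q u : Q * seq B :=
  foldl (fun s a => let r := step s.1 a in (r.1, rcons s.2 r.2)) (q, [::]) u.

Lemma transduce_cons q a u : transduce q (a :: u) =
  ((transduce (step q a).1 u).1, (step q a).2 :: (transduce (step q a).1 u).2).
Proof.
rewrite /transduce /=; move: (step q a) => [q' b] /=.
suff aux w : foldl (fun s a => let r := step s.1 a in (r.1, rcons s.2 r.2)) (q', w) u =
    ((transduce q' u).1, w ++ (transduce q' u).2) by rewrite (aux [:: b]).
rewrite /transduce; elim/last_ind: u => [|u c IH] /=; first by rewrite cats0.
by rewrite !foldl_rcons IH /= rcons_cat.
Qed.

Lemma transduce_cat q u v : transduce q (u ++ v) =
  ((transduce (transduce q u).1 v).1, (transduce q u).2 ++ (transduce (transduce q u).1 v).2).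
Proof.
elim: u q => [|a u IH] q; first by rewrite /=; case: (transduce q v).
by rewrite cat_cons !transduce_cons IH.
Qed.

Lemma size_transduce q u : size (transduce q u).2 = size u.
Proof. by elim: u q => [|a u IH] q //; rewrite transduce_cons /= IH. Qed.

End Mealy.

Lemma transduce_id (Q A : Type) (step : Q -> A -> Q * A) q :
  (forall c, step q c = (q, c)) -> forall u, transduce step q u = (q, u).
Proof. by move=> h; elim=> [|a u IH] //; rewrite transduce_cons h IH. Qed.

Lemma drop_catl (A : Type) n (v e : seq A) : n <= size v -> drop n (v ++ e) = drop n v ++ e.
Proof.
move=> nv; rewrite drop_cat; case: ltnP => // vn.
by rewrite (drop_oversize vn) (eqP (_ : n - size v == 0)) ?drop0 // subn_eq0.
Qed.

(** * Marked vertices of a bounded action on words of blocks *)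

Section Core.
Variables (D I Q W : eqType) (d0 : D) (step : Q -> D -> Q * D) (triv : pred Q).
Variables (init : I -> Q) (src dst : W -> seq D).
Implicit Types (x : I) (w : W) (s : I + W) (us ws : seq (I + W)) (b v e : seq D).

(** Letters of [D] are blocks, and [x : I] acts on words of blocks as the state
    [init x] of a Mealy machine; the states in [triv] act trivially. The extra
    symbol [w : W] replaces the prefix [src w] by [dst w]; the empty word serves
    as the sink, reached when [dst w] is empty. *)
Definition run x v := (transduce step (init x) v).1.
Definition out x v := (transduce step (init x) v).2.

Definition move s v :=
  match s with
  | inl x => out x v
  | inr w => if dst w == [::] then [::] else dst w ++ drop 3 v
  end.

Definition defined_at s v :=
  match s with
  | inl x => v != [::]
  | inr w => take 3 v == src w
  end.

(** The four graphs in use differ in the letters that they allow at a vertex.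
    With [sp], the section after three blocks must be nontrivial; with [et],
    the section at the whole vertex must be trivial. Thus [enabled false false]
    is the full action and [enabled false true] its part with trivial sections,
    while [enabled true _] is for the finite graphs, where the edges with a
    trivial section after three blocks are represented by the symbols of [W]. *)
Definition enabled (sp et : bool) s v :=
  defined_at s v && match s with
    | inl x => (sp ==> ~~ triv (run x (take 3 v))) && (et ==> triv (run x v))
    | inr _ => true end.

(** Maps [:: u, z & e] to u z^(m+1) e; so [m = 0] changes nothing. *)
Definition stretch m b := nth d0 b 0 :: nseq m.+1 (nth d0 b 1) ++ drop 2 b.
(** The three-block name of a marked vertex of level m + 3, and [::] for any
    other word; the convention matches that for [dst]. *)
Definition mark m v :=
  let q := [:: nth d0 v 0; nth d0 v 1; last d0 v] in
  if v == stretch m q then q else [::].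
Definition unmarked m v := mark m v == [::].

(** The labels of the pieces that start at [v] and end at the marked vertex
    with name [o], or unmarked if [o] is empty. With [sp] they are replaced by
    the corresponding walks of the finite graph. *)
Definition first_return m (sp : bool) ws v o :=
  exists2 v', endpoint move (enabled sp true) (unmarked m) ws v = Some v' & mark m v' = o.
Definition sym_lang m s ws :=
  match s with
  | inl x => ws = [:: s]
  | inr w => first_return m false ws (stretch m (src w)) (dst w)
  end.

Variable good : pred D.
Hypothesis triv_step : forall q c, triv q -> step q c = (q, c).
Hypothesis step_ok : forall q c, good c -> good (step q c).2.
(** [settle] and [cycle_block] are the two consequences of boundedness on which
    everything rests. *)
Hypothesis settle : forall x v z y, v != [::] -> all good v -> good z -> good y ->
  (step (run x v) z).1 = run x v \/ triv (step (step (run x v) z).1 y).1.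
Hypothesis cycle_block : forall x u z y, good u -> good z -> good y ->
  (step (run x [:: u]) z).1 = run x [:: u] ->
  (step (run x [:: u]) y).1 = run x [:: u] -> ~~ triv (run x [:: u]) -> y = z.
Hypothesis src_size : forall w, size (src w) = 3.
Hypothesis src_ok : forall w, all good (src w).
Hypothesis dst_size : forall w, dst w != [::] -> size (dst w) = 3.
Hypothesis dst_ok : forall w, all good (dst w).
Hypothesis pair_exists : forall p o, size p = 3 -> all good p ->
  (o = [::] \/ size o = 3 /\ all good o) -> exists2 w, src w = p & dst w = o.
Hypothesis pair_inj : forall w w', src w = src w' -> dst w = dst w' -> w = w'.

Lemma run_triv q v : triv q -> transduce step q v = (q, v).
Proof. by move=> tq; apply: transduce_id => c; exact: triv_step. Qed.

Lemma run_cons x u v : run x (u :: v) = (transduce step (run x [:: u]) v).1.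
Proof. by rewrite /run !transduce_cons. Qed.

Lemma out_cons x u v : out x (u :: v) = (step (init x) u).2 :: (transduce step (run x [:: u]) v).2.
Proof. by rewrite /run /out !transduce_cons. Qed.

Lemma run_consE x u : exists s0 : Q, [/\ run x [:: u] = s0,
  forall v, run x (u :: v) = (transduce step s0 v).1
  & forall v, out x (u :: v) = (step (init x) u).2 :: (transduce step s0 v).2].
Proof. by exists (run x [:: u]); split=> // v; [exact: run_cons | exact: out_cons]. Qed.

Lemma run_cat x u v : run x (u ++ v) = (transduce step (run x u) v).1.
Proof. by rewrite /run transduce_cat. Qed.

Lemma run_rcons x u c : run x (rcons u c) = (step (run x u) c).1.
Proof. by rewrite -cats1 run_cat transduce_cons. Qed.

Lemma out_cat x u v : out x (u ++ v) = out x u ++ (transduce step (run x u) v).2.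
Proof. by rewrite /run /out transduce_cat. Qed.

Lemma size_out x v : size (out x v) = size v.
Proof. exact: size_transduce. Qed.

Lemma transduce_ok q v : all good v -> all good (transduce step q v).2.
Proof.
elim: v q => [|c v IH] q //= /andP [c_ok v_ok].
by rewrite transduce_cons /= step_ok // IH.
Qed.

Lemma move_ok s v : all good v -> all good (move s v).
Proof.
case: s => [x|w] /= v_ok; first exact: transduce_ok.
case: eqP => // _; rewrite all_cat dst_ok; apply/allP => c /mem_drop.
exact: allP.
Qed.

Lemma defined_at_sink s : defined_at s [::] = false.
Proof. by case: s => [x|w] //=; apply/eqP => E; have := src_size w; rewrite -E. Qed.

Lemma endpoint_sink sp et ok us : endpoint move (enabled sp et) ok us [::] = None.
Proof. by case: us => [|s us] //=; rewrite /enabled defined_at_sink. Qed.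

Lemma size_move s v : 2 < size v -> move s v != [::] -> size (move s v) = size v.
Proof.
case: s => [x|w] /= sv; first by rewrite size_out.
case: (dst w =P [::]) => [//|/eqP dw] _; rewrite size_cat size_drop dst_size //.
by rewrite subnKC.
Qed.

Definition live_cat v e := if v is [::] then [::] else v ++ e.

Lemma live_catE v e : v != [::] -> live_cat v e = v ++ e.
Proof. by case: v. Qed.

(** An edge with trivial section moves only the front part of a longer vertex. *)
Lemma interior_cat et s v e : 2 < size v -> enabled false true s v ->
  enabled false et s (v ++ e) /\ move s (v ++ e) = live_cat (move s v) e.
Proof.
rewrite /enabled; case: s => [x|w] /= sv.
  case/andP => vn tv; rewrite run_cat run_triv // tv implybT andbT; split.
    by case: v vn {sv tv}.
  rewrite out_cat run_triv //= live_catE //.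
  by rewrite -size_eq0 size_out size_eq0.
rewrite !andbT => /eqP tE; rewrite takel_cat // tE eqxx; split=> //.
case: (dst w =P [::]) => [//|/eqP dn]; rewrite live_catE ?drop_catl ?catA //.
by rewrite -size_eq0 size_cat addn_eq0 negb_and size_eq0 dn.
Qed.

Lemma run_nseq q z k : (step q z).1 = q -> (transduce step q (nseq k z)) = (q, nseq k (step q z).2).
Proof. by move=> E; elim: k => [|k IH] //; rewrite [nseq _ _]/= transduce_cons E IH. Qed.

Lemma triv_transduce q v : triv q -> triv (transduce step q v).1.
Proof. by move=> tq; rewrite run_triv. Qed.

(** If the state reached after [u] is not fixed by [z], it dies within two more
    blocks, and each u z^(m+1) y has at least two blocks after [u]. *)
Lemma cycles_or_triv x u z y : good u -> good z -> good y ->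
  (step (run x [:: u]) z).1 = run x [:: u] \/
  forall m, triv (run x (stretch m [:: u; z; y])).
Proof.
move=> uo zo yo; have uok : all good [:: u] by rewrite /= uo.
have [|tz] := settle x (isT : [:: u] != [::]) uok zo zo; first by left.
have [|ty] := settle x (isT : [:: u] != [::]) uok zo yo; first by left.
right=> -[|m]; rewrite /stretch /= run_cons !transduce_cons /=; first by rewrite ty.
exact: triv_transduce.
Qed.

Lemma stretch0 u z e : stretch 0 [:: u, z & e] = [:: u, z & e].
Proof. by rewrite /stretch /= drop0. Qed.

Lemma stretchE m u z e : stretch m [:: u, z & e] = u :: nseq m.+1 z ++ e.
Proof. by rewrite /stretch /= drop0. Qed.

(** A nontrivial section at u z y forces the state after [u] to be fixed by [z];
    then repeating [z] changes neither the section nor, up to the same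
    repetition, the image. This is why one finite graph serves all levels. *)
Lemma special_stretch x u z y e m : good u -> good z -> good y ->
  ~~ triv (run x [:: u; z; y]) ->
  [/\ run x (stretch m [:: u, z, y & e]) = run x [:: u, z, y & e],
      out x (stretch m [:: u, z, y & e]) = stretch m (out x [:: u, z, y & e])
    & (step (run x [:: u]) z).1 = run x [:: u]].
Proof.
move=> uo zo yo nt.
have [E|/(_ 0)] := cycles_or_triv x uo zo yo; last by rewrite stretch0 (negbTE nt).
have [s0 [s0E R O]] := run_consE x u; rewrite s0E in E *.
rewrite !stretchE !R !O !transduce_cat run_nseq //=.
split=> //; first by rewrite [in RHS]transduce_cons /= E.
by rewrite (transduce_cons _ _ z) E /stretch /= drop0.
Qed.

Lemma triv_stretch x p m : size p = 3 -> all good p ->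
  triv (run x (stretch m p)) = triv (run x p).
Proof.
case: p => [|u [|z [|y []]]] //= _ /and4P [uo zo yo _].
have [E|T] := cycles_or_triv x uo zo yo.
  have [s0 [s0E R _]] := run_consE x u; rewrite s0E in E *.
  by rewrite stretchE !R transduce_cat run_nseq //= E.
by rewrite T -(T 0) stretch0.
Qed.

Lemma stretch_inj m b b' : 2 < size b -> 2 < size b' -> stretch m b = stretch m b' -> b = b'.
Proof.
case: b => [|u [|z e]] //; case: b' => [|u' [|z' e']] // _ _.
by rewrite !stretchE /= => -[-> -> /eqP]; rewrite eqseq_cat // eqxx => /eqP ->.
Qed.

Lemma size_stretch m b : 1 < size b -> size (stretch m b) = m + size b.
Proof.
case: b => [|u [|z e]] // _; rewrite stretchE /= size_cat size_nseq.
by rewrite !addnS.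
Qed.

Lemma stretch_cat m b e : 1 < size b -> stretch m (b ++ e) = stretch m b ++ e.
Proof. by case: b => [|u [|z b]] // _; rewrite 2!cat_cons !stretchE catA. Qed.

Lemma stretch_ok m b : 1 < size b -> all good (stretch m b) = all good b.
Proof.
case: b => [|u [|z e]] // _; rewrite stretchE /= all_cat all_nseq.
by case: (good u); case: (good z) => //=; case: m.
Qed.

Lemma mark_stretch m p : size p = 3 -> mark m (stretch m p) = p.
Proof.
case: p => [|u [|z [|y []]]] // _; rewrite /mark stretchE /= last_cat /=.
by rewrite stretchE eqxx.
Qed.

Lemma mark_inv m v : mark m v != [::] -> size (mark m v) = 3 /\ v = stretch m (mark m v).
Proof. by rewrite /mark; case: ifP => // /eqP. Qed.

Lemma mark_nil m : mark m [::] = [::].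
Proof. by rewrite /mark /stretch. Qed.

Lemma mark_eq m v q : q != [::] -> mark m v = q -> v = stretch m q.
Proof. by move=> qn E; move: qn; rewrite -E => /mark_inv []. Qed.

Lemma stretch_succ m u z y : stretch m.+1 [:: u; z; y] = stretch m [:: u; z; z; y].
Proof. by rewrite !stretchE -[m.+2]addn1 nseqD -catA. Qed.

(** Among the children of the marked vertex u z^(m+1) y, all are marked if
    y = z and none otherwise. *)
Lemma mark_succ m p c : size p = 3 -> mark m.+1 (rcons (stretch m p) c) =
  if nth d0 p 2 == nth d0 p 1 then [:: nth d0 p 0; nth d0 p 1; c] else [::].
Proof.
case: p => [|u [|z [|y []]]] // _.
rewrite stretchE /mark last_rcons /= stretchE -cats1 /= -catA.
suff -> : ([:: u, z & nseq m z ++ [:: y] ++ [:: c]] ==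
           [:: u, z, z & nseq m z ++ [:: c]]) = (y == z) by [].
have -> : z :: (nseq m z ++ [:: c]) = nseq m z ++ [:: z] ++ [:: c].
  by rewrite -[LHS]/(nseq m.+1 z ++ [:: c]) -[m.+1]addn1 nseqD -catA.
by rewrite !eqseq_cons !eqxx /= eqseq_cat // eqxx /= eqseq_cons eqxx andbT.
Qed.

(** A prefix of a marked vertex is marked. *)
Lemma mark_succ_unmarked m v c : mark m v = [::] -> mark m.+1 (rcons v c) = [::].
Proof.
move=> nv; apply/eqP; apply: contra_eqT nv => /mark_inv [].
case: (mark _ _) => [|u [|z [|y []]]] // _; rewrite stretch_succ.
rewrite -[[:: u; z; z; y]]/([:: u; z; z] ++ [:: y]) stretch_cat // cats1.
by move=> /rcons_inj [-> _]; rewrite mark_stretch.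
Qed.

(** Along a nontrivial section every block but the last fixes the state reached
    after the first block, by [settle]; by [cycle_block] these blocks agree. *)
Lemma unmarked_triv m x v : size v = m + 3 -> all good v -> mark m v = [::] ->
  triv (run x v).
Proof.
move=> sv vo nv; apply: contra_eqT nv => nt.
case: v sv vo nt => [|u v]; first by rewrite addn3.
rewrite addnS => -[]; elim/last_ind: v => [|v t _]; first by rewrite addn2.
rewrite size_rcons addnS => -[]; rewrite addn1 => sv /= /andP [uo].
rewrite all_rcons => /andP [ok_t vo]; rewrite run_cons => nt.
have uok : all good [:: u] by rewrite /= uo.
have ns0 : ~~ triv (run x [:: u]) by apply: contra nt => /triv_transduce.
have fixall : forall r, all good r -> ~~ triv (transduce step (run x [:: u]) (rcons r t)).1 ->
    forall y, y \in r -> (step (run x [:: u]) y).1 = run x [:: u].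
  elim=> [|y r IH] // /= /andP [yo ro]; rewrite transduce_cons /= => ntr.
  have E : (step (run x [:: u]) y).1 = run x [:: u].
    case: r ro ntr {IH} => [|y2 r] /= ro ntr.
      have [//|tr] := settle x (isT : [:: u] != [::]) uok yo ok_t.
      by move: ntr; rewrite /= tr.
    have [//|tr] := settle x (isT : [:: u] != [::]) uok yo (proj1 (andP ro)).
    by move: ntr; rewrite transduce_cons /= triv_transduce.
  move=> y'; rewrite inE => /orP [/eqP ->//|]; apply: IH => //.
  by rewrite E in ntr.
have fx := fixall _ vo nt.
case: v sv vo fx {nt fixall} => [|z v] // [sv] /= /andP [zo vo] fx.
have vE : v = nseq m z.
  rewrite -sv; apply/all_pred1P/allP => y yv /=; apply/eqP.
  apply: (cycle_block uo zo (allP vo _ yv) _ _ ns0); apply: fx; rewrite inE ?eqxx // yv.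
  by rewrite orbT.
rewrite vE -[_ :: _](_ : stretch m [:: u; z; t] = _) ?mark_stretch //.
by rewrite stretchE /= cats1.
Qed.

(** * Cutting a walk at the marked vertices *)

Section Parse.
(** A vertex of the long graph is a vertex of level m + 3 followed by [k] blocks;
    it corresponds to a vertex of 3 + k blocks of the finite graph. The table
    alpha uses [k = 0] and beta uses [k = 1]. *)
Variables (m k : nat) (et : bool) (okn okb : pred (seq D)).
(** Where a walk may end but not be cut: the sink and unmarked vertices. In the
    finite graph both become the sink. *)
Definition dead v := v = [::] \/ exists v1 e, [/\ v = v1 ++ e, size v1 = m + 3, size e = k & mark m v1 = [::]].
Hypothesis ok_st : forall b, size b = 3 + k -> all good b -> okb (stretch m b) = okn b.
Hypothesis ok_dead : forall v, dead v -> okb v.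

Definition tracks b v := if b is [::] then dead v else v = stretch m b.

Lemma first_return_lift ws v v' e : size v = m + 3 -> all good v -> size e = k ->
  endpoint move (enabled false true) (unmarked m) ws v = Some v' ->
  endpoint move (enabled false et) okb ws (v ++ e) = Some (live_cat v' e).
Proof.
move=> sv vo se; elim: ws v sv vo => [|s ws IH] v sv vo // /endpoint_consP [].
have s3 : 2 < size v by rewrite sv addn3.
move=> /(interior_cat et e s3) [es mE] [[-> ->]|[/eqP nm h]].
  by rewrite endpoint_cons1 // mE.
case: (altP (move s v =P [::])) => [E|mn]; first by rewrite E endpoint_sink in h.
have sE := size_move s3 mn.
rewrite live_catE // in mE.
apply: endpoint_consS => //; rewrite mE.
  by apply: ok_dead; right; exists (move s v), e; rewrite sE sv.
by apply: IH => //; [rewrite sE | exact: move_ok].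
Qed.

Lemma first_return_dead v' e : size e = k -> (v' = [::] \/ size v' = m + 3) -> mark m v' = [::] ->
  dead (live_cat v' e).
Proof.
move=> se; case=> [->|sv]; first by left.
move=> nv; right; exists v', e; split=> //; apply: live_catE.
by rewrite -size_eq0 sv addn3.
Qed.

Lemma endpoint_size sp et' ok ws v v' : 2 < size v ->
  endpoint move (enabled sp et') ok ws v = Some v' -> v' = [::] \/ size v' = size v.
Proof.
elim: ws v => [|s ws IH] v // sv /endpoint_consP [_].
case: (altP (move s v =P [::])) => [E|mn].
  by case=> [[_ ->]|[_]]; [left | rewrite E endpoint_sink].
have sE := size_move sv mn.
case=> [[_ ->]|[_ h]]; first by right.
by rewrite -sE; apply: IH h; rewrite sE.
Qed.

Lemma endpoint_ok sp et' ok ws v v' : all good v ->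
  endpoint move (enabled sp et') ok ws v = Some v' -> all good v'.
Proof.
elim: ws v => [|s ws IH] v // vo /endpoint_consP [_] [[_ ->]|[_ h]].
  exact: move_ok.
by apply: IH h; exact: move_ok.
Qed.

(** Each symbol of [W] on a walk of the finite graph can be replaced by a piece
    that it stands for, because pieces do not see the last [k] blocks. *)
Lemma parse_sound us wss b b' : size b = 3 + k -> all good b ->
  endpoint move (enabled true et) okn us b = Some b' ->
  List.Forall2 (sym_lang m) us wss ->
  exists2 v', endpoint move (enabled false et) okb (flatten wss) (stretch m b) = Some v' & tracks b' v'.
Proof.
move=> sb bo + F; elim: F b sb bo => [|s ws us' wss' sws F' IH] b sb bo // /endpoint_consP [es].
have b3 : 2 < size b by rewrite sb.
have sm : move s b != [::] -> size (move s b) = 3 + k by move=> /(size_move b3) ->.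
suff [v1 h1 r1] : exists2 v1, endpoint move (enabled false et) okb ws (stretch m b) = Some v1
    & tracks (move s b) v1.
  case=> [[usE ->]|[o h]].
    exists v1 => //; rewrite usE in F'.
    suff -> : wss' = [::] by rewrite /= cats0.
    by inversion F'.
  case: (altP (move s b =P [::])) => [E|mn]; first by rewrite E endpoint_sink in h.
  have v1E : v1 = stretch m (move s b) by move: r1 mn; rewrite /tracks; case: (move s b).
  have [v' h' r'] := IH _ (sm mn) (move_ok s bo) h.
  exists v' => //=; apply: (endpoint_cat h1); last by rewrite v1E.
  by rewrite v1E ok_st ?sm // move_ok.
case: s es sws sm {IH} => [x|w].
  move=> /andP [_ /andP [/= nt tt]] -> _.
  case: b sb bo b3 nt tt => [|u [|z [|y e]]] // sb /and4P [uo zo yo eo] _.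
  rewrite /= take0 => nt tt.
  have [rE oE _] := special_stretch e m uo zo yo nt.
  exists (stretch m (out x [:: u, z, y & e])).
    by rewrite oE /enabled /= rE tt.
  by rewrite out_cons transduce_cons.
move=> /andP [/eqP /= tE _] [v1 h1 nE] sm.
have bE : b = src w ++ drop 3 b by rewrite -tE cat_take_drop.
have se : size (drop 3 b) = k by rewrite size_drop sb addKn.
have sst : size (stretch m (src w)) = m + 3 by rewrite size_stretch src_size.
exists (live_cat v1 (drop 3 b)).
  rewrite bE stretch_cat ?src_size // -bE; apply: first_return_lift => //.
  by rewrite stretch_ok ?src_size.
have v1s : v1 = [::] \/ size v1 = m + 3.
  by rewrite -sst; apply: endpoint_size h1; rewrite sst addn3.
rewrite /=; case: eqP => [dE|/eqP dn].
  by apply: first_return_dead => //; rewrite nE.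
rewrite (mark_eq dn nE) live_catE // -stretch_cat ?dst_size //.
by move: (dst_size dn); case: (dst w).
Qed.

(** From its first edge with trivial section, a walk stays among such edges until
    it meets a marked vertex, because all letters have trivial sections at
    unmarked vertices. *)
Lemma first_return_scan s ws v e v' : size v = m + 3 -> all good v -> size e = k ->
  enabled false true s v ->
  endpoint move (enabled false et) okb (s :: ws) (v ++ e) = Some v' ->
  (exists ws1 ws2 v1, [/\ s :: ws = ws1 ++ ws2,
     endpoint move (enabled false true) (unmarked m) ws1 v = Some v1, mark m v1 != [::]
     & (ws2 = [::] /\ v' = v1 ++ e) \/
       [/\ ws2 != [::], okb (v1 ++ e) & endpoint move (enabled false et) okb ws2 (v1 ++ e) = Some v']])
  \/ (exists v1, [/\ endpoint move (enabled false true) (unmarked m) (s :: ws) v = Some v1,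
       mark m v1 = [::] & v' = live_cat v1 e]).
Proof.
move=> sv vo se; elim: ws s v sv vo => [|t ws IH] s v sv vo es.
  have s3 : 2 < size v by rewrite sv addn3.
  have [es' mE] := interior_cat et e s3 es.
  rewrite endpoint_cons1 // mE => -[<-].
  case: (altP (mark m (move s v) =P [::])) => [nE|nn].
    by right; exists (move s v); rewrite endpoint_cons1.
  left; exists [:: s], [::], (move s v); rewrite endpoint_cons1 //; split=> //; left.
  by split=> //; apply: live_catE; apply: contra nn => /eqP ->; rewrite mark_nil.
have s3 : 2 < size v by rewrite sv addn3.
have [es' mE] := interior_cat et e s3 es.
move=> /endpoint_consP [_ [[//]|[o h]]].
case: (altP (move s v =P [::])) => [E|mn]; first by rewrite mE E endpoint_sink in h.
rewrite mE live_catE // in h o.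
have sE := size_move s3 mn.
have mo := move_ok s vo.
case: (altP (mark m (move s v) =P [::])) => [nE|nn]; last first.
  left; exists [:: s], (t :: ws), (move s v); rewrite endpoint_cons1 //.
  by split=> //; right.
have et1 : enabled false true t (move s v).
  have [et2 _] := endpoint_consP h; move: et2; rewrite /enabled.
  case: t {IH h} => [x|w] /=; last first.
    by rewrite !andbT takel_cat // sE.
  by move=> _; rewrite mn /=; apply: (unmarked_triv _ _ mo nE); rewrite sE.
have [|[ws1 [ws2 [v1 [wE f1 n1 c]]]]|[v1 [f1 n1 c]]] := IH t (move s v) _ mo et1 h.
- by rewrite sE.
- left; exists (s :: ws1), ws2, v1; split=> //; first by rewrite wE.
  by apply: endpoint_consS => //; rewrite /unmarked nE.
right; exists v1; split=> //; apply: endpoint_consS => //.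
by rewrite /unmarked nE.
Qed.

(** Induction on the length of the walk: its first edge either has a nontrivial
    section, and is an edge of the finite graph, or starts a piece. *)
Lemma parse_exists ws b v' : size b = 3 + k -> all good b ->
  endpoint move (enabled false et) okb ws (stretch m b) = Some v' ->
  exists us wss b', [/\ endpoint move (enabled true et) okn us b = Some b',
    List.Forall2 (sym_lang m) us wss, ws = flatten wss & tracks b' v'].
Proof.
have [n] := ubnP (size ws).
elim: n ws b => // n IH [|s ws] b //; rewrite ltnS => wn sb bo h.
have b3 : 2 < size b by rewrite sb.
have p3 : size (take 3 b) = 3 by rewrite size_takel // sb.
have po : all good (take 3 b) by apply/allP => c /mem_take; exact: allP.
have se : size (drop 3 b) = k by rewrite size_drop sb addKn.
have stb : stretch m b = stretch m (take 3 b) ++ drop 3 b.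
  by rewrite -stretch_cat ?p3 // cat_take_drop.
have sst : size (stretch m (take 3 b)) = m + 3 by rewrite size_stretch p3.
have sto : all good (stretch m (take 3 b)) by rewrite stretch_ok // p3.
have [sp|nsp] := boolP (if s is inl x then ~~ triv (run x (take 3 b)) else false).
  case: s sp wn h => [x|//] sp wn h.
  have [es c] := endpoint_consP h.
  have [rE oE] : run x (stretch m b) = run x b /\ out x (stretch m b) = stretch m (out x b).
    case: b sb bo sp {b3 p3 po se stb sst sto h es c} => [|u [|z [|y e]]] // sb.
    rewrite /= take0 => /and4P [uo zo yo eo] sp.
    by have [] := special_stretch e m uo zo yo sp.
  have es1 : enabled true et (inl x) b.
    move: es; rewrite /enabled /= sp rE => ->.
    by case: b b3 {sb bo p3 po se stb sst sto h c oE rE sp}.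
  have so : size (out x b) = 3 + k by rewrite size_out.
  case: c => [[wsE ->]|[o h']].
    exists [:: inl x], [:: [:: inl x]], (out x b); split=> //.
    - by rewrite endpoint_cons1.
    - by constructor.
    - by rewrite wsE.
    by rewrite /= oE; case: (out x b) so.
  rewrite /= oE in o h'.
  have [us [wss [b' [f F -> r]]]] := IH _ _ wn so (move_ok (inl x) bo) h'.
  exists (inl x :: us), ([:: inl x] :: wss), b'; split=> //; last by constructor.
  apply: endpoint_consS => //=.
  by rewrite -ok_st //; exact: (move_ok (inl x) bo).
have es : enabled false true s (stretch m (take 3 b)).
  have [es _] := endpoint_consP h; move: es.
  rewrite /enabled; case: s nsp {wn h} => [x|w].
    by rewrite /= negbK (triv_stretch _ _ p3 po) => ->.
  by rewrite /defined_at !andbT stb takel_cat // sst addn3.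
rewrite stb in h.
have sst3 : 2 < size (stretch m (take 3 b)) by rewrite sst addn3.
have [[ws1 [ws2 [v1 [wE f1 n1 c]]]]|[v1 [f1 n1 c]]] := first_return_scan sst sto se es h.
  have v1o := endpoint_ok sto f1.
  have [ns nE] := mark_inv n1.
  have no : all good (mark m v1) by rewrite nE stretch_ok ?ns in v1o.
  have [w srcE dstE] := pair_exists p3 po (or_intror (conj ns no)).
  have stn : v1 ++ drop 3 b = stretch m (move (inr w) b).
    by rewrite /= dstE (negbTE n1) stretch_cat ?ns // -nE.
  have mvn : move (inr w) b != [::].
    rewrite /= dstE (negbTE n1); apply: contra n1; rewrite -!size_eq0 size_cat.
    by rewrite addn_eq0 => /andP [].
  have smv : size (move (inr w) b) = 3 + k by rewrite size_move.
  have mvo := move_ok (inr w) bo.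
  have ew : enabled true et (inr w) b by rewrite /enabled /= srcE eqxx.
  have w1n : ws1 != [::] by case: ws1 f1 {wE}.
  have L1 : sym_lang m (inr w) ws1 by exists v1; rewrite ?srcE ?dstE.
  case: c => [[w2E ->]|[w2n o h']].
    exists [:: inr w], [:: ws1], (move (inr w) b); split=> //.
    - by rewrite endpoint_cons1.
    - by constructor.
    - by rewrite wE w2E /= !cats0.
    by rewrite stn /tracks; case: (move (inr w) b) mvn.
  rewrite stn in o h'.
  have w2s : size ws2 < n.
    have {}wn : size (s :: ws) <= n by [].
    apply: leq_trans wn; rewrite wE size_cat -[X in X < _]add0n ltn_add2r.
    by case: (ws1) w1n.
  have [us [wss [b' [f F w2E r]]]] := IH _ _ w2s smv mvo h'.
  exists (inr w :: us), (ws1 :: wss), b'; split=> //.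
  - by apply: endpoint_consS => //; rewrite -ok_st.
  - by constructor.
  by rewrite /= -w2E.
have [w srcE dstE] := pair_exists p3 po (or_introl erefl).
have mE : move (inr w) b = [::] by rewrite /= dstE.
exists [:: inr w], [:: s :: ws], [::]; split.
- by rewrite endpoint_cons1 ?mE // /enabled /= srcE eqxx.
- by constructor=> //; exists v1; rewrite ?srcE ?dstE.
- by rewrite /= cats0.
rewrite c; apply: first_return_dead => //.
have [|->] := endpoint_size sst3 f1; first by left.
by right.
Qed.

End Parse.

Lemma sym_lang_nil m s ws : sym_lang m s ws -> ws != [::].
Proof. by case: s => [x|w] /=; [move=> -> | case=> v1 /endpoint_nilN]. Qed.

(** A proper prefix of a first return ends at an unmarked vertex. So of two
    different pieces with the same start, one can be a prefix of the other only
    if it has an unmarked end, and such a piece is the last one of its walk. *)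
Lemma first_return_prefix m w w' ws t : src w = src w' ->
  sym_lang m (inr w) ws -> sym_lang m (inr w') (ws ++ t) -> (dst w = [::] -> t = [::]) ->
  t = [::] /\ w = w'.
Proof.
move=> srcE L [v1' f1' n1'] dt; have wn := sym_lang_nil L.
case: L => v1 f1 n1; rewrite -srcE in f1'.
case: (altP (t =P [::])) => [tE|tn].
  split=> //; apply: pair_inj => //; rewrite -n1 -n1'; congr mark.
  by move: f1'; rewrite tE cats0 f1 => -[].
have [k [fk nk _]] := endpoint_catP wn tn f1'.
move: fk nk; rewrite f1 => -[<-]; rewrite /unmarked n1 => /eqP /dt tE.
by rewrite tE in tn.
Qed.

Lemma cat_eq_cat (T : Type) (a b a' b' : seq T) : a ++ b = a' ++ b' ->
  (exists2 t, a' = a ++ t & b = t ++ b') \/ (exists2 t, a = a' ++ t & b' = t ++ b).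
Proof.
elim: a a' => [|x a IH] [|x' a'] /= E.
- by left; exists [::].
- by left; exists (x' :: a').
- by right; exists (x :: a).
case: E => -> /IH [[t -> ->]|[t -> ->]]; [left|right]; by exists t.
Qed.

(** At each marked vertex the first letter decides whether an edge or a piece
    comes next, and [first_return_prefix] decides where the piece ends. *)
Lemma parse_uniq m et et' okn okn' us us' wss wss' b b1 b1' :
  2 < size b -> all good b ->
  endpoint move (enabled true et) okn us b = Some b1 ->
  endpoint move (enabled true et') okn' us' b = Some b1' ->
  List.Forall2 (sym_lang m) us wss -> List.Forall2 (sym_lang m) us' wss' ->
  flatten wss = flatten wss' -> us = us' /\ wss = wss'.
Proof.
move=> + + + + F; elim: F us' wss' b => [|s ws us1 wss1 Ls F IH] us' wss' b b3 bo f f' // F'.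
case: F' f' => [|s' ws' us1' wss1' Ls' F'] // f' /= E.
have p3 : size (take 3 b) = 3 by rewrite size_takel.
have po : all good (take 3 b) by apply/allP => c /mem_take; exact: allP.
have [es c] := endpoint_consP f; have [es' c'] := endpoint_consP f'.
have rest (okr : pred (seq D)) etr s0 us0 wss0 : List.Forall2 (sym_lang m) us0 wss0 ->
    (us0 = [::] /\ True) \/ (okr (move s0 b) /\ exists b0, endpoint move (enabled true etr) okr us0 (move s0 b) = Some b0) ->
    move s0 b = [::] -> flatten wss0 = [::].
  move=> F0 [[head_block _] _|[_ [b0 f0]] E0].
    by rewrite head_block in F0; inversion F0.
  by rewrite E0 endpoint_sink in f0.
have tail : s = s' -> ws = ws' -> s :: us1 = s' :: us1' /\ ws :: wss1 = ws' :: wss1'.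
  move=> sE wsE; rewrite -wsE in E; rewrite -sE in c' f'.
  have {}E : flatten wss1 = flatten wss1'.
    by have /eqP := E; rewrite eqseq_cat // eqxx => /eqP.
  suff [-> ->] : us1 = us1' /\ wss1 = wss1' by rewrite sE wsE.
  case: c => [[u1 _]|[_ h]]; case: c' => [[u1' _]|[_ h']].
  - by rewrite u1 in F *; rewrite u1' in F' *; inversion F; inversion F'.
  - rewrite u1 in F; inversion F; subst.
    case: F' h' E => // s2 ws2 us2 wss2 /sym_lang_nil; by case: ws2.
  - rewrite u1' in F'; inversion F'; subst.
    case: F h E {IH f} => // s2 ws2 us2 wss2 /sym_lang_nil; by case: ws2.
  case: (altP (move s b =P [::])) => [E0|mn]; first by rewrite E0 endpoint_sink in h.
  by apply: IH h h' F' E; [rewrite size_move | exact: move_ok].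
have head_int w w0s : take 3 b = src w -> sym_lang m (inr w) w0s ->
    exists2 t, enabled false true t (stretch m (take 3 b)) & exists r, w0s = t :: r.
  move=> -> [v1]; case: w0s => [|t r] // /endpoint_consP [et0 _] _.
  by exists t => //; exists r.
have clash x w wx ww r r' : enabled true et (inl x) b \/ enabled true et' (inl x) b ->
    take 3 b = src w -> sym_lang m (inl x) wx -> sym_lang m (inr w) ww -> wx ++ r = ww ++ r' -> False.
  move=> ex tw -> /(head_int _ _ tw) [t et0 [r0 ->]] [tE _].
  move: et0; rewrite -tE => /andP [_] /=; rewrite triv_stretch // => tt.
  by case: ex => /andP [_ /andP []] /=; rewrite tt.
case: s s' Ls Ls' f f' es es' c c' tail => [x|w] [x'|w'] Ls Ls' f f' es es' c c' tail.
- by apply: tail; move: E; rewrite /= in Ls Ls'; rewrite Ls Ls' => -[->].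
- move: (es') => /andP [/eqP /= tw' _].
  by case: (clash x w' ws ws' (flatten wss1) (flatten wss1')) => //; left.
- move: (es) => /andP [/eqP /= tw _].
  by case: (clash x' w ws' ws (flatten wss1') (flatten wss1)) => //; right.
move: (es) (es') => /andP [/eqP /= tw _] /andP [/eqP /= tw' _].
have dz : dst w = [::] -> flatten wss1 = [::].
  move=> dE; apply: (rest okn et (inr w) us1 wss1 F); last by rewrite /= dE.
  by case: c => [[-> _]|[o h]]; [left | right; split=> //; exists b1].
have dz' : dst w' = [::] -> flatten wss1' = [::].
  move=> dE; apply: (rest okn' et' (inr w') us1' wss1' F'); last by rewrite /= dE.
  by case: c' => [[-> _]|[o h]]; [left | right; split=> //; exists b1'].
have srcE : src w = src w' by rewrite -tw -tw'.
have [[t tE rE]|[t tE rE]] := cat_eq_cat E.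
  rewrite tE in Ls'.
  have dt : dst w = [::] -> t = [::] by move=> /dz fE; move: rE; rewrite fE; case: (t).
  have [t0 ww] := first_return_prefix srcE Ls Ls' dt.
  by apply: tail; [rewrite ww | rewrite tE t0 cats0].
rewrite tE in Ls.
have dt : dst w' = [::] -> t = [::] by move=> /dz' fE; move: rE; rewrite fE; case: (t).
have [t0 ww] := first_return_prefix (esym srcE) Ls' Ls dt.
by apply: tail; [rewrite ww | rewrite tE t0 cats0].
Qed.

Lemma mark_succ_stretch m b : size b = 4 -> mark m.+1 (stretch m b) = mark 1 b.
Proof.
move=> sb; rewrite -(cat_take_drop 3 b).
have: size (drop 3 b) = 1 by rewrite size_drop sb.
case: (drop 3 b) => [|c []] // _.
have p3 : size (take 3 b) = 3 by rewrite size_takel // sb.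
rewrite stretch_cat ?p3 // !cats1; move: (take 3 b) p3 => p p3.
have pE : stretch 0 p = p by case: p p3 => [|u [|z e]] // _; rewrite stretch0.
by rewrite -{2}pE !mark_succ.
Qed.

Definition beta_lang us w := first_return 1 true us (stretch 1 (src w)) (dst w).

Lemma dead_succ m v : dead m 1 v -> unmarked m.+1 v.
Proof.
case=> [->|[v1 [e [-> _ + nv]]]]; first by rewrite /unmarked mark_nil.
by case: e => [|c []] // _; rewrite cats1 /unmarked mark_succ_unmarked.
Qed.

(** The instance [k = 1] of the decomposition: the pieces of level m + 4 in terms
    of those of level m + 3. *)
Lemma beta_decomp m w ws : sym_lang m.+1 (inr w) ws <->
  exists us wss, [/\ beta_lang us w, List.Forall2 (sym_lang m) us wss & ws = flatten wss].
Proof.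
have stb : stretch m (stretch 1 (src w)) = stretch m.+1 (src w).
  by case: (src w) (src_size w) => [|u [|z [|y []]]] // _; rewrite stretchE stretch_succ.
have sb : size (stretch 1 (src w)) = 3 + 1 by rewrite size_stretch src_size.
have bo : all good (stretch 1 (src w)) by rewrite stretch_ok ?src_size.
have oks b : size b = 3 + 1 -> all good b -> unmarked m.+1 (stretch m b) = unmarked 1 b.
  by move=> sb' _; rewrite /unmarked mark_succ_stretch.
have relE us b' v' : endpoint move (enabled true true) (unmarked 1) us (stretch 1 (src w)) = Some b' ->
    tracks m 1 b' v' -> mark m.+1 v' = mark 1 b'.
  move=> f; have [|->|sb'] := endpoint_size _ f; rewrite ?sb //.
    by move=> /dead_succ /eqP ->; rewrite mark_nil.
  by case: b' f sb' => // c b' f sb' ->; rewrite mark_succ_stretch ?sb' ?sb.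
split.
  move=> [v' f nE]; rewrite -stb in f.
  have [us [wss [b' [f' F wsE r]]]] := parse_exists oks sb bo f.
  by exists us, wss; split=> //; exists b'; rewrite -?(relE _ _ _ f' r).
move=> [us [wss [[b' f nE] F ->]]].
have [v' f' r] := parse_sound oks (@dead_succ m) sb bo f F.
by exists v'; rewrite -?stb // (relE _ _ _ f r).
Qed.

(** * Walks from a prefix of the ray *)

Section Alpha.
Variable base_node : seq D.
Hypothesis base_size : size base_node = 3.
Hypothesis base_ok : all good base_node.

Lemma tracks_stretch m us b v : endpoint move (enabled true false) predT us base_node = Some b ->
  tracks m 0 b v -> (v = stretch m base_node) <-> (b = base_node).
Proof.
move=> f; have [|->|sb] := endpoint_size _ f; rewrite ?base_size //.
  move=> dv; split=> [vE|bE]; last by move: base_size; rewrite -bE.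
  case: dv => [v0|[v1 [e [vE' _ /size0nil eE nv]]]].
    by have := @size_stretch m base_node; rewrite base_size -vE v0 addnS => /(_ isT).
  by move: nv base_size; rewrite -[v1]cats0 -eE -vE' vE mark_stretch ?base_size // => ->.
case: b f sb => [|c b] f sb; first by rewrite base_size in sb.
rewrite /tracks => ->; split=> [/stretch_inj-> //|-> //]; last by rewrite base_size.
by rewrite sb base_size.
Qed.

(** The instance [k = 0] of the decomposition. *)
Lemma alpha_decomp m ws (e : bool) :
  (exists2 v', endpoint move (enabled false false) predT ws (stretch m base_node) = Some v' & (v' == stretch m base_node) = e) <->
  exists us wss b, [/\ endpoint move (enabled true false) predT us base_node = Some b, (b == base_node) = e,
    List.Forall2 (sym_lang m) us wss & ws = flatten wss].
Proof.
have oks b : size b = 3 + 0 -> all good b -> predT (stretch m b) = predT b by [].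
have okd v : dead m 0 v -> predT v by [].
have rE us b v : endpoint move (enabled true false) predT us base_node = Some b -> tracks m 0 b v ->
    (v == stretch m base_node) = (b == base_node).
  by move=> f r; apply/eqP/eqP => /(tracks_stretch f r).
split=> [[v' f vE]|[us [wss [b [f bE F ->]]]]].
  have [us [wss [b [f' F wsE r]]]] := parse_exists oks base_size base_ok f.
  by exists us, wss, b; split=> //; rewrite -(rE _ _ _ f' r).
have [v' f' r] := parse_sound oks okd base_size base_ok f F.
by exists v' => //; rewrite (rE _ _ _ f r).
Qed.

End Alpha.

Definition endpoint_or_start ws v := if ws is [::] then Some v else endpoint move (enabled false false) predT ws v.

Lemma endpoint_or_start_cat ws1 ws2 v v' : endpoint_or_start ws1 v = Some v' -> endpoint_or_start (ws1 ++ ws2) v = endpoint_or_start ws2 v'.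
Proof.
case: ws1 => [|s ws1] /=; first by case=> ->.
rewrite -/(endpoint move (enabled false false) predT (s :: ws1) v) => f.
case: ws2 => [|t ws2]; first by rewrite cats0; exact: f.
change (endpoint move (enabled false false) predT ((s :: ws1) ++ (t :: ws2)) v =
  endpoint move (enabled false false) predT (t :: ws2) v').
case E: (endpoint _ _ _ (t :: ws2) v') => [v2|].
  exact: (endpoint_cat f isT E).
case E2: (endpoint _ _ _ _ v) => [v2|] //.
have [k [f1 _ f2]] := endpoint_catP (isT : s :: ws1 != [::]) (isT : t :: ws2 != [::]) E2.
by move: f1; rewrite f => -[kE]; rewrite -kE E in f2.
Qed.

(** The part of the finite graph on the vertices [:: u; z; z] in which a symbol of
    [W] may change [u] only, while a letter may change both. *)
Definition enabled_diag s b := [&& enabled true false s b, nth d0 b 1 == nth d0 b 2 &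
  if s is inr w then drop 1 (dst w) == drop 1 (src w) else true].

Lemma stretch_diag m u z j : stretch m [:: u; z; z] ++ nseq j z = u :: nseq (m + 2 + j) z.
Proof. by rewrite stretchE -[[:: z]]/(nseq 1 z) cat_cons -!nseqD addn1 addn2. Qed.

Lemma out_diag x u z j : good u -> good z -> ~~ triv (run x [:: u; z; z]) ->
  out x (u :: nseq j z) =
    (step (init x) u).2 :: nseq j (step (run x [:: u]) z).2.
Proof.
move=> uo zo nt; have [_ _ E] := special_stretch [::] 0 uo zo zo nt.
by rewrite out_cons run_nseq.
Qed.

(** The walk is followed on u z^(m+2+j) for all [j] at once: a piece between
    u z^(m+2) and u' z^(m+2) keeps all further blocks, and a letter whose state
    is fixed by [z] replaces every [z] by the same block. *)
Lemma wp_sound m us wss u z b' j : good u -> good z ->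
  endpoint move enabled_diag predT us [:: u; z; z] = Some b' -> List.Forall2 (sym_lang m) us wss ->
  exists u' z', b' = [:: u'; z'; z'] /\
    endpoint_or_start (flatten wss) (u :: nseq (m + 2 + j) z) = Some (u' :: nseq (m + 2 + j) z').
Proof.
move=> + + + F; elim: F u z => [|s ws us1 wss1 Ls F IH] u z uo zo // /endpoint_consP [es c].
suff [u1 [z1 [uo1 zo1 mE w1]]] : exists u1 z1, [/\ good u1, good z1,
    move s [:: u; z; z] = [:: u1; z1; z1] &
    endpoint_or_start ws (u :: nseq (m + 2 + j) z) = Some (u1 :: nseq (m + 2 + j) z1)].
  rewrite mE in c; case: c => [[usE ->]|[_ h]].
    rewrite usE in F; inversion F; exists u1, z1; split=> //.
    by rewrite /= cats0.
  have [u' [z' [b'E w']]] := IH _ _ uo1 zo1 h.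
  by exists u', z'; split=> //=; rewrite (endpoint_or_start_cat _ w1).
have bo : all good [:: u; z; z] by rewrite /= uo zo.
case: s Ls es {c} => [x|w] Ls /and3P [].
  rewrite Ls => /andP [_ /andP [/= nt _]] _ _.
  exists (step (init x) u).2, (step (run x [:: u]) z).2; split.
  - exact: step_ok.
  - exact: step_ok.
  - exact: (out_diag 2 uo zo nt).
  by rewrite /endpoint_or_start /= (out_diag _ uo zo nt).
move=> /andP [/eqP /= tw _] _ /eqP dw.
have dE : exists u1, dst w = [:: u1; z; z].
  move: dw; rewrite -tw; case: (dst w) => [|u1 e] //=; rewrite drop0 => ->.
  by exists u1.
case: dE => u1 dE; have := dst_ok w; rewrite dE => /= /and3P [uo1 _ _].
exists u1, z; split=> //.
  case: Ls => v1 f1 n1; have wn := endpoint_nilN f1.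
  have sst : size (stretch m (src w)) = m + 3 by rewrite size_stretch src_size.
  have := @first_return_lift m j false predT (fun _ _ => isT) ws (stretch m (src w)) v1 (nseq j z)
    sst _ (size_nseq j z) f1.
  rewrite stretch_ok ?src_size // src_ok => /(_ isT).
  have -> : v1 = stretch m [:: u1; z; z] by exact: (mark_eq _ (etrans n1 dE)).
  rewrite -tw live_catE // !stretch_diag.
  by rewrite /endpoint_or_start; case: (ws) wn.
Qed.

Lemma drop_of_nseq n k (z : D) : drop n (nseq k z) = nseq (k - n) z.
Proof. by elim: n k => [|n IH] [|k] //=; rewrite ?subn0. Qed.

(** From position [l] on, the word repeats one block. *)
Definition tail_constant l v := exists n z, good z /\ drop l v = nseq n z.

(** By [settle] a letter either repeats its output along the constant part, or
    acts on it trivially after at most two blocks. *)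
Lemma tail_constant_move l s v : 0 < l -> all good v -> enabled false false s v -> move s v != [::] ->
  tail_constant l v -> tail_constant l.+2 (move s v).
Proof.
move=> l0 vo es mn [n [z [zo E]]].
have [vl|lv] := leqP (size v) l.
  exists 0, z; split=> //; apply: drop_oversize.
  case: s es mn => [x|w] /= es mn; first by rewrite size_out; apply: leq_trans vl _; do 2 apply: leqW.
  move: mn; case: (dst w =P [::]) => // /eqP dn _.
  rewrite size_cat dst_size // size_drop.
  by rewrite -maxnE geq_max !ltnS l0 (leq_trans vl) // leqW.
case: s es mn => [x|w] es mn; last first.
  move: mn; rewrite /=; case: (dst w =P [::]) => // /eqP dn _.
  exists (n - 2), z; split=> //; rewrite drop_cat dst_size //.
  have -> : (l.+2 < 3) = false by rewrite !ltnS leqn0; case: (l) l0.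
  by rewrite drop_drop subnK // -drop_of_nseq -E drop_drop addnC addn2.
have st1 : size (take l v) = l by rewrite size_takel // ltnW.
have dE : drop l.+2 (out x v) = drop 2 (transduce step (run x (take l v)) (nseq n z)).2.
  rewrite -[in LHS](cat_take_drop l v) E out_cat drop_cat size_out st1.
  by rewrite ltnNge 2?leqW //= -addn2 addKn.
rewrite /tail_constant -[move _ _]/(out x v) dE.
have to : all good (take l v) by apply/allP => c /mem_take; exact: (allP vo).
have tn : take l v != [::] by rewrite -size_eq0 st1 -lt0n.
have [E1|T] := settle x tn to zo zo.
  by exists (n - 2), (step (run x (take l v)) z).2; rewrite run_nseq //= drop_of_nseq step_ok.
exists (n - 2), z; split=> //.
case: n {E dE} => [|[|n]] //=; rewrite !transduce_cons /= run_triv // drop0.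
by rewrite subSS subSS subn0.
Qed.

Lemma tail_constant_endpoint l ok ws v v' : 0 < l -> all good v ->
  endpoint move (enabled false false) ok ws v = Some v' -> v' <> [::] ->
  tail_constant l v -> tail_constant (l + 2 * size ws) v'.
Proof.
elim: ws l v => [|s ws IH] l v l0 vo // /endpoint_consP [es c] vn ev.
have mn : move s v != [::].
  apply/eqP => E; rewrite E in c; case: c => [[]//|[_]].
  by rewrite endpoint_sink.
have ev1 := tail_constant_move l0 vo es mn ev.
case: c => [[-> ->]|[_ h]]; first by rewrite /= muln1 addn2.
have := IH l.+2 _ _ (move_ok s vo) h vn ev1.
by rewrite /= mulnS addnA addn2; apply.
Qed.

(** After a piece that starts at u z^(m+2), the vertex has the form
    u' z'^(m+1) t', and with one block [z] behind it its tail is constant. If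
    [m] exceeds the length of the unsettled part, then z' = t' = z. *)
Lemma wp_complete m us wss u z b' : good u -> good z -> 2 * size (flatten wss) < m ->
  endpoint move (enabled true false) predT us [:: u; z; z] = Some b' -> b' <> [::] ->
  List.Forall2 (sym_lang m) us wss ->
  endpoint move enabled_diag predT us [:: u; z; z] = Some b'.
Proof.
move=> + + + + bn F; elim: F u z => [|s ws us1 wss1 Ls F IH] u z uo zo // lm /endpoint_consP [es c].
have bo : all good [:: u; z; z] by rewrite /= uo zo.
have mn : move s [:: u; z; z] != [::].
  apply/eqP => E; rewrite E in c; case: c => [[]//|[_]].
  by rewrite endpoint_sink.
suff [u1 [z1 [uo1 zo1 mE ew]]] : exists u1 z1, [/\ good u1, good z1,
    move s [:: u; z; z] = [:: u1; z1; z1] & enabled_diag s [:: u; z; z]].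
  case: c => [[-> ->]|[_ h]]; first by rewrite endpoint_cons1.
  apply: endpoint_consS => //; rewrite mE in h *; apply: IH => //.
  by apply: leq_ltn_trans lm; rewrite leq_mul2l /= size_cat leq_addl.
case: s Ls es mn {c} => [x|w] Ls es mn.
  have /andP [_ /andP [/= nt _]] := es.
  exists (step (init x) u).2, (step (run x [:: u]) z).2; split.
  - exact: step_ok.
  - exact: step_ok.
  - exact: (out_diag 2 uo zo nt).
  by rewrite /enabled_diag es /= eqxx.
have /andP [/eqP /= tw _] := es.
have dn : dst w != [::] by apply: contraNN mn => /eqP /= ->.
case: Ls => v1 f1 n1; have wn := endpoint_nilN f1.
have sst : size (stretch m (src w)) = m + 3 by rewrite size_stretch src_size.
have := @first_return_lift m 1 false predT (fun _ _ => isT) ws (stretch m (src w)) v1 (nseq 1 z)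
    sst _ (size_nseq 1 z) f1.
rewrite stretch_ok ?src_size // src_ok => /(_ isT).
have v1E := mark_eq dn n1.
rewrite v1E -tw stretch_diag live_catE; last by rewrite -size_eq0 size_stretch dst_size // addn3.
move=> fz.
have eo : all good (u :: nseq (m + 2 + 1) z) by rewrite /= uo all_nseq zo orbT.
have ev : tail_constant 1 (u :: nseq (m + 2 + 1) z) by exists (m + 2 + 1), z; rewrite /= drop0.
have vn : stretch m (dst w) ++ nseq 1 z <> [::] by rewrite /= cats1; case: (stretch m _).
have [n [z2 [zo2]]] := tail_constant_endpoint (ltn0Sn 0) eo fz vn ev.
have := dst_ok w; have := dst_size dn.
case dE: (dst w) => [|u1 [|z1 [|y1 []]]] // _ /and4P [uo1 zo1 yo1 _].
have [l [lE ll]] : exists l, 1 + 2 * size ws = l.+1 /\ l <= m.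
  exists (2 * size ws); split; first by rewrite add1n.
  by apply: leq_trans (ltnW lm); rewrite leq_mul2l /= size_cat leq_addr.
rewrite lE stretchE -[_ ++ nseq 1 z]/(u1 :: (nseq m.+1 z1 ++ [:: y1]) ++ [:: z]) /= -catA.
rewrite -[z1 :: _]/(nseq m.+1 z1 ++ [:: y1; z]) drop_catl ?size_nseq ?leqW // drop_of_nseq.
rewrite subSn // => /= nE.
have mem c : c \in z1 :: nseq (m - l) z1 ++ [:: y1; z] -> c = z2.
  by rewrite nE mem_nseq => /andP [_ /eqP].
have zE : z1 = z.
  apply: etrans (mem z1 _) (esym (mem z _)); first exact: mem_head.
  by rewrite inE mem_cat !inE eqxx !orbT.
have yE : y1 = z.
  by apply: etrans (mem y1 _) (esym (mem z _)); rewrite inE mem_cat !inE eqxx !orbT.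
exists u1, z; split=> //; first by rewrite zE yE.
by rewrite /enabled_diag es /= eqxx /= dE -tw zE yE eqxx.
Qed.

(** Walks of one level lift to walks of all deeper levels. *)
Lemma endpoint_lift ok ws v v' e : 2 < size v ->
  endpoint move (enabled false false) ok ws v = Some v' ->
  exists2 e', endpoint move (enabled false false) predT ws (v ++ e) = Some (live_cat v' e') & size e' = size e.
Proof.
elim: ws v e => [|s ws IH] v e // v3 /endpoint_consP [es c].
have [e1 es1 [mE se]] : exists2 e1, enabled false false s (v ++ e) &
    move s (v ++ e) = live_cat (move s v) e1 /\ size e1 = size e.
  move: es; rewrite /enabled; case: s {c} => [x|w] /= es.
    exists (transduce step (run x v) e).2; first by case: v v3 {es}.
    rewrite out_cat live_catE ?size_transduce //.
    by rewrite -size_eq0 size_out -lt0n; apply: leq_trans v3.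
  exists e; first by rewrite takel_cat.
  split=> //; case: (dst w =P [::]) => // /eqP dn.
  rewrite drop_catl // catA live_catE //.
  by apply: contra dn; rewrite -!size_eq0 size_cat addn_eq0 => /andP [].
case: (altP (move s v =P [::])) => [E|mn].
  case: c => [[-> ->]|[_]]; last by rewrite E endpoint_sink.
  by exists e1; rewrite // endpoint_cons1 // mE.
rewrite live_catE // in mE; case: c => [[-> ->]|[_ h]].
  by exists e1; rewrite // endpoint_cons1 // mE live_catE.
have sv : 2 < size (move s v) by rewrite size_move.
have [e2 f2 se2] := IH _ e1 sv h.
by exists e2; rewrite ?se2 //; apply: endpoint_consS => //; rewrite mE.
Qed.

Section Stabiliser.
Variables (u z : D).
Hypotheses (u_ok : good u) (z_ok : good z).
Let p := [:: u; z; z].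

Definition wp_derives m ws := exists us wss,
  [/\ us = [::] \/ endpoint move enabled_diag predT us p = Some p, List.Forall2 (sym_lang m) us wss & ws = flatten wss].

Lemma wp_derives_sound m ws j : wp_derives m ws ->
  endpoint_or_start ws (stretch (m + j) p) = Some (stretch (m + j) p).
Proof.
move=> [us [wss [c F ->]]]; have [usE|f] := c.
  by rewrite usE in F; inversion F.
have [u' [z' [E w]]] := wp_sound j u_ok z_ok f F.
have := stretch_diag (m + j) u z 0; rewrite cats0 addn0 => ->.
by rewrite addnAC w; case: E => -> ->.
Qed.

Lemma wp_derives_complete m ws : 2 * size ws < m ->
  endpoint_or_start ws (stretch m p) = Some (stretch m p) -> wp_derives m ws.
Proof.
move=> lm; case: ws lm => [|s ws] lm h.
  by exists [::], [::]; split=> //; left.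
have po : all good p by rewrite /= u_ok z_ok.
have [us [wss [b [f /eqP bE F wsE]]]] : exists us wss b,
    [/\ endpoint move (enabled true false) predT us p = Some b, (b == p) = true,
    List.Forall2 (sym_lang m) us wss & s :: ws = flatten wss].
  by apply/alpha_decomp => //; exists (stretch m p); rewrite ?eqxx.
exists us, wss; split=> //; right; rewrite bE in f.
by apply: (wp_complete (m := m) (wss := wss)) => //; rewrite -wsE.
Qed.

Lemma wp_derives_limit m ws : wp_derives m ws ->
  exists2 K, m <= K & forall k, K <= k -> wp_derives k ws.
Proof.
move=> h; exists (maxn m (2 * size ws).+1); first exact: leq_maxl.
move=> k; rewrite geq_max => /andP [mk1 wk]; apply: wp_derives_complete => //.
by rewrite -(subnKC mk1); apply: wp_derives_sound.
Qed.

End Stabiliser.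

Lemma moved_limit u z m k ws : m <= k ->
  (exists2 v', endpoint move (enabled false false) predT ws (stretch m [:: u; z; z]) = Some v' & (v' == stretch m [:: u; z; z]) = false) ->
  exists2 v', endpoint move (enabled false false) predT ws (stretch k [:: u; z; z]) = Some v' & (v' == stretch k [:: u; z; z]) = false.
Proof.
move=> /subnKC <- [v' f vN]; set j := k - m; set p := [:: u; z; z] in f vN *.
have stE' : stretch (m + j) p = stretch m p ++ nseq j z.
  by rewrite stretch_diag addnAC -[stretch _ _]cats0 (stretch_diag _ u z 0) addn0.
have s3 : 2 < size (stretch m p) by rewrite size_stretch // addn3.
have [e' f' se] := endpoint_lift (nseq j z) s3 f.
rewrite stE'; exists (live_cat v' e') => //.
have [v0|sv] := endpoint_size s3 f; first by rewrite v0 /stretch.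
rewrite live_catE; last by rewrite -size_eq0 sv -lt0n; apply: leq_trans s3.
by rewrite eqseq_cat ?sv // vN.
Qed.

End Core.

(** * Boundedness on blocks *)

Section Bounded.
Variable d : nat.
Implicit Types (g : taut d) (u v w m y z : seq 'I_d).

Lemma section_cat g u v : section (section g u) v = section g (u ++ v).
Proof.
symmetry; apply/sectionP => w.
have E1 := section_funE g u (v ++ w); have E2 := section_funE g (u ++ v) w.
rewrite catA E2 section_funE -catA in E1.
by move/eqP: E1; rewrite eqseq_cat // eqxx => /eqP.
Qed.

Lemma section1 u : section (1%g : taut d) u = 1%g.
Proof. by symmetry; apply/sectionP => w. Qed.

Definition reps k (u : seq 'I_d) := flatten (nseq k u).

Lemma reps_S k u : reps k.+1 u = u ++ reps k u. Proof. by []. Qed.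

Lemma size_reps k u : size (reps k u) = k * size u.
Proof. by elim: k => // k IH; rewrite reps_S size_cat IH. Qed.

Lemma reps_add i j u : reps (i + j) u = reps i u ++ reps j u.
Proof. by rewrite /reps nseqD flatten_cat. Qed.

Lemma section_reps g u k w : section g (w ++ u) = section g w ->
  section g (w ++ reps k u) = section g w.
Proof.
move=> E; elim: k => [|k IH]; first by rewrite cats0.
by rewrite reps_S catA -section_cat E section_cat.
Qed.

Lemma section_congr g u v w : section g u = section g v ->
  section g (u ++ w) = section g (v ++ w).
Proof. by move=> E; rewrite -!section_cat E. Qed.

(** Otherwise, for i <= N + 1, the words u U^i m Y^(N+1-i) are distinct vertices
    of one level, and the section at each of them is the nontrivial g@(um):
    for i < j, after u U^i one continues with [m] and the other with [U]. *)
Lemma no_pump g u U m Y : bounded_automaton_aut g ->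
  0 < size U -> size Y = size U -> size m <= size U ->
  section g (u ++ U) = section g u ->
  section g (u ++ m ++ Y) = section g (u ++ m) ->
  section g (u ++ m) <> 1%g -> m = take (size m) U.
Proof.
move=> [_ [N bnd]] U0 sY sm sU sYm nt; apply: contrapT => mU.
pose L := size u + N.+1 * size U + size m.
have L0 : 0 < L by rewrite /L mulSn -addnA addnCA addnA; do 2 rewrite ltn_addr //; rewrite addn_gt0 U0.
pose W i := u ++ reps i U ++ m ++ reps (N.+1 - i) Y.
have sW (i : 'I_N.+2) : size (W i) == L.
  rewrite /W !size_cat !size_reps sY /L.
  have iN : i <= N.+1 by rewrite -ltnS.
  have -> : N.+1 * size U = i * size U + (N.+1 - i) * size U by rewrite -mulnDl subnKC.
  by rewrite -!addnA [size m + _]addnC.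
have Winj : injective (fun i : 'I_N.+2 => Tuple (sW i)).
  have lt (i j : 'I_N.+2) : W i = W j -> i < j -> False.
    move=> + ij; rewrite /W => /eqP; rewrite eqseq_cat // eqxx /= => /eqP.
    have [t jE] : exists t, val j = i + t.+1 by exists (j - i.+1); rewrite addnS -addSn subnKC.
    rewrite jE reps_add reps_S -!catA.
    move=> /eqP; rewrite eqseq_cat // eqxx /= => /eqP E; apply: mU.
    by rewrite -(takel_cat (reps t U ++ m ++ reps (N.+1 - (i + t.+1)) Y) sm) -E take_size_cat.
  move=> i j /(congr1 val) /= E; apply/val_inj.
  by case: (ltngtP i j) => // [/(lt _ _ E)|/(lt _ _ (esym E))].
have := bnd L L0; apply/negP; rewrite -leqNgt.
apply: (@leq_trans N.+2); first by rewrite leqW.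
rewrite -{1}(card_ord N.+2) -(card_codom Winj).
apply/subset_leq_card/fintype.subsetP => t /codomP [i ->]; rewrite inE /=.
apply/eqP => E; apply: nt; rewrite -E /W.
rewrite [u ++ _ ++ _]catA (section_congr _ (section_reps i sU)) catA.
by rewrite section_reps // -catA.
Qed.

Section States.
Variables (g : taut d) (M : mealy d).
Hypothesis gM : section_automaton M g.
Hypothesis g_bounded : bounded_automaton_aut g.

(** The states of a section automaton are the sections, up to renaming, so they
    can be compared instead of the sections. *)
Definition state u : 'I_(nstates M) := foldl (@Defs.next d M) (Defs.init M) u.

Lemma state_section u v : state u = state v <-> section g u = section g v.
Proof.
have [phi [phi_inj _ phi0 phiS]] := gM.
have E w : phi (state w) = section g w.
  elim/last_ind: w => [|w c IH].
    by have [_ g0 _] := tautP g; rewrite /state /= phi0; apply/sectionP => w; rewrite g0.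
  by rewrite /state foldl_rcons -/(state w) -(proj2 (phiS _ _)) IH section_cat cats1.
by rewrite -!E; split=> [->|/phi_inj].
Qed.

Lemma repeat_state w u : nstates M <= size u ->
  exists i j, [/\ i < j, j <= nstates M &
    section g (w ++ take i u) = section g (w ++ take j u)].
Proof.
move=> su; pose f (i : 'I_(nstates M).+1) := state (w ++ take i u).
have : ~ injective f by move=> /leq_card; rewrite !card_ord ltnn.
move=> /existsNP [i] /existsNP [j] /not_implyP [/state_section E /eqP ij].
have ijN : val i != val j by [].
case: (ltngtP i j) ijN => // lt _.
  by exists i, j; split=> //; rewrite -ltnS.
by exists j, i; split=> //; rewrite -ltnS.
Qed.

Variable p : nat.
Hypothesis p_gt0 : 0 < p.
Hypothesis p_big : nstates M <= p.
Hypothesis p_div : forall l, 0 < l -> l <= nstates M -> l %| p.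

(** Pigeonhole: some state repeats while reading [u], and the loop can be iterated
    up to the length [p], which is a multiple of its length. *)
Lemma repeat_cycle w u : size u = p -> exists r U t,
  [/\ u = r ++ t, size U = p & section g (w ++ r ++ U) = section g (w ++ r)].
Proof.
move=> su; have [|i [j [ij jM E]]] := @repeat_state w u; first by rewrite su.
have ju : j <= size u by rewrite su (leq_trans jM).
pose V := take (j - i) (drop i u).
have sV : size V = j - i.
  by rewrite size_takel // size_drop leq_sub2r.
have dV : j - i %| p by apply: p_div; rewrite ?subn_gt0 // (leq_trans (leq_subr _ _)).
exists (take i u), (reps (p %/ (j - i)) V), (drop i u); split=> //.
- by rewrite cat_take_drop.
- by rewrite size_reps sV divnK.
rewrite catA section_reps // -catA E; congr (section g (w ++ _)).
by rewrite /V -[in RHS](subnKC (ltnW ij)) takeD.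
Qed.

(** Apply [no_pump] with the cycle [z] both before and after the word [y]. *)
Lemma cycle_uniq u z y : size z = p -> size y = p -> section g u <> 1%g ->
  section g (u ++ z) = section g u -> section g (u ++ y) = section g u -> y = z.
Proof.
move=> sz sy nt Ez Ey.
suff E : y = take (size y) z by rewrite E sy -sz take_size.
apply: (@no_pump g u z y z) => //; rewrite ?sz ?sy //.
  by rewrite catA (section_congr _ Ey) Ez Ey.
by rewrite Ey.
Qed.

(** If g@(vzy) is nontrivial, a state repeats within the last [p] letters of [v],
    along a cycle [U], and a nontrivial state repeats within [y]. By [no_pump]
    the word in between continues the first cycle, so that reading [z] leads
    from g@v back to g@v. *)
Lemma cycle_or_finite v z y : p <= size v -> size z = p -> size y = p ->
  section g (v ++ z) = section g v \/ section g (v ++ z ++ y) = 1%g.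
Proof.
move=> sv sz sy; case: (pselect (section g (v ++ z ++ y) = 1%g)) => nt; [by right | left].
have [v1 [u [vE su]]] : exists v1 u, v = v1 ++ u /\ size u = p.
  exists (take (size v - p) v), (drop (size v - p) v).
  by rewrite cat_take_drop size_drop subKn.
have [r [U [t [uE sU EU]]]] := repeat_cycle v1 su.
have [y1 [Y [y2 [yE sY EY]]]] := repeat_cycle (v ++ z) sy.
have tp : size t <= p by rewrite -su uE size_cat leq_addl.
have yp : size y1 <= p by rewrite -sy yE size_cat leq_addr.
rewrite catA in EU.
have vE' : v = (v1 ++ r) ++ t by rewrite vE uE catA.
have mE : t ++ z ++ y1 = take (size (t ++ z ++ y1)) (reps 3 U).
  (* three rounds, as the word in between may have length 3p *)
  apply: (@no_pump g (v1 ++ r) (reps 3 U) _ (reps 3 Y)) => //.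
  - by rewrite size_reps sU muln_gt0.
  - by rewrite !size_reps sU sY.
  - by rewrite size_reps !size_cat sU sz !mulSn mul0n addn0 leq_add // leq_add2l.
  - exact: section_reps.
  - rewrite [X in section g X](_ : _ = (v ++ z ++ y1) ++ reps 3 Y); last first.
      by rewrite vE' -!catA.
    rewrite section_reps; first by rewrite vE' -!catA.
    by move: EY; rewrite -!catA.
  rewrite [X in section g X](_ : _ = v ++ z ++ y1); last by rewrite vE' -!catA.
  move=> E; apply: nt; rewrite yE [X in section g X](_ : _ = (v ++ z ++ y1) ++ y2).
    by rewrite -section_cat E section1.
  by rewrite -!catA.
have tE : t = take (size t) U.
  have := congr1 (take (size t)) mE.
  rewrite take_size_cat // take_takel ?size_cat ?leq_addr // => ->.
  by rewrite size_takel ?takel_cat ?sU // size_reps sU mulSn (leq_trans tp) ?leq_addr.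
have tzE : t ++ z = U ++ t.
  have := congr1 (take (size (t ++ z))) mE.
  rewrite catA take_size_cat // take_takel ?size_cat ?leq_addr // => ->.
  rewrite ?size_cat sz -sU addnC takeD reps_S take_size_cat // drop_size_cat //.
  by rewrite reps_S takel_cat ?sU // -tE.
rewrite {1}vE' -catA tzE catA (section_congr _ EU).
by rewrite -vE'.
Qed.

End States.
End Bounded.

(** * Computable functions *)

Class Enc (A : Type) := enc : A -> data.
#[global] Instance Enc_nat : Enc nat := enc_nat.
#[global] Instance Enc_ord n : Enc 'I_n := @enc_ord n.
#[global] Instance Enc_bool : Enc bool := fun b => if b then Pair Defs.Nil Defs.Nil else Defs.Nil.
#[global] Instance Enc_unit : Enc unit := fun=> Defs.Nil.
#[global] Instance Enc_prod A B (eA : Enc A) (eB : Enc B) : Enc (A * B) := enc_prod eA eB.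
#[global] Instance Enc_sum A B (eA : Enc A) (eB : Enc B) : Enc (A + B) := enc_sum eA eB.
#[global] Instance Enc_seq A (eA : Enc A) : Enc (seq A) := enc_seq eA.
#[global] Instance Enc_regex A (eA : Enc A) : Enc (regex A) := enc_regex eA.

(** The program must halt on all of [data], not only on codes: [Rec] also visits
    subtrees that encode nothing of the intended type. *)
Definition computable A B {eA : Enc A} {eB : Enc B} (f : A -> B) :=
  exists P F, (forall x, computes P x (F x)) /\ forall a, F (enc a) = enc (f a).

Section Basic.
Context {A B B1 B2 R : Type} {eA : Enc A} {eB : Enc B} {eB1 : Enc B1} {eB2 : Enc B2} {eR : Enc R}.

Lemma computable_ext (f g : A -> B) : f =1 g -> computable f -> computable g.
Proof. by move=> /funext ->. Qed.

Lemma computable_id : computable (fun x : A => x).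
Proof. by exists Defs.Id, id; split=> [x|//]; constructor. Qed.

Lemma computable_const (b : B) : computable (fun _ : A => b).
Proof. by exists (Quote (enc b)), (fun=> enc b); split=> [x|//]; constructor. Qed.

Lemma computable_comp (f : B -> R) (g : A -> B) :
  computable f -> computable g -> computable (fun x => f (g x)).
Proof.
move=> [P [F [PF FE]]] [Q [G [QG GE]]]; exists (Comp P Q), (F \o G); split.
  by move=> x; econstructor; [exact: QG | exact: PF].
by move=> a /=; rewrite GE FE.
Qed.

Lemma computable_pair (f : A -> B1) (g : A -> B2) :
  computable f -> computable g -> computable (fun x => (f x, g x)).
Proof.
move=> [P [F [PF FE]]] [Q [G [QG GE]]].
exists (Defs.Cons P Q), (fun x => Pair (F x) (G x)); split.
  by move=> x; constructor.
by move=> a; rewrite FE GE.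
Qed.

Lemma computable_raw P h (f : A -> B) (g : B -> R) : (forall x, computes P x (h x)) ->
  (forall b, h (enc b) = enc (g b)) -> computable f -> computable (fun x => g (f x)).
Proof. by move=> Ph hE; apply: computable_comp; exists P, h. Qed.

Lemma computable_if (b : A -> bool) (f g : A -> R) : computable b -> computable f ->
  computable g -> computable (fun x => if b x then f x else g x).
Proof.
move=> [T [H [TH HE]]] [P [F [PF FE]]] [Q [G [QG GE]]].
exists (If T P Q), (fun x => if H x is Pair _ _ then F x else G x); split.
  move=> x; have := TH x; case: (H x) => [|y z] h.
    by apply: ev_if_nil h _.
  by apply: ev_if_pair h _.
by move=> a; rewrite HE /=; case: (b a) => /=.
Qed.

End Basic.

Section BinaryRaw.
Context {A B1 B2 R : Type} {eA : Enc A} {eB1 : Enc B1} {eB2 : Enc B2} {eR : Enc R}.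

Lemma computable_raw2 (P : prog) h (f : A -> B1) (g : A -> B2) (k : B1 -> B2 -> R) :
  (forall x, computes P x (h x)) ->
  (forall b1 b2, h (Pair (enc b1) (enc b2)) = enc (k b1 b2)) ->
  computable f -> computable g -> computable (fun x => k (f x) (g x)).
Proof.
move=> Ph hE cf cg; apply: (@computable_comp _ _ _ _ _ _ (fun p => k p.1 p.2) _ _ (computable_pair cf cg)).
by exists P, h; split=> // -[b1 b2]; exact: hE.
Qed.

End BinaryRaw.

Section Basic2.
Context {A B B1 B2 : Type} {eA : Enc A} {eB : Enc B} {eB1 : Enc B1} {eB2 : Enc B2}.

Lemma computable_fst (f : A -> B1 * B2) : computable f -> computable (fun x => (f x).1).
Proof. exact: computable_raw ev_hd _. Qed.

Lemma computable_snd (f : A -> B1 * B2) : computable f -> computable (fun x => (f x).2).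
Proof. exact: computable_raw ev_tl _. Qed.

Lemma computable_cons (f : A -> B) (g : A -> seq B) :
  computable f -> computable g -> computable (fun x => f x :: g x).
Proof. by apply: (computable_raw2 (k := cons) ev_id). Qed.

Lemma computable_behead (f : A -> seq B) : computable f -> computable (fun x => behead (f x)).
Proof. by apply: (computable_raw ev_tl) => -[]. Qed.

Lemma computable_S (f : A -> nat) : computable f -> computable (fun x => (f x).+1).
Proof.
apply: (computable_raw (g := S) (P := Defs.Cons (Quote Defs.Nil) Defs.Id) (h := (Pair Defs.Nil))) => // x.
by do 2 constructor.
Qed.

Lemma computable_pred (f : A -> nat) : computable f -> computable (fun x => (f x).-1).
Proof. by apply: (computable_raw ev_tl) => -[]. Qed.

Lemma computable_eq0 (f : A -> nat) : computable f -> computable (fun x => f x == 0).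
Proof.
apply: (computable_raw (g := fun n : nat => n == 0) (P := If Defs.Id (Quote Defs.Nil) (Quote (Pair Defs.Nil Defs.Nil)))
  (h := fun x => if x is Pair _ _ then Defs.Nil else Pair Defs.Nil Defs.Nil)) => [[|x y]|[]//].
  by apply: ev_if_nil; constructor.
by apply: ev_if_pair; constructor.
Qed.

Lemma computable_inl (f : A -> B1) : computable f -> computable (fun x => inl (f x) : B1 + B2).
Proof.
apply: (computable_raw (g := @inl B1 B2) (P := Defs.Cons (Quote Defs.Nil) Defs.Id) (h := (Pair Defs.Nil))) => // x.
by do 2 constructor.
Qed.

Lemma computable_inr (f : A -> B2) : computable f -> computable (fun x => inr (f x) : B1 + B2).
Proof.
apply: (computable_raw (g := @inr B1 B2) (P := Defs.Cons (Quote (Pair Defs.Nil Defs.Nil)) Defs.Id) (h := (Pair (Pair Defs.Nil Defs.Nil)))) => // x.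
by do 2 constructor.
Qed.

Lemma computable_ord n (f : A -> 'I_n) : computable f -> computable (fun x => f x : nat).
Proof. by apply: (computable_raw (g := @nat_of_ord n) ev_id). Qed.

Lemma computable_Chr (f : A -> B) : computable f -> computable (fun x => Chr (f x)).
Proof.
apply: (computable_raw (g := @Chr B) (P := Defs.Cons (Quote (enc_nat 2)) Defs.Id) (h := (Pair (enc_nat 2)))) => // x.
by do 2 constructor.
Qed.

Lemma computable_Star (f : A -> regex B) : computable f -> computable (fun x => Star (f x)).
Proof.
apply: (computable_raw (g := @Star B) (P := Defs.Cons (Quote (enc_nat 5)) Defs.Id) (h := (Pair (enc_nat 5)))) => // x.
by do 2 constructor.
Qed.

Lemma computable_Alt (f g : A -> regex B) : computable f -> computable g ->
  computable (fun x => Alt (f x) (g x)).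
Proof.
apply: (computable_raw2 (k := @Alt B) (P := Defs.Cons (Quote (enc_nat 3)) Defs.Id) (h := (Pair (enc_nat 3)))) => // x.
by do 2 constructor.
Qed.

Lemma computable_Cat (f g : A -> regex B) : computable f -> computable g ->
  computable (fun x => Cat (f x) (g x)).
Proof.
apply: (computable_raw2 (k := @Cat B) (P := Defs.Cons (Quote (enc_nat 4)) Defs.Id) (h := (Pair (enc_nat 4)))) => // x.
by do 2 constructor.
Qed.

End Basic2.

Section Basic3.
Context {A B B1 B2 R : Type} {eA : Enc A} {eB : Enc B} {eB1 : Enc B1} {eB2 : Enc B2} {eR : Enc R}.

Fixpoint data_rec (z q : data -> data) p x :=
  if x is Pair x1 x2 then q (Pair p (Pair x (Pair (data_rec z q p x1) (data_rec z q p x2))))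
  else z p.

Lemma computable_case (s : A -> B1 + B2) (f : A -> B1 -> R) (g : A -> B2 -> R) :
  computable s -> computable (fun p : A * B1 => f p.1 p.2) ->
  computable (fun p : A * B2 => g p.1 p.2) ->
  computable (fun x => match s x with inl a => f x a | inr b => g x b end).
Proof.
move=> [S [H [SH HE]]] [P [F [PF FE]]] [Q [G [QG GE]]].
pose arg := Defs.Cons Defs.Id (Comp Tl S).
have argE x : computes arg x (Pair x (tl (H x))).
  by constructor; [constructor | econstructor; [exact: SH | constructor]].
exists (If (Comp Hd S) (Comp Q arg) (Comp P arg)),
  (fun x => if hd (H x) is Pair _ _ then G (Pair x (tl (H x))) else F (Pair x (tl (H x)))).
split=> [x|a].
  have T : computes (Comp Hd S) x (hd (H x)).
    by econstructor; [exact: SH | constructor].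
  case E: (hd (H x)) T => [|y z] T.
    by apply: ev_if_nil T _; econstructor; [exact: argE | exact: PF].
  by apply: ev_if_pair T _; econstructor; [exact: argE | exact: QG].
rewrite HE; case: (s a) => b /=.
  exact: (FE (a, b)).
exact: (GE (a, b)).
Qed.

(** A list is a right comb. [Rec] also recurses into the heads of the list; those
    results are discarded. *)
Lemma computable_foldr (F : A -> B -> R -> R) (z : A -> R) (s : A -> seq B) :
  computable (fun p : A * (B * R) => F p.1 p.2.1 p.2.2) ->
  computable z -> computable s ->
  computable (fun x => foldr (F x) (z x) (s x)).
Proof.
move=> [P [f [Pf fE]]] [Z [Zf [ZZ ZE]]] [S [H [SH HE]]].
pose arg := Defs.Cons Hd (Defs.Cons (Comp Hd (Comp Hd Tl)) (Comp Tl (Comp Tl Tl))).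
pose argf x := Pair (hd x) (Pair (hd (hd (tl x))) (tl (tl (tl x)))).
have argE x : computes arg x (argf x).
  constructor; first by constructor.
  by constructor; do 3 (econstructor; try by constructor).
have QE x : computes (Comp P arg) x (f (argf x)).
  by econstructor; [exact: argE | exact: Pf].
have RE p x : computes (Rec Z (Comp P arg)) (Pair p x) (data_rec Zf (f \o argf) p x).
  elim: x => [|x1 IH1 x2 IH2] /=; first by constructor.
  by econstructor; [exact: IH1 | exact: IH2 | exact: QE].
exists (Comp (Rec Z (Comp P arg)) (Defs.Cons Defs.Id S)), (fun x => data_rec Zf (f \o argf) x (H x)).
split=> [x|a].
  by econstructor; [constructor; [constructor | exact: SH] | exact: RE].
rewrite HE; elim: (s a) => [|b t IH] /=; first by rewrite ZE.
by rewrite IH; exact: (fE (a, (b, foldr (F a) (z a) t))).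
Qed.

End Basic3.

Section Basic4.
Context {A R : Type} {eA : Enc A} {eR : Enc R}.

Lemma computable_iter (n : A -> nat) (F : A -> R -> R) (z : A -> R) :
  computable n -> computable (fun p : A * R => F p.1 p.2) -> computable z ->
  computable (fun x => iter (n x) (F x) (z x)).
Proof.
move=> cn cF cz.
apply: (@computable_ext _ _ _ _ (fun x => foldr (fun (_ : unit) => F x) (z x) (nseq (n x) tt))).
  by move=> x; elim: (n x) => //= k ->.
apply: computable_foldr => //.
  apply: (@computable_comp _ _ _ _ _ _ (fun p : A * R => F p.1 p.2) (fun p : A * (unit * R) => (p.1, p.2.2))) => //.
  by apply: computable_pair; do ?[apply: computable_fst | apply: computable_snd | apply: computable_id].
case: cn => P [h [Ph hE]]; exists P, h; split=> // a; rewrite hE.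
by elim: (n a) => // k IH; exact: (congr1 (Pair Defs.Nil) IH).
Qed.

End Basic4.

Section Local.
Context {A B1 B2 B3 R : Type} {eA : Enc A} {eB1 : Enc B1} {eB2 : Enc B2} {eB3 : Enc B3} {eR : Enc R}.

Lemma computable_comp2 (F : B1 -> B2 -> R) (f : A -> B1) (g : A -> B2) :
  computable (fun p => F p.1 p.2) -> computable f -> computable g ->
  computable (fun x => F (f x) (g x)).
Proof. by move=> cF cf cg; exact: (computable_comp cF (computable_pair cf cg)). Qed.

Lemma computable_comp3 (F : B1 -> B2 -> B3 -> R) (f : A -> B1) (g : A -> B2) (h : A -> B3) :
  computable (fun p => F p.1 p.2.1 p.2.2) -> computable f -> computable g ->
  computable h -> computable (fun x => F (f x) (g x) (h x)).
Proof. by move=> cF cf cg ch; exact: (computable_comp cF (computable_pair cf (computable_pair cg ch))). Qed.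

End Local.

(** The closure lemmas have conclusions of the form [computable (fun x => f (g x))],
    so that proof search can follow the syntax of the function. *)
Create HintDb comp.
#[global] Hint Constants Opaque : comp.
#[global] Hint Variables Opaque : comp.
#[global] Hint Resolve computable_id computable_pair computable_fst computable_snd
  computable_cons computable_behead computable_S computable_pred computable_eq0
  computable_inl computable_inr computable_ord computable_Chr computable_Star
  computable_Alt computable_Cat computable_case computable_foldr computable_iter
  computable_if : comp.
#[global] Hint Resolve computable_const | 0 : comp.
#[global] Hint Extern 5 (computable _) => match goal with
  | H : computable ?f |- computable (fun x => ?f (@?g x)) => apply (computable_comp H)
  | H : computable (fun p => ?f p.1 p.2) |- computable (fun x => ?f (@?g x) (@?h x)) =>
      apply (computable_comp2 H)
  | H : computable (fun p => ?f p.1 p.2.1 p.2.2) |-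
      computable (fun x => ?f (@?g x) (@?h x) (@?k x)) => apply (computable_comp3 H)
  end : comp.
Ltac comp := solve [eauto 2000 with comp nocore].
Ltac comp_ext f := apply: (@computable_ext _ _ _ _ f).

Section Nat.
Context {A : Type} {eA : Enc A}.

Lemma computable_sub (f g : A -> nat) : computable f -> computable g ->
  computable (fun x => f x - g x).
Proof.
move=> cf cg; comp_ext (fun x => iter (g x) predn (f x)).
  by move=> x; elim: (g x) => [|n IH] /=; rewrite ?subn0 // IH subnS.
comp.
Qed.

Lemma computable_add (f g : A -> nat) : computable f -> computable g ->
  computable (fun x => f x + g x).
Proof.
move=> cf cg; comp_ext (fun x => iter (f x) S (g x)).
  by move=> x; elim: (f x) => //= n ->.
comp.
Qed.

End Nat.
#[global] Hint Resolve computable_sub computable_add : comp.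

Section Bools.
Context {A : Type} {eA : Enc A}.

Lemma computable_mul (f g : A -> nat) : computable f -> computable g ->
  computable (fun x => f x * g x).
Proof.
move=> cf cg; comp_ext (fun x => iter (f x) (fun r => g x + r) 0).
  by move=> x; elim: (f x) => //= n ->.
comp.
Qed.

Lemma computable_and (f g : A -> bool) : computable f -> computable g ->
  computable (fun x => f x && g x).
Proof.
move=> cf cg; comp_ext (fun x => if f x then g x else false) => [x|].
  by case: (f x).
comp.
Qed.

Lemma computable_not (f : A -> bool) : computable f -> computable (fun x => ~~ f x).
Proof.
move=> cf; comp_ext (fun x => if f x then false else true) => [x|]; [by case: (f x) | comp].
Qed.

Lemma computable_imp (f g : A -> bool) : computable f -> computable g ->
  computable (fun x => f x ==> g x).
Proof.
move=> cf cg; comp_ext (fun x => if f x then g x else true) => [x|].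
  by case: (f x).
comp.
Qed.

Lemma computable_leq (f g : A -> nat) : computable f -> computable g ->
  computable (fun x => f x <= g x).
Proof. by move=> cf cg; apply: computable_eq0; comp. Qed.

End Bools.
#[global] Hint Resolve computable_mul computable_and computable_not computable_imp
  computable_leq : comp.

Section Seqs.
Context {A B B1 B2 : Type} {eA : Enc A} {eB : Enc B} {eB1 : Enc B1} {eB2 : Enc B2}.
Implicit Types (f g s : A -> seq B) (n : A -> nat).

Lemma computable_size s : computable s -> computable (fun x => size (s x)).
Proof.
move=> cs; comp_ext (fun x => foldr (fun _ k => k.+1) 0 (s x)); last comp.
by move=> x; elim: (s x) => //= b t ->.
Qed.

Lemma computable_cat f g : computable f -> computable g -> computable (fun x => f x ++ g x).
Proof.
move=> cf cg; comp_ext (fun x => foldr (fun b r => b :: r) (g x) (f x)); last comp.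
by move=> x; elim: (f x) => //= b t ->.
Qed.

Lemma computable_map (F : A -> B1 -> B2) (s : A -> seq B1) :
  computable (fun p => F p.1 p.2) -> computable s ->
  computable (fun x => map (F x) (s x)).
Proof.
move=> cF cs; comp_ext (fun x => foldr (fun b r => F x b :: r) [::] (s x)) => [x|].
  by elim: (s x) => //= b t ->.
comp.
Qed.

End Seqs.
#[global] Hint Resolve computable_size computable_cat computable_map : comp.

Section Seqs2.
Context {A B : Type} {eA : Enc A} {eB : Enc B}.
Implicit Types (f g s : A -> seq B) (n : A -> nat).

Lemma computable_rcons s (b : A -> B) : computable s -> computable b ->
  computable (fun x => rcons (s x) (b x)).
Proof.
move=> cs cb; comp_ext (fun x => s x ++ [:: b x]) => [x|]; last comp.
by rewrite cats1.
Qed.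

Lemma computable_filter (F : A -> B -> bool) s : computable (fun p => F p.1 p.2) ->
  computable s -> computable (fun x => filter (F x) (s x)).
Proof.
move=> cF cs; comp_ext (fun x => foldr (fun b r => if F x b then b :: r else r) [::] (s x)) => [x|].
  by elim: (s x) => //= b t ->.
comp.
Qed.

Lemma computable_all (F : A -> B -> bool) s : computable (fun p => F p.1 p.2) ->
  computable s -> computable (fun x => all (F x) (s x)).
Proof.
move=> cF cs; comp_ext (fun x => foldr (fun b r => F x b && r) true (s x)) => [x|].
  by elim: (s x) => //= b t ->.
comp.
Qed.

Lemma computable_head s (b : A -> B) : computable s -> computable b ->
  computable (fun x => head (b x) (s x)).
Proof.
move=> cs cb; comp_ext (fun x => foldr (fun c _ => c) (b x) (s x)) => [x|].
  by case: (s x).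
comp.
Qed.

Lemma computable_drop s n : computable s -> computable n ->
  computable (fun x => drop (n x) (s x)).
Proof.
move=> cs cn; comp_ext (fun x => iter (n x) behead (s x)) => [x|].
  elim: (n x) (s x) => [|k IH] t; first by rewrite drop0.
  by rewrite iterSr IH; case: t => //=; rewrite drop_nil.
comp.
Qed.

Lemma computable_nseq n (b : A -> B) : computable n -> computable b ->
  computable (fun x => nseq (n x) (b x)).
Proof. by move=> cn cb; comp_ext (fun x => iter (n x) (cons (b x)) [::]) => [//|]; comp. Qed.

Lemma computable_flatten (s : A -> seq (seq B)) : computable s -> computable (fun x => flatten (s x)).
Proof. by move=> cs; comp_ext (fun x => foldr (fun b r => b ++ r) [::] (s x)) => [//|]; comp. Qed.

End Seqs2.
#[global] Hint Resolve computable_rcons computable_filter computable_all computable_head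
  computable_drop computable_nseq computable_flatten : comp.

Section Seqs3.
Context {A B B1 B2 R : Type} {eA : Enc A} {eB : Enc B} {eB1 : Enc B1} {eB2 : Enc B2} {eR : Enc R}.
Implicit Types (f g s : A -> seq B) (n : A -> nat).

Lemma computable_rev s : computable s -> computable (fun x => rev (s x)).
Proof.
move=> cs; comp_ext (fun x => foldr (fun b r => rcons r b) [::] (s x)) => [x|]; last comp.
by elim: (s x) => //= b t ->; rewrite rev_cons.
Qed.

Lemma computable_nth (b : A -> B) s n : computable b -> computable s -> computable n ->
  computable (fun x => nth (b x) (s x) (n x)).
Proof.
move=> cb cs cn; comp_ext (fun x => head (b x) (drop (n x) (s x))) => [x|]; last comp.
by rewrite -nth0 nth_drop addn0.
Qed.

Lemma computable_iota0 n : computable n -> computable (fun x => iota 0 (n x)).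
Proof.
move=> cn; comp_ext (fun x => iter (n x) (fun l => rcons l (size l)) [::]) => [x|]; last comp.
by elim: (n x) => // k IH; rewrite iterS IH size_iota -cats1 -[k.+1]addn1 iotaD.
Qed.

Lemma computable_allpairs (F : A -> B1 -> B2 -> R) (s : A -> seq B1) (t : A -> seq B2) :
  computable (fun p => F p.1 p.2.1 p.2.2) -> computable s -> computable t ->
  computable (fun x => [seq F x y z | y <- s x, z <- t x]).
Proof.
move=> cF cs ct.
comp_ext (fun x => flatten [seq [seq F x y z | z <- t x] | y <- s x]) => [//|]; comp.
Qed.

Lemma computable_sumn (s : A -> seq nat) : computable s -> computable (fun x => sumn (s x)).
Proof. by move=> cs; comp_ext (fun x => foldr (fun b r => b + r) 0 (s x)) => [//|]; comp. Qed.

End Seqs3.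
#[global] Hint Resolve computable_rev computable_nth computable_iota0
  computable_allpairs computable_sumn : comp.

Section Seqs4.
Context {A B R : Type} {eA : Enc A} {eB : Enc B} {eR : Enc R}.
Implicit Types (f g s : A -> seq B) (n : A -> nat).

Lemma computable_take s n : computable s -> computable n ->
  computable (fun x => take (n x) (s x)).
Proof.
move=> cs cn; comp_ext (fun x => rev (drop (size (s x) - n x) (rev (s x)))) => [x|]; last comp.
rewrite drop_rev revK; have [h|h] := leqP (n x) (size (s x)); first by rewrite subKn.
rewrite take_oversize ?take_oversize // ?(ltnW h) //.
by rewrite (eqP (_ : _ - n x == 0)) ?subn0 // subn_eq0 ltnW.
Qed.

Lemma computable_foldl (F : A -> R -> B -> R) (z : A -> R) s :
  computable (fun p => F p.1 p.2.1 p.2.2) -> computable z -> computable s ->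
  computable (fun x => foldl (F x) (z x) (s x)).
Proof.
move=> cF cz cs; comp_ext (fun x => foldr (fun b r => F x r b) (z x) (rev (s x))) => [x|]; last comp.
by rewrite -foldl_rev revK.
Qed.

End Seqs4.
#[global] Hint Resolve computable_take computable_foldl : comp.

Section Seqs5.
Context {A B B1 B2 R : Type} {eA : Enc A} {eB : Enc B} {eB1 : Enc B1} {eB2 : Enc B2} {eR : Enc R}.

Lemma computable_last (b : A -> B) (s : A -> seq B) : computable s -> computable b ->
  computable (fun x => last (b x) (s x)).
Proof.
move=> cs cb; comp_ext (fun x => foldl (fun _ c => c) (b x) (s x)) => [x|]; last comp.
by elim: (s x) (b x) => //=.
Qed.

Lemma computable_transduce (step : A -> R -> B1 -> R * B2) (q : A -> R) (u : A -> seq B1) :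
  computable (fun p => step p.1 p.2.1 p.2.2) -> computable q -> computable u ->
  computable (fun x => transduce (step x) (q x) (u x)).
Proof. by move=> cF cq cu; rewrite /transduce; comp. Qed.

End Seqs5.
#[global] Hint Resolve computable_last computable_transduce : comp.

Class EqComp (T : eqType) {eT : Enc T} := eq_comp : computable (fun p : T * T => p.1 == p.2).
Arguments EqComp T {eT}.

Lemma computable_eq (T : eqType) (A : Type) (eA : Enc A) (eT : Enc T) (f g : A -> T) :
  EqComp T -> computable f -> computable g -> computable (fun x => f x == g x).
Proof. by move=> h cf cg; apply: (computable_comp2 (F := fun a b : T => a == b)). Qed.

#[global] Instance eq_nat : @EqComp _ Enc_nat.
Proof.
rewrite /EqComp; comp_ext (fun p : nat * nat => (p.1 <= p.2) && (p.2 <= p.1)) => [p|]; last comp.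
by rewrite eqn_leq.
Qed.

#[global] Instance eq_ord n : @EqComp _ (@Enc_ord n).
Proof.
rewrite /EqComp; comp_ext (fun p : 'I_n * 'I_n => (p.1 : nat) == p.2 :> nat) => [//|].
apply: computable_eq; comp.
Qed.

#[global] Instance eq_pair (T1 T2 : eqType) (e1 : Enc T1) (e2 : Enc T2)
  (h1 : EqComp T1) (h2 : EqComp T2) : @EqComp _ (Enc_prod e1 e2).
Proof.
rewrite /EqComp; comp_ext (fun p : (T1 * T2) * (T1 * T2) => (p.1.1 == p.2.1) && (p.1.2 == p.2.2)).
  by case=> -[a b] [c e].
by apply: computable_and; apply: computable_eq => //; comp.
Qed.

(** Two lists are compared position by position. The slices of length one avoid a
    default element. *)
#[global] Instance eq_seq (T : eqType) (e : Enc T) (h : EqComp T) : @EqComp _ (Enc_seq e).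
Proof.
rewrite /EqComp; comp_ext (fun p : seq T * seq T => (size p.1 == size p.2) &&
  all (fun i => all (fun c => all (fun c' => c == c') (take 1 (drop i p.2))) (take 1 (drop i p.1)))
      (iota 0 (size p.1))) => [[s t] /=|].
  apply/andP/eqP => [[/eqP sz /allP al]|<-]; last first.
    split=> //; apply/allP => i; rewrite mem_iota /= add0n => si.
    case: s si => // x0 s si.
    by rewrite (drop_nth x0 si) /= take0 /= eqxx.
  case: s sz al => [|x0 s] sz al; first by case: t sz {al}.
  apply: (@eq_from_nth _ x0) => // i si.
  have := al i; rewrite mem_iota /= add0n => /(_ si).
  rewrite (drop_nth x0 si) (drop_nth x0 (_ : i < size t)) -?sz //= !take0 /=.
  by rewrite !andbT => /eqP.
apply: computable_and; first by apply: computable_eq; comp.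
apply: computable_all; last comp; apply: computable_all; last comp; apply: computable_all; last comp.
by apply: computable_eq; comp.
Qed.

#[global] Hint Extern 1 (computable _) => lazymatch goal with
  | |- computable (fun x => @eq_op _ (@?f x) (@?g x)) => eapply computable_eq; [typeclasses eauto | | ];
      cbn [Equality.sort Datatypes_prod__canonical__eqtype_Equality
        Datatypes_list__canonical__eqtype_Equality Datatypes_nat__canonical__eqtype_Equality
        fintype_ordinal__canonical__eqtype_Equality]
  end : comp.
#[global] Hint Extern 0 (EqComp _) => exact _ : comp.
Definition tuples (A : Type) k (l : seq A) : seq (seq A) :=
  iter k (fun L => [seq x :: y | x <- l, y <- L]) [:: [::]].

Arguments tuples : simpl never.

Lemma computable_tuples A B (eA : Enc A) (eB : Enc B) (l : A -> seq B) (n : A -> nat) :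
  computable n -> computable l -> computable (fun x => tuples (n x) (l x)).
Proof. by move=> cn cl; rewrite /tuples; comp. Qed.
#[global] Hint Resolve computable_tuples : comp.

Section Elim.
Context {A : Type} {N : eqType} {eA : Enc A} {eN : Enc N}.
Variables (T : eqType) (eT : Enc T).
Hypothesis eqN : EqComp N.

Lemma computable_lookup (M : A -> seq ((N * N) * regex T)) (ab : A -> N * N) :
  computable M -> computable ab -> computable (fun x => lookup (M x) (ab x)).
Proof. move=> cM cab; rewrite /lookup; comp. Qed.

End Elim.
#[global] Hint Resolve computable_lookup : comp.

Section Elim2.
Context {A : Type} {N : eqType} {eA : Enc A} {eN : Enc N}.
Variables (T : eqType) (eT : Enc T).
Hypothesis eqN : EqComp N.

Lemma computable_kleene_matrix (enabled : A -> T -> N -> bool) (move : A -> T -> N -> N)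
    (syms : A -> seq T) (nodes l : A -> seq N) :
  computable (fun p => enabled p.1 p.2.1 p.2.2) ->
  computable (fun p => move p.1 p.2.1 p.2.2) ->
  computable syms -> computable nodes -> computable l ->
  computable (fun x => kleene_matrix (enabled x) (move x) (syms x) (nodes x) (l x)).
Proof.
move=> ce cm cs cn cl; rewrite /kleene_matrix /elim_node /edge_matrix /edge.
comp.
Qed.

Lemma computable_alts (rs : A -> seq (regex T)) : computable rs -> computable (fun x => alts (rs x)).
Proof.
move=> cr; comp_ext (fun x => foldr (fun r s => Alt r s) Void (rs x)) => [x|]; last comp.
by elim: (rs x) => //= r s ->.
Qed.

End Elim2.
#[global] Hint Resolve computable_kleene_matrix computable_alts : comp.

(** * The grammar as a computable function of the automata *)

Section Algorithm.
Variables (d : nat) (c0 : 'I_d).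
(** For each generator its table of transitions and outputs and its initial state;
    then the preperiod and the period of the ray. *)
Definition input := (seq (seq (seq (nat * 'I_d)) * nat) * (seq 'I_d * seq 'I_d))%type.
Implicit Types (inp : input) (q : nat * nat).
#[local] Instance Enc_input : Enc input := Enc_prod _ _.

Definition rows inp x := nth ([::], 0) inp.1 x.
(** A state is a pair of the index of an automaton and one of its states. *)
Definition delta inp q (c : 'I_d) : (nat * nat) * 'I_d :=
  let r := nth (0, c0) (nth [::] (rows inp q.1).1 q.2) c in ((q.1, r.1), r.2).
Definition bstep inp q u := transduce (delta inp) q u.
(** Distinct states act differently, so a state acts trivially only if all its
    transitions are loops that copy the letter. *)
Definition trivial_state inp q := all (fun c => delta inp q c == (q, c)) (enum 'I_d).
Definition initial_state inp x := (x, (rows inp x).2).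
Definition size_bound inp :=
  size inp.2.1 + size inp.2.2 + sumn [seq size r.1 | r <- inp.1].
(** A common multiple of the numbers up to [size_bound inp], and at least as
    large: it bounds all preperiods and is divisible by all periods. *)
Definition block_len inp := foldr muln 1 [seq i.+1 | i <- iota 0 (size_bound inp)].
Definition blocks inp := tuples (block_len inp) (enum 'I_d).
Definition nt_list inp : seq (seq (seq 'I_d) * seq (seq 'I_d)) :=
  [seq (p, o) | p <- tuples 3 (blocks inp), o <- [::] :: tuples 3 (blocks inp)].
Definition nt_src inp i := (nth ([::], [::]) (nt_list inp) i).1.
Definition nt_dst inp i := (nth ([::], [::]) (nt_list inp) i).2.
(** Long enough to contain two blocks, as the period is nonempty. *)
Definition ray_word inp := inp.2.1 ++ flatten (nseq (2 * block_len inp) inp.2.2).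
Definition head_block inp := take (block_len inp) (ray_word inp).
Definition period_block inp := take (block_len inp) (drop (block_len inp) (ray_word inp)).
Definition base_node inp := [:: head_block inp; period_block inp; period_block inp].

(** The rules are polymorphic in the names of letters and nonterminals: the
    grammar itself uses ordinals, and the program uses natural numbers. *)
Section Rules.
Variables (I W : eqType) (inp : input) (init : I -> nat * nat)
  (src dst : W -> seq (seq 'I_d)) (syms : seq (I + W)).
Let step := bstep inp.
Let triv := trivial_state inp.
Definition nodes k := [::] :: tuples k (blocks inp).

(** [m = 0] and [k = 3] give gamma; [m = 1] and [k = 4] give beta. *)
Definition first_return_regex m k sp a o :=
  alts [seq lookup (kleene_matrix (enabled step triv init src sp true) (move step init dst) syms
                     (nodes k) [seq b <- nodes k | unmarked [::] m b]) (a, b)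
       | b <- [seq b <- nodes k | mark [::] m b == o]].
Definition beta_regex (w : W) := first_return_regex 1 4 true (stretch [::] 1 (src w)) (dst w).
Definition gamma_regex (w : W) := first_return_regex 0 3 false (stretch [::] 0 (src w)) (dst w).
Definition co_regex :=
  alts [seq lookup (kleene_matrix (enabled step triv init src true false) (move step init dst) syms
                     (nodes 3) (nodes 3)) (base_node inp, b)
       | b <- [seq b <- nodes 3 | b != base_node inp]].
Definition wp_regex :=
  Alt Eps (lookup (kleene_matrix (enabled_diag [::] step triv init src dst) (move step init dst) syms
                     (nodes 3) (nodes 3)) (base_node inp, base_node inp)).
End Rules.

Definition sym_codes inp : seq (nat + nat) :=
  [seq inl i | i <- iota 0 (size inp.1)] ++ [seq inr i | i <- iota 0 (size (nt_list inp))].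

(** Tables 0, 1, 2 are alpha, beta, gamma; alpha has one value for all
    nonterminals, so that any of them can be the start symbol. *)
Definition grammar_code (al : input -> regex (nat + nat)) inp :=
  (size (nt_list inp),
   ([:: [seq al inp | i <- iota 0 (size (nt_list inp))];
        [seq beta_regex inp (initial_state inp) (nt_src inp) (nt_dst inp) (sym_codes inp) i
           | i <- iota 0 (size (nt_list inp))];
        [seq gamma_regex inp (initial_state inp) (nt_src inp) (nt_dst inp) (sym_codes inp) i
           | i <- iota 0 (size (nt_list inp))]],
    (Cat (Chr 0) (Cat (Star (Chr 1)) (Chr 2)), 0))).

Definition co_code inp := co_regex inp (initial_state inp) (nt_src inp) (nt_dst inp) (sym_codes inp).
Definition wp_code inp := wp_regex inp (initial_state inp) (nt_src inp) (nt_dst inp) (sym_codes inp).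

End Algorithm.

Section Computability.
Variables (d : nat) (c0 : 'I_d).
Notation input := (input d).
#[local] Instance Enc_input' : Enc input := Enc_prod _ _.
Section Comp1.
Context {A : Type} {eA : Enc A}.
Implicit Types (inp : A -> input) (q : A -> nat * nat).

Lemma computable_delta inp q (c : A -> 'I_d) : computable inp -> computable q -> computable c ->
  computable (fun x => delta c0 (inp x) (q x) (c x)).
Proof. by move=> ci cq cc; rewrite /delta /rows; comp. Qed.

Lemma computable_initial_state inp (n : A -> nat) : computable inp -> computable n ->
  computable (fun x => initial_state (inp x) (n x)).
Proof. by move=> ci cn; rewrite /initial_state /rows; comp. Qed.

Lemma computable_block_len inp : computable inp -> computable (fun x => block_len (inp x)).
Proof. by move=> ci; rewrite /block_len /size_bound; comp. Qed.
End Comp1.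
#[local] Hint Resolve computable_delta computable_initial_state computable_block_len :
  comp.

Section Comp2.
Context {A : Type} {eA : Enc A}.
Implicit Types (inp : A -> input) (q : A -> nat * nat).

Lemma computable_bstep inp q (u : A -> seq 'I_d) : computable inp -> computable q -> computable u ->
  computable (fun x => bstep c0 (inp x) (q x) (u x)).
Proof. by move=> ci cq cu; rewrite /bstep; comp. Qed.

Lemma computable_trivial_state inp q : computable inp -> computable q ->
  computable (fun x => trivial_state c0 (inp x) (q x)).
Proof. by move=> ci cq; rewrite /trivial_state; comp. Qed. 

Lemma computable_blocks inp : computable inp -> computable (fun x => blocks (inp x)).
Proof. by move=> ci; rewrite /blocks; comp. Qed.

Lemma computable_ray_word inp : computable inp -> computable (fun x => ray_word (inp x)).
Proof. by move=> ci; rewrite /ray_word; comp. Qed.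
End Comp2.
#[local] Hint Resolve computable_bstep computable_trivial_state computable_blocks
  computable_ray_word : comp.

Section Comp3.
Context {A : Type} {eA : Enc A}.
Implicit Types (inp : A -> input) (q : A -> nat * nat).

Lemma computable_nt_list inp : computable inp -> computable (fun x => nt_list (inp x)).
Proof. by move=> ci; rewrite /nt_list; comp. Qed.

Lemma computable_nodes inp (k : A -> nat) : computable inp -> computable k ->
  computable (fun x => nodes (inp x) (k x)).
Proof. by move=> ci ck; rewrite /nodes; comp. Qed.

Lemma computable_base_node inp : computable inp -> computable (fun x => base_node (inp x)).
Proof. by move=> ci; rewrite /base_node /head_block /period_block; comp. Qed.
End Comp3.
#[local] Hint Resolve computable_nt_list computable_nodes computable_base_node : comp.

Section Comp4.
Context {A : Type} {eA : Enc A}.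
Implicit Types (inp : A -> input) (q : A -> nat * nat).

Lemma computable_nt_src inp (i : A -> nat) : computable inp -> computable i ->
  computable (fun x => nt_src (inp x) (i x)).
Proof. by move=> ci ck; rewrite /nt_src; comp. Qed.

Lemma computable_nt_dst inp (i : A -> nat) : computable inp -> computable i ->
  computable (fun x => nt_dst (inp x) (i x)).
Proof. by move=> ci ck; rewrite /nt_dst; comp. Qed.

Lemma computable_sym_codes inp : computable inp -> computable (fun x => sym_codes (inp x)).
Proof. by move=> ci; rewrite /sym_codes; comp. Qed.

Lemma computable_stretch (D : eqType) (eD : Enc D) (d0 : A -> D) (m : A -> nat) (b : A -> seq D) :
  computable d0 -> computable m -> computable b ->
  computable (fun x => stretch (d0 x) (m x) (b x)).
Proof. by move=> c1 c2 c3; rewrite /stretch; comp. Qed.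

Lemma computable_run (D I Q : eqType) (eD : Enc D) (eI : Enc I) (eQ : Enc Q)
    (step : A -> Q -> D -> Q * D) (init : A -> I -> Q) (x : A -> I) (v : A -> seq D) :
  computable (fun p => step p.1 p.2.1 p.2.2) -> computable (fun p => init p.1 p.2) ->
  computable x -> computable v ->
  computable (fun a => run (step a) (init a) (x a) (v a)).
Proof. by move=> c1 c2 c3 c4; rewrite /run; comp. Qed.
End Comp4.
#[local] Hint Resolve computable_nt_src computable_nt_dst computable_sym_codes
  computable_stretch computable_run : comp.

Section Comp5.
Context {A : Type} {eA : Enc A}.
Implicit Types (inp : A -> input) (q : A -> nat * nat).

Lemma computable_mark (D : eqType) (eD : Enc D) (d0 : A -> D) (m : A -> nat) (b : A -> seq D) :
  EqComp D -> computable d0 -> computable m -> computable b ->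
  computable (fun x => mark (d0 x) (m x) (b x)).
Proof. by move=> h c1 c2 c3; rewrite /mark; comp. Qed.

Lemma computable_enabled inp (sp et : A -> bool) (s : A -> nat + nat) (v : A -> seq (seq 'I_d)) :
  computable inp -> computable sp -> computable et -> computable s -> computable v ->
  computable (fun x => enabled (bstep c0 (inp x)) (trivial_state c0 (inp x)) (initial_state (inp x)) (nt_src (inp x))
    (sp x) (et x) (s x) (v x)).
Proof. by move=> c1 c2 c3 c4 c5; rewrite /enabled /defined_at; comp. Qed.

Lemma computable_move inp (s : A -> nat + nat) (v : A -> seq (seq 'I_d)) :
  computable inp -> computable s -> computable v ->
  computable (fun x => move (bstep c0 (inp x)) (initial_state (inp x)) (nt_dst (inp x)) (s x) (v x)).
Proof. by move=> c1 c2 c3; rewrite /move /out; comp. Qed.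
End Comp5.
#[local] Hint Resolve computable_mark computable_enabled computable_move : comp.

Section Comp6.
Context {A : Type} {eA : Enc A}.
Implicit Types (inp : A -> input) (q : A -> nat * nat).

Lemma computable_enabled_diag inp (s : A -> nat + nat) (v : A -> seq (seq 'I_d)) :
  computable inp -> computable s -> computable v ->
  computable (fun x => enabled_diag [::] (bstep c0 (inp x)) (trivial_state c0 (inp x)) (initial_state (inp x)) (nt_src (inp x))
    (nt_dst (inp x)) (s x) (v x)).
Proof. by move=> c1 c2 c3; rewrite /enabled_diag; comp. Qed.

Lemma computable_first_return_regex inp (m k : A -> nat) (sp : A -> bool) (a o : A -> seq (seq 'I_d)) :
  computable inp -> computable m -> computable k -> computable sp -> computable a ->
  computable o ->
  computable (fun x => first_return_regex c0 (inp x) (initial_state (inp x)) (nt_src (inp x)) (nt_dst (inp x))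
    (sym_codes (inp x)) (m x) (k x) (sp x) (a x) (o x)).
Proof. by move=> c1 c2 c3 c4 c5 c6; rewrite /first_return_regex /unmarked; comp. Qed.

End Comp6.
#[local] Hint Resolve computable_enabled_diag computable_first_return_regex : comp.

Lemma computable_co_code : computable (co_code c0).
Proof. by rewrite /co_code /co_regex; comp. Qed.

Lemma computable_wp_code : computable (wp_code c0).
Proof. by rewrite /wp_code /wp_regex; comp. Qed.

Lemma computable_grammar_code al : computable al -> computable (grammar_code c0 al).
Proof. by move=> cal; rewrite /grammar_code /beta_regex /gamma_regex; comp. Qed.
End Computability.

(** * Renaming the symbols of the rules *)

Fixpoint rmap (A B : Type) (f : A -> B) (r : regex A) : regex B :=
  match r with
  | Void => Void | Eps => Eps | Chr x => Chr (f x)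
  | Alt r1 r2 => Alt (rmap f r1) (rmap f r2)
  | Cat r1 r2 => Cat (rmap f r1) (rmap f r2)
  | Star r1 => Star (rmap f r1)
  end.

Lemma enc_rmap (A B : Type) (f : A -> B) (e : B -> data) r :
  enc_regex e (rmap f r) = enc_regex (fun x => e (f x)) r.
Proof. by elim: r => //= [r1 -> r2 ->|r1 -> r2 ->|r ->]. Qed.

Definition rmap_matrix (N : eqType) (S S' : Type) (f : S -> S')
  (M : seq ((N * N) * regex S)) := [seq (e.1, rmap f e.2) | e <- M].

Section Naturality.
Variables (N S S' : eqType) (f : S -> S') (enabled : S -> N -> bool) (en' : S' -> N -> bool)
  (move : S -> N -> N) (mv' : S' -> N -> N).
Hypothesis enabledE : forall s a, en' (f s) a = enabled s a.
Hypothesis moveE : forall s a, mv' (f s) a = move s a.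

Lemma rmap_lookup (M : seq ((N * N) * regex S)) ab : lookup (rmap_matrix f M) ab = rmap f (lookup M ab).
Proof. by elim: M => //= e M ->; case: ifP. Qed.

Lemma rmap_kleene_matrix syms nodes l :
  kleene_matrix en' mv' [seq f s | s <- syms] nodes l = rmap_matrix f (kleene_matrix enabled move syms nodes l).
Proof.
elim: l => [|k l IH] /=.
  rewrite /rmap_matrix map_allpairs; apply/eq_allpairs => a b; congr (_, _).
  by rewrite /edge; elim: syms => //= s ss ->; rewrite enabledE moveE; case: ifP.
rewrite -/(kleene_matrix _ _ _ _ _) IH /elim_node /rmap_matrix -!map_comp.
by apply: eq_map => e /=; rewrite !rmap_lookup.
Qed.

Lemma rmap_alts (rs : seq (regex S)) : rmap f (alts rs) = alts [seq rmap f r | r <- rs].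
Proof. by elim: rs => //= r rs ->. Qed.

End Naturality.

(** * Derivations and derivation trees *)

Section Grammars.
Variables (Sigma : Type) (E : et0l Sigma).
Notation sym := (Sigma + 'I_(nonterms E))%type.
Implicit Types (s : sym) (u w : seq sym) (r : seq 'I_(ntables E)) (t : 'I_(ntables E)).

Definition derives r s w := @rewrites _ E r [:: s] w.

Lemma Forall2_cat (A B : Type) (R : A -> B -> Prop) l1 l2 m1 m2 :
  List.Forall2 R l1 m1 -> List.Forall2 R l2 m2 -> List.Forall2 R (l1 ++ l2) (m1 ++ m2).
Proof. by elim=> //= a b l m h _ IH /IH; constructor. Qed.

Lemma Forall2_catl (A B : Type) (R : A -> B -> Prop) l1 l2 m :
  List.Forall2 R (l1 ++ l2) m -> exists m1 m2,
  [/\ m = m1 ++ m2, List.Forall2 R l1 m1 & List.Forall2 R l2 m2].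
Proof.
elim: l1 m => [|a l1 IH] m /= h; first by exists [::], m.
inversion h as [|? b ? m' ab hm]; subst; have [m1 [m2 [-> h1 h2]]] := IH _ hm.
by exists (b :: m1), m2; split=> //; constructor.
Qed.

Lemma step1 t s w : @step _ E t [:: s] w <-> table t s w.
Proof.
split=> [[us F ->]|h].
  inversion F as [|? w1 ? us' h F']; subst; inversion F'; subst.
  by rewrite /= cats0.
exists [:: w]; last by rewrite /= cats0.
by constructor.
Qed.

(** In a controlled derivation the symbols of a word evolve independently. *)
Lemma rewrites_flat r u w : @rewrites _ E r u w <->
  exists2 wss, List.Forall2 (derives r) u wss & w = flatten wss.
Proof.
elim: r u w => [|t r IH] u w.
  split=> [->|[wss F ->]].
    exists [seq [:: s] | s <- u]; last by rewrite flatten_seq1.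
    by elim: u => //= s u F; constructor.
  by elim: F => //= s ws u' wss' -> _ <-.
split=> [[w1 [us F ->] /IH [wss F' ->]]|[wss F ->]].
  elim: F wss F' => [|s us1 u' us' h F IHF] wss F'.
    by inversion F'; subst; exists [::].
  have [m1 [m2 [-> F1 F2]]] := Forall2_catl F'.
  have [wss' F3 E3] := IHF _ F2.
  exists (flatten m1 :: wss'); last by rewrite flatten_cat E3.
  constructor=> //; exists us1; first exact/step1.
  by apply/IH; exists m1.
suff [us F1 [wss' F2 ->]] : exists2 us, List.Forall2 (table t) u us &
    exists2 wss', List.Forall2 (derives r) (flatten us) wss' & flatten wss = flatten wss'.
  by exists (flatten us); [exists us | apply/IH; exists wss'].
elim: F => [|s ws u' wss' [w1 /step1 h /IH [m1 F1 wE]] _ [us F2 [m2 F3 E3]]].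
  by exists [::] => //; exists [::].
exists (w1 :: us); first by constructor.
exists (m1 ++ m2); first exact: Forall2_cat.
by rewrite /= E3 wE flatten_cat.
Qed.

Lemma derives_cons t r s w : derives (t :: r) s w <->
  exists u wss, [/\ table t s u, List.Forall2 (derives r) u wss & w = flatten wss].
Proof.
split=> [[u /step1 h /rewrites_flat [wss F ->]]|[u [wss [h F ->]]]].
  by exists u, wss.
by exists u; [exact/step1 | apply/rewrites_flat; exists wss].
Qed.

Lemma derives_terminal r x w : derives r (inl x) w <-> w = [:: inl x].
Proof.
elim: r w => [|t r IH] w; first by [].
rewrite derives_cons; split=> [[u [wss [/= -> F ->]]]|->].
  inversion F as [|? w1 ? m h F']; subst; inversion F'; subst.
  by move/IH: h => ->.
exists [:: inl x], [:: [:: inl x]]; split=> //.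
by constructor=> //; apply/IH.
Qed.

Notation tree := (ltree (option sym)).

Lemma expanded_leaf r (T : tree) : label T = None -> expanded r T -> T = LNode None [::].
Proof. by case: T => [l Ts] /= ->; case: r => [|t r] /= ->. Qed.

Lemma expanded_terminal r (T : tree) x : label T = Some (inl x) -> expanded r T ->
  T = LNode (Some (inl x)) [::].
Proof. by case: T => [l Ts] /= ->; case: r => [|t r] /= ->. Qed.

Definition children_of (u : seq sym) r (Ts : seq tree) :=
  if u is [::] then Ts = [:: LNode None [::]]
  else [seq label T | T <- Ts] = map Some u /\ List.Forall (expanded r) Ts.

Lemma expanded_inr t r (T : tree) v : label T = Some (inr v) -> expanded (t :: r) T ->
  exists u, [/\ table t (inr v) u, children_of u r (children T)
    & yield T = if u is [::] then [::] else flatten [seq yield T' | T' <- children T]].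
Proof.
case: T => [l Ts] /= -> [[u h lE] F]; exists u; split=> //.
  case: u h lE => [|s u] h lE //.
  case: Ts lE F => [|T []] //= [lT] F.
  by inversion F as [|? ? eT ?]; subst; rewrite (expanded_leaf lT eT).
case: u h lE => [|s u] h lE.
  case: Ts lE F => [|T []] //= [lT] F.
  by inversion F as [|? ? eT ?]; subst; rewrite (expanded_leaf lT eT).
by case: Ts lE F => [|T Ts].
Qed.

Lemma expanded_derives r (T : tree) s : label T = Some s -> expanded r T ->
  derives r s (yield T).
Proof.
elim: r T s => [|t r IH] T s lT eT.
  by case: T lT eT => [l Ts] /= -> ->.
case: s lT => [x|v] lT.
  by rewrite (expanded_terminal lT eT); apply/derives_terminal.
have [u [h c ->]] := expanded_inr lT eT; apply/derives_cons.
exists u; case: u h c => [|s u] h c; first by exists [::]; split=> //.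
case: c => lE F; exists [seq yield T' | T' <- children T]; split=> //.
elim: {h}(s :: u) (children T) lE F => [|s' u' IHu] [|T' Ts] //= [lT' lTs] F.
inversion F; subst; constructor; last exact: IHu.
exact: IH.
Qed.

(** A word derived from a nonterminal in one application of [t] followed by [r]
    determines the word after [t] and how it is distributed. *)
Definition uniq_parse t r := forall v u u' wss wss',
  table t (inr v) u -> table t (inr v) u' ->
  List.Forall2 (derives r) u wss -> List.Forall2 (derives r) u' wss' ->
  flatten wss = flatten wss' -> u = u' /\ wss = wss'.

Fixpoint uniq_parses r := if r is t :: r' then uniq_parse t r' /\ uniq_parses r' else True.

Lemma children_derives u r (Ts : seq tree) : children_of u r Ts ->
  List.Forall2 (derives r) u (if u is [::] then [::] else [seq yield T | T <- Ts]).
Proof.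
case: u => [|s u] // [lE F].
elim: (s :: u) Ts lE F => [|s' u' IHu] [|T' Ts] //= [lT' lTs] F.
inversion F; subst; constructor; last exact: IHu.
exact: expanded_derives.
Qed.

Lemma tree_uniq r (T T' : tree) : uniq_parses r -> label T = label T' ->
  expanded r T -> expanded r T' -> yield T = yield T' -> T = T'.
Proof.
elim: r T T' => [|t r IH] T T'.
  by case: T T' => [l Ts] [l' Ts'] _ /= -> -> ->.
move=> [up ups] lE eT eT' yE.
case lT: (label T) => [[x|v]|]; last first.
- by rewrite (expanded_leaf lT eT) (expanded_leaf _ eT') // -lE.
- have lT' : label T' = Some (inr v) by rewrite -lE.
  have [u [h c y]] := expanded_inr lT eT; have [u' [h' c' y']] := expanded_inr lT' eT'.
  have yE' : flatten (if u is [::] then [::] else [seq yield T0 | T0 <- children T]) =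
             flatten (if u' is [::] then [::] else [seq yield T0 | T0 <- children T']).
    by move: yE; rewrite y y'; case: (u); case: (u').
  have [uE wE] := up _ _ _ _ _ h h' (children_derives c) (children_derives c') yE'.
  suff cE : children T = children T'.
    by case: T T' lT lT' cE {eT eT' lE yE c c' y y' yE' wE} => [l Ts] [l' Ts'] /= -> -> ->.
  rewrite -uE in c' wE; case: (u) c c' wE => [|s u1] /=; first by move=> -> ->.
  move=> [l1 F1] [l2 F2]; rewrite -l2 in l1.
  elim: (children T) (children T') l1 F1 F2 => [|T1 Ts IHT] [|T2 Ts'] //= [lT1 lTs] F1 F2 [yT yTs].
  inversion F1; inversion F2; subst; congr (_ :: _); last exact: IHT.
  exact: IH.
- have lT' : label T' = Some (inl x) by rewrite -lE.
  by rewrite (expanded_terminal lT eT) (expanded_terminal lT' eT').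
Qed.

End Grammars.

(** Interior vertices can be restricted to a finite set closed under the enabled
    moves. *)
Lemma endpoint_in (N S : eqType) (move : S -> N -> N) (enabled : S -> N -> bool) (ok : pred N) (nodes : seq N) us a b :
  (forall s c, c \in nodes -> enabled s c -> move s c \in nodes) -> a \in nodes ->
  endpoint move enabled ok us a = Some b ->
  endpoint move enabled [in [seq c <- nodes | ok c]] us a = Some b /\ b \in nodes.
Proof.
move=> cl; elim: us a => [|s us IH] a // an /endpoint_consP [es [[-> ->]|[o h]]].
  by rewrite endpoint_cons1 //; split=> //; exact: cl.
have [f bn] := IH _ (cl _ _ an es) h; split=> //; apply: endpoint_consS => //.
by rewrite /= mem_filter o cl.
Qed.

Lemma endpoint_out (N S : eqType) (move : S -> N -> N) (enabled : S -> N -> bool) (ok : pred N) (nodes : seq N) us a b :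
  endpoint move enabled [in [seq c <- nodes | ok c]] us a = Some b -> endpoint move enabled ok us a = Some b.
Proof. by apply: endpoint_mono => // c; rewrite /= mem_filter => /andP []. Qed.

Lemma mem_tuples (A : eqType) k (l : seq A) u :
  (u \in tuples k l) = (size u == k) && all [in l] u.
Proof.
elim: k u => [|k IH] u; first by rewrite inE; case: u.
rewrite /tuples iterS -/(tuples k l); apply/allpairsP/andP => [[[x y] /= [xl yl ->]]|].
  by move: yl; rewrite IH => /andP [/eqP sy al] /=; rewrite sy xl.
case: u => [[]//|x u] [su xu]; have /andP [xl ul] : (x \in l) && all [in l] u by [].
by exists (x, u); split=> //=; rewrite IH ul -eqSS su.
Qed.

Lemma uniq_tuples (A : eqType) k (l : seq A) : uniq l -> uniq (tuples k l).
Proof.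
move=> ul; elim: k => [|k IH] //; rewrite /tuples iterS -/(tuples k l).
by apply: allpairs_uniq => // -[x u] [y v] _ _ /= [-> ->].
Qed.

Lemma transduce_flatten (Q A : Type) (step : Q -> A -> Q * A) q v :
  (transduce (transduce step) q v).1 = (transduce step q (flatten v)).1 /\
  flatten (transduce (transduce step) q v).2 = (transduce step q (flatten v)).2.
Proof.
elim: v q => [|u v IH] q //; rewrite transduce_cons /= transduce_cat /=.
by have [-> ->] := IH (transduce step q u).1.
Qed.

Lemma enc_seq_map A B (e : B -> data) (f : A -> B) s :
  enc_seq e (map f s) = enc_seq (e \o f) s.
Proof. by elim: s => //= x s ->. Qed.

(** * The two grammars of a periodic ray *)

Section Assembly.
Variables (d : nat) (c0 : 'I_d) (n : nat) (X : 'I_n -> taut d) (M : 'I_n -> mealy d).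
Variables (a b : seq 'I_d).
Hypothesis hd : 1 < d.
Hypothesis X_bounded : forall i, bounded_automaton_aut (X i).
Hypothesis XM : forall i, section_automaton (M i) (X i).
Hypothesis b_nil : 0 < size b.

Definition transition_table (m : mealy d) : seq (seq (nat * 'I_d)) :=
  [seq [seq (nat_of_ord (Defs.next q c), Defs.out q c) | c <- enum 'I_d] | q <- enum 'I_(nstates m)].
Definition inp : input d :=
  ([seq (transition_table (M i), nat_of_ord (Defs.init (M i))) | i <- enum 'I_n], (a, b)).

Lemma enc_input_data : enc inp = enc_input M a b.
Proof.
congr Pair.
change (enc_seq (enc_prod (enc_seq (enc_seq (enc_prod enc_nat (@enc_ord d)))) enc_nat)
  [seq (transition_table (M i), nat_of_ord (Defs.init (M i))) | i <- enum 'I_n] = enc_map (@enc_mealy d) M).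
rewrite /enc_map !enc_seq_map; congr enc_seq; apply/funext => i /=.
rewrite /enc_mealy /enc_prod /=; congr Pair.
rewrite /enc_map /transition_table !enc_seq_map; congr enc_seq; apply/funext => q /=.
by rewrite !enc_seq_map.
Qed.

Lemma rowsE (x : 'I_n) : rows inp x = (transition_table (M x), nat_of_ord (Defs.init (M x))).
Proof. by rewrite /rows (nth_map x) ?size_enum_ord // nth_ord_enum. Qed.

Lemma deltaE (x : 'I_n) (q : 'I_(nstates (M x))) c :
  delta c0 inp (nat_of_ord x, nat_of_ord q) c = ((nat_of_ord x, nat_of_ord (Defs.next q c)), Defs.out q c).
Proof.
rewrite /delta rowsE /= /transition_table (nth_map q) ?size_enum_ord // nth_ord_enum.
by rewrite (nth_map c) ?size_enum_ord // nth_ord_enum.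
Qed.

(** The naming of the sections by the states of the automaton, along each word. *)
Lemma section_naming (x : 'I_n) : exists2 phi : 'I_(nstates (M x)) -> taut d, injective phi &
  forall u, phi (state (M x) u) = section (X x) u /\
  forall q c, phi q [:: c] = [:: Defs.out q c] /\ section (phi q) [:: c] = phi (Defs.next q c).
Proof.
have [phi [phi_inj _ phi0 phiS]] := XM x; exists phi => // u; split=> //.
elim/last_ind: u => [|w c IH].
  by have [_ g0 _] := tautP (X x); rewrite /state /= phi0; apply/sectionP => w; rewrite g0.
by rewrite /state foldl_rcons -/(state _ w) -(proj2 (phiS _ _)) IH section_cat cats1.
Qed.

Lemma letter_run (x : 'I_n) u : transduce (delta c0 inp) (initial_state inp x) u =
  ((nat_of_ord x, nat_of_ord (state (M x) u)), X x u).
Proof.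
have [phi phi_inj phiP] := section_naming x.
elim/last_ind: u => [|u c IH].
  by have [_ -> _] := tautP (X x); rewrite /initial_state rowsE.
rewrite -cats1 transduce_cat IH (transduce_cons _ _ c) deltaE /state foldl_cat /=; congr (_, _).
rewrite section_funE -/(section (X x) u) ; congr (_ ++ _).
have [E] := phiP u; move/(_ (state (M x) u) c) => [<- _].
by rewrite E.
Qed.

Lemma triv_section (x : 'I_n) u :
  trivial_state c0 inp (nat_of_ord x, nat_of_ord (state (M x) u)) <-> section (X x) u = 1%g.
Proof.
have [phi phi_inj phiP] := section_naming x; have [E phiS] := phiP u; rewrite -E.
move: (state (M x) u) => q; split=> [/allP h|q1]; last first.
  apply/allP => c _; rewrite deltaE; apply/eqP; have [o s] := phiS q c.
  have -> : Defs.out q c = c by move: o; rewrite q1 => -[].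
  congr ((_, nat_of_ord _), _); apply: phi_inj.
  by rewrite -s q1 section1.
have loop c : Defs.next q c = q /\ Defs.out q c = c.
  have := h c; rewrite mem_enum deltaE => /(_ isT) /eqP [/val_inj -> ->]; by [].
apply: taut_ext => w; elim: w => [|c w IH] /=.
  by have [_ -> _] := tautP (phi q).
rewrite -[c :: w]/([:: c] ++ w) section_funE -/(section (phi q) [:: c]).
have [-> s] := phiS q c; have [nE oE] := loop c.
by rewrite -[section_fun _ _ _]/(section (phi q) [:: c] w) s nE oE IH.
Qed.

Notation p := (block_len inp).
Notation K := (size_bound inp).

Lemma bound_dvd l : 0 < l -> l <= K -> l %| p.
Proof.
move=> l0 lK; rewrite /block_len.
have : l \in [seq i.+1 | i <- iota 0 K].
  by apply/mapP; exists l.-1; rewrite ?mem_iota ?prednK //= add0n -ltnS prednK.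
elim: [seq _ | _ <- _] => //= x s IH; rewrite inE => /orP [/eqP <-|/IH].
  exact: dvdn_mulr.
exact: dvdn_mull.
Qed.

Lemma block_len_gt0 : 0 < p.
Proof.
rewrite /block_len; have : all (fun i => 0 < i) [seq i.+1 | i <- iota 0 K].
  by apply/allP => x /mapP [i _ ->].
by elim: [seq _ | _ <- _] => //= x s IH /andP [x0 /IH]; rewrite muln_gt0 x0.
Qed.

Lemma bound_leq l : l <= K -> l <= p.
Proof.
case: l => // l lK; apply: dvdn_leq; first exact: block_len_gt0.
exact: bound_dvd.
Qed.

Lemma nstates_leq x : nstates (M x) <= K.
Proof.
rewrite /size_bound; apply: leq_trans (leq_addl _ _).
rewrite -map_comp sumnE big_map (big_rem x) ?mem_enum //=.
by rewrite size_map size_enum_ord leq_addr.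
Qed.

Notation step := (bstep c0 inp).
Notation triv := (trivial_state c0 inp).
Definition start_state (x : 'I_n) := initial_state inp x.
Definition good (u : seq 'I_d) := size u == p.
Notation brun := (run step start_state).
Notation bout := (out step start_state).

Lemma block_run (x : 'I_n) v :
  brun x v = (nat_of_ord x, nat_of_ord (state (M x) (flatten v))) /\
  flatten (bout x v) = X x (flatten v).
Proof.
have [E1 E2] := transduce_flatten (delta c0 inp) (start_state x) v.
by rewrite /run /out [transduce step _ _]/(transduce (transduce _) _ _) E1 E2 letter_run.
Qed.

Lemma block_step (x : 'I_n) v z : (step (brun x v) z).1 =
  (nat_of_ord x, nat_of_ord (state (M x) (flatten v ++ z))).
Proof.
have := proj1 (block_run x (rcons v z)).
by rewrite flatten_rcons -cats1 run_cat transduce_cons.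
Qed.

Lemma size_flatten_ok v : all good v -> size (flatten v) = size v * p.
Proof.
elim: v => //= u v IH /andP [/eqP su vo]; rewrite size_cat su IH //.
Qed.

Lemma block_triv q u : triv q -> step q u = (q, u).
Proof.
move=> /allP h; apply: transduce_id => c; apply/eqP; apply: h.
by rewrite mem_enum.
Qed.

Lemma block_ok q u : good u -> good (step q u).2.
Proof. by rewrite /good size_transduce. Qed.

Lemma block_settle x v z y : v != [::] -> all good v -> good z -> good y ->
  (step (brun x v) z).1 = brun x v \/ triv (step (step (brun x v) z).1 y).1.
Proof.
move=> vn vo /eqP sz /eqP sy.
have sv : p <= size (flatten v).
  by rewrite size_flatten_ok //; case: v vn {vo} => // u v _; rewrite mulSn leq_addr.
have [//||E|E] := @cycle_or_finite _ _ _ (XM x) (X_bounded x) p block_len_gt0 _ _ (flatten v) z y sv sz sy.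
- exact: bound_leq (nstates_leq x).
- by move=> l l0 lM; apply: bound_dvd => //; apply: leq_trans lM (nstates_leq x).
- left; rewrite block_step (proj1 (block_run x v)).
  by rewrite (proj2 (state_section (XM x) _ _) E).
right; rewrite -{1}run_rcons block_step.
by apply/(triv_section x); rewrite flatten_rcons -catA.
Qed.

Lemma block_cycle x u z y : good u -> good z -> good y ->
  (step (brun x [:: u]) z).1 = brun x [:: u] ->
  (step (brun x [:: u]) y).1 = brun x [:: u] -> ~~ triv (brun x [:: u]) -> y = z.
Proof.
move=> _ /eqP sz /eqP sy; rewrite !block_step (proj1 (block_run x [:: u])) /= cats0.
move=> [/val_inj/(state_section (XM x)) E1] [/val_inj/(state_section (XM x)) E2] nt.
apply: (@cycle_uniq _ _ (X_bounded x) p block_len_gt0 u) => //.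
by move=> u1; move/negP: nt; apply; apply/triv_section.
Qed.

Lemma mem_blocks u : (u \in blocks inp) = good u.
Proof.
rewrite mem_tuples /good; case: eqP => //= _; apply/allP => c _ /=.
by rewrite mem_enum.
Qed.

Lemma all_blocks v : all [in blocks inp] v = all good v.
Proof. by apply: eq_all => u /=; rewrite mem_blocks. Qed.

Notation k := (size (nt_list inp)).
Definition src (i : 'I_k) := nt_src inp i.
Definition dst (i : 'I_k) := nt_dst inp i.

Lemma src_dst i : [/\ size (src i) = 3, all good (src i) &
  dst i = [::] \/ size (dst i) = 3 /\ all good (dst i)].
Proof.
have : nth ([::], [::]) (nt_list inp) i \in nt_list inp by exact: mem_nth.
rewrite /src /dst /nt_src /nt_dst; move: (nth _ _ i) => [p o] /allpairsP [[p1 o1] /= [h1 h2 [-> ->]]].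
move: h1; rewrite mem_tuples all_blocks => /andP [/eqP s1 a1].
move: h2; rewrite inE mem_tuples all_blocks => /orP [/eqP ->|/andP [/eqP s2 a2]].
  by split=> //; left.
by split=> //; right.
Qed.

Lemma src_size i : size (src i) = 3. Proof. by case: (src_dst i). Qed.
Lemma src_ok i : all good (src i). Proof. by case: (src_dst i). Qed.
Lemma dst_size i : dst i != [::] -> size (dst i) = 3.
Proof. by case: (src_dst i) => _ _ [->|[]]. Qed.
Lemma dst_ok i : all good (dst i). Proof. by case: (src_dst i) => _ _ [->|[]]. Qed.

(** Every pair is the code of some nonterminal; in particular the pieces found by
    cutting a walk have names. *)
Lemma nt_exists q o : size q = 3 -> all good q ->
  (o = [::] \/ size o = 3 /\ all good o) -> exists2 w, src w = q & dst w = o.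
Proof.
move=> sq aq ho.
have qo : (q, o) \in nt_list inp.
  apply/allpairsP; exists (q, o); rewrite /= inE !mem_tuples !all_blocks sq aq; split=> //.
  by case: ho => [->|[-> ->]] //; rewrite orbT.
have ik : index (q, o) (nt_list inp) < k by rewrite index_mem.
by exists (Ordinal ik); rewrite /src /dst /nt_src /nt_dst /= nth_index.
Qed.

Lemma nt_inj w w' : src w = src w' -> dst w = dst w' -> w = w'.
Proof.
rewrite /src /dst /nt_src /nt_dst => E1 E2; apply/val_inj/eqP.
have ub : uniq (blocks inp) by apply/uniq_tuples/enum_uniq.
have un : uniq (nt_list inp).
  apply: allpairs_uniq; first exact: uniq_tuples.
    by rewrite /= mem_tuples uniq_tuples.
  by move=> [? ?] [? ?].
rewrite -(nth_uniq ([::], [::]) (ltn_ord w) (ltn_ord w') un).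
by move: E1 E2; case: (nth _ _ w) => ? ?; case: (nth _ _ w') => ? ? /= -> ->.
Qed.

Definition syms : seq ('I_n + 'I_k) := [seq inl i | i <- enum 'I_n] ++ [seq inr i | i <- enum 'I_k].

Lemma symsP s : s \in syms.
Proof.
rewrite mem_cat; case: s => i; apply/orP; [left|right]; apply/mapP;
  by exists i; rewrite ?mem_enum.
Qed.

Notation moveE := (move step start_state dst).
Notation enabledE := (enabled step triv start_state src).
Notation enabled_diagE := (enabled_diag [::] step triv start_state src dst).
Notation first_returnE := (first_return [::] step triv start_state src dst).
Notation sym_langE := (sym_lang [::] step triv start_state src dst).

Lemma mem_nodes m v : (v \in nodes inp m) = (v == [::]) || (size v == m) && all good v.
Proof. by rewrite inE mem_tuples all_blocks. Qed.

Lemma nodes_closed m sp et s c : 2 < m -> c \in nodes inp m -> enabledE sp et s c ->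
  moveE s c \in nodes inp m.
Proof.
move=> m3; rewrite !mem_nodes => /orP [/eqP ->|/andP [/eqP sc co]].
  by rewrite /enabled (defined_at_sink src_size).
move=> _; have [//|mn] := altP (moveE s c =P [::]).
rewrite size_move ?sc //=; last exact: dst_size.
by rewrite eqxx; apply: move_ok => //; [exact: block_ok | exact: dst_ok].
Qed.

Lemma first_return_regexP m q sp x o us : 2 < q -> x \in nodes inp q ->
  lang (first_return_regex c0 inp start_state src dst syms m q sp x o) us <-> first_returnE m sp us x o.
Proof.
move=> q3 xn; rewrite /first_return_regex.
pose l := [seq c <- nodes inp q | unmarked [::] m c].
have ln : {subset l <= nodes inp q} by move=> c; rewrite mem_filter => /andP [].
rewrite lang_alts; split=> [[y]|[y f nE]].
  rewrite mem_filter => /andP [/eqP nE yn].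
  rewrite lookup_kleene // (lang_kleene _ _ symsP) => f.
  by exists y => //; exact: endpoint_out f.
have [f' yn] := endpoint_in (fun s c => @nodes_closed q sp true s c q3) xn f.
exists y; first by rewrite mem_filter nE eqxx.
by rewrite lookup_kleene // (lang_kleene _ _ symsP).
Qed.

Lemma full_regexP (en0 : 'I_n + 'I_k -> seq (seq 'I_d) -> bool) x y us :
  (forall s c, c \in nodes inp 3 -> en0 s c -> moveE s c \in nodes inp 3) ->
  x \in nodes inp 3 -> y \in nodes inp 3 ->
  lang (lookup (kleene_matrix en0 moveE syms (nodes inp 3) (nodes inp 3)) (x, y)) us <->
  endpoint moveE en0 predT us x = Some y.
Proof.
move=> cl xn yn; rewrite lookup_kleene // (lang_kleene _ _ symsP); split.
  exact: endpoint_mono.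
move=> f; have [f' _] := endpoint_in cl xn f.
by apply: endpoint_mono f' => // c cf; have : c \in [seq z <- nodes inp 3 | predT z] by []; rewrite mem_filter.
Qed.

Notation base := (base_node inp).

Lemma size_ray_word : 2 * p <= size (ray_word inp).
Proof.
rewrite /ray_word size_cat size_flatten /shape map_nseq sumn_nseq /=.
apply: leq_trans (leq_addl _ _); apply: leq_pmull; exact: b_nil.
Qed.

Lemma head_block_ok : good (head_block inp).
Proof.
rewrite /good size_takel //; apply: leq_trans size_ray_word.
by rewrite mul2n -addnn leq_addr.
Qed.

Lemma period_block_ok : good (period_block inp).
Proof.
rewrite /good size_takel // size_drop leq_subRL.
  by rewrite addnn -mul2n; exact: size_ray_word.
by apply: leq_trans size_ray_word; rewrite mul2n -addnn leq_addr.
Qed.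

Lemma base_ok : all good base. Proof. by rewrite /= head_block_ok period_block_ok. Qed.

Lemma base_in_nodes : base \in nodes inp 3. Proof. by rewrite mem_nodes base_ok orbT. Qed.

Lemma co_regexP us : lang (co_regex c0 inp start_state src dst syms) us <->
  exists2 y, endpoint moveE (enabledE true false) predT us base = Some y & y <> base.
Proof.
have cl s c := @nodes_closed 3 true false s c isT.
rewrite /co_regex lang_alts; split=> [[y]|[y f yN]].
  by rewrite mem_filter => /andP [/eqP yN yn] /(full_regexP _ cl base_in_nodes yn); exists y.
have [_ yn] := endpoint_in cl base_in_nodes f.
exists y; first by rewrite mem_filter yn andbT; apply/eqP.
exact/(full_regexP _ cl base_in_nodes yn).
Qed.

Lemma enabled_diag_enabled s c : enabled_diagE s c -> enabledE true false s c.
Proof. by case/and3P. Qed.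

Lemma wp_regexP us : lang (wp_regex c0 inp start_state src dst syms) us <->
  us = [::] \/ endpoint moveE enabled_diagE predT us base = Some base.
Proof.
have cl s c : c \in nodes inp 3 -> enabled_diagE s c -> moveE s c \in nodes inp 3.
  by move=> cn /enabled_diag_enabled; exact: nodes_closed.
by split=> [[->|/(full_regexP _ cl base_in_nodes base_in_nodes)]|[->|/(full_regexP _ cl base_in_nodes base_in_nodes)]];
  [left | right | left | right].
Qed.

Lemma stretch_node m w : stretch [::] m (src w) \in nodes inp (m + 3).
Proof.
by rewrite mem_nodes size_stretch src_size // eqxx stretch_ok ?src_size // src_ok orbT.
Qed.

Section Grammar.
Variable al : regex ('I_n + 'I_k).

Definition t_al : 'I_3 := ord0.
Definition t_be : 'I_3 := Ordinal (isT : 1 < 3).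
Definition t_ga : 'I_3 := Ordinal (isT : 2 < 3).

Lemma k_gt0 : 0 < k.
Proof.
have [w _ _] := @nt_exists base [::] erefl base_ok (or_introl erefl).
exact: leq_ltn_trans (ltn_ord w).
Qed.

Definition grammar : et0l 'I_n := @ET0L 'I_n k 3
  (fun t w => nth Void [:: al; beta_regex c0 inp start_state src dst syms w;
                           gamma_regex c0 inp start_state src dst syms w] t)
  (Cat (Chr t_al) (Cat (Star (Chr t_be)) (Chr t_ga)))
  (Ordinal k_gt0).
Notation E := grammar.

Lemma table_beta (w : 'I_k) us : @table _ E t_be (inr w) us <->
  beta_lang [::] step triv start_state src dst us w.
Proof. by apply: first_return_regexP => //; exact: (stretch_node 1). Qed.

Lemma table_gamma (w : 'I_k) us : @table _ E t_ga (inr w) us <-> sym_langE 0 (inr w) us.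
Proof. by apply: first_return_regexP => //; exact: (stretch_node 0). Qed.

Definition rho m : seq 'I_3 := t_al :: rcons (nseq m t_be) t_ga.

(** [beta_decomp] read as a derivation: m steps of beta lower the level to 3,
    where gamma finishes. *)
Lemma derives_sym_lang m s ws : @derives _ E (rcons (nseq m t_be) t_ga) s ws <-> sym_langE m s ws.
Proof.
case: s => [x|w]; first exact: derives_terminal.
elim: m w ws => [|m IH] w ws.
  split=> [[w1 /step1 /table_gamma h ->] //|h].
  by exists ws => //; apply/step1/table_gamma.
have IH' s v : @derives _ E (rcons (nseq m t_be) t_ga) s v <-> sym_langE m s v.
  by case: s => [x|w']; [exact: derives_terminal | exact: IH].
have F2 us wss : List.Forall2 (@derives _ E (rcons (nseq m t_be) t_ga)) us wss <->
    List.Forall2 (sym_langE m) us wss.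
  by split; elim=> [|s v us' wss' h _ h']; constructor=> //; exact/IH'.
rewrite (beta_decomp [::] block_triv block_ok block_settle block_cycle src_size src_ok dst_size dst_ok nt_exists).
rewrite [nseq _ _]/= rcons_cons derives_cons.
by split=> [[us [wss [/table_beta h /F2 F ->]]]|[us [wss [h F ->]]]]; exists us, wss;
  split=> //; [exact/table_beta | exact/F2].
Qed.

Lemma Forall2_derives m us wss :
  List.Forall2 (@derives _ E (rcons (nseq m t_be) t_ga)) us wss <->
  List.Forall2 (sym_langE m) us wss.
Proof.
by split; elim=> [|s v us' wss' h _ h']; constructor=> //; exact/derives_sym_lang.
Qed.

Lemma rewrites_rho m w : @rewrites _ E (rho m) [:: inr (start E)] w <->
  exists us wss, [/\ lang al us, List.Forall2 (sym_langE m) us wss & w = flatten wss].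
Proof.
rewrite [X in X <-> _](derives_cons _ _ (inr (start E))).
by split=> -[us [wss [h /Forall2_derives F ->]]]; exists us, wss.
Qed.

Definition al_derives m ws := exists us wss,
  [/\ lang al us, List.Forall2 (sym_langE m) us wss & ws = flatten wss].

(** What the two choices of alpha have in common. *)
Hypothesis al_path : forall us, lang al us ->
  us = [::] \/ exists y, endpoint moveE (enabledE true false) predT us base = Some y.
Hypothesis al_limit : forall m ws, al_derives m ws ->
  exists2 K, m <= K & forall j, K <= j -> al_derives j ws.

Lemma flatten_singletons (us : seq ('I_n + 'I_k)) wss :
  List.Forall2 (@derives _ E [::]) us wss -> flatten wss = us.
Proof. by elim=> //= s v us' wss' -> _ ->. Qed.

Lemma Forall_singletons (us : seq ('I_n + 'I_k)) wss wss' :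
  List.Forall2 (@derives _ E [::]) us wss -> List.Forall2 (@derives _ E [::]) us wss' ->
  wss = wss'.
Proof.
move=> F; elim: F wss' => [|s v us' wss1 -> _ IH] wss' F'; inversion F' as [|? v' ? wss2 h F2] => //; subst.
by rewrite h (IH _ F2).
Qed.

Definition parse_uniqE := parse_uniq (d0 := [::]) block_triv block_ok block_settle src_size dst_size dst_ok nt_inj.

Lemma flatten_sym_lang_nil m us wss : List.Forall2 (sym_langE m) us wss -> flatten wss = [::] ->
  us = [::] /\ wss = [::].
Proof. by case=> // s v us' wss' /sym_lang_nil; case: v. Qed.

Lemma grammar_uniq_parses m : @uniq_parses _ E (rho m).
Proof.
split.
  move=> v us us' wss wss' h h' /Forall2_derives F /Forall2_derives F' fE.
  have [us0|[y f]] := al_path h.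
    rewrite us0 in F *; inversion F; subst.
    by have [-> ->] := flatten_sym_lang_nil F' (esym fE).
  have [us0|[y' f']] := al_path h'.
    rewrite us0 in F' *; inversion F'; subst.
    by have [-> ->] := flatten_sym_lang_nil F fE.
  exact: (parse_uniqE _ base_ok f f' F F' fE).
elim: m => [|m IH].
  split=> // v us us' wss wss' _ _ F F'.
  rewrite (flatten_singletons F) (flatten_singletons F') => usE; split=> //.
  by apply: (Forall_singletons F); rewrite usE.
split=> // v us us' wss wss' /table_beta [y f _] /table_beta [y' f' _].
move=> /Forall2_derives F /Forall2_derives F'; apply: (parse_uniqE _ _ f f' F F').
  by rewrite size_stretch src_size.
by rewrite stretch_ok ?src_size // src_ok.
Qed.

Lemma controlP r : lang (control E) r <-> exists m, r = rho m.
Proof.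
split=> [[_ -> [_ [_ [rs F <-] [_ -> <-]] <-]]|[m ->]].
  exists (size rs); congr (_ :: _); elim: F => // r1 rs' -> _ IH.
  exact: (congr1 (cons t_be) IH).
exists [:: t_al] => //; exists (rcons (nseq m t_be) t_ga) => //.
exists (nseq m t_be); last by exists [:: t_ga]; rewrite ?cats1.
exists (nseq m [:: t_be]); first by elim: m => //= m IH; constructor.
by elim: m => //= m ->.
Qed.

Lemma grammar_unambiguous : unambiguous E.
Proof.
move=> r w T T' /controlP [m ->] [lT eT yT] [lT' eT' yT'].
apply: (tree_uniq (grammar_uniq_parses m)) => //; first by rewrite lT lT'.
by rewrite yT yT'.
Qed.

(** The only walk from [src w] with the label [w] itself: gamma may keep [w]. *)
Lemma table_gamma_self (w : 'I_k) : @table _ E t_ga (inr w) [:: inr w].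
Proof.
apply/table_gamma; have srcE : stretch [::] 0 (src w) = src w.
  by case: (src w) (src_size w) => [|u [|z e]] // _; rewrite stretch0.
exists (dst w).
  rewrite srcE endpoint_cons1 /=; last by rewrite /enabled /= take_oversize ?src_size // eqxx.
  by case: eqP => [->//|_]; rewrite drop_oversize ?src_size // cats0.
have [/eqP ->|dn] := boolP (dst w == [::]); first by rewrite mark_nil.
have dE : stretch [::] 0 (dst w) = dst w.
  by case: (dst w) (dst_size dn) => [|u [|z e]] // _; rewrite stretch0.
by rewrite -{1}dE mark_stretch // dst_size.
Qed.

Lemma table_gamma_src (w w' : 'I_k) : @table _ E t_ga (inr w) [:: inr w'] -> src w' = src w.
Proof.
move=> /table_gamma [y /endpoint_consP [/andP [/eqP /= <- _] _] _].
case: (src w) (src_size w) => [|u [|z [|c []]]] // _.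
Qed.

Lemma table_beta_src (w w' : 'I_k) : @table _ E t_be (inr w) [:: inr w'] ->
  src w' = take 3 (stretch [::] 1 (src w)).
Proof. by move=> /table_beta [y /endpoint_consP [/andP [/eqP /= <- _] _] _]. Qed.

Lemma two_blocks : exists e0 e1, [/\ good e0, good e1 & e0 <> e1].
Proof.
have d0 : 0 < d by exact: ltn_trans hd.
exists (nseq p (Ordinal d0)), (nseq p (Ordinal hd)).
rewrite /good !size_nseq; split=> //.
by have := block_len_gt0; case: (p) => // q _ [].
Qed.

Lemma nt_loop e0 e1 e2 : good e0 -> good e1 -> good e2 ->
  exists w, src w = [:: e0; e1; e2] /\ dst w = [:: e0; e1; e2].
Proof.
move=> h0 h1 h3; have ho : all good [:: e0; e1; e2] by rewrite /= h0 h1 h3.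
have [w s t] := nt_exists (erefl : size [:: e0; e1; e2] = 3) ho
  (or_intror (conj (erefl : size [:: e0; e1; e2] = 3) ho)).
by exists w.
Qed.

(** Alpha is constant, unlike beta and gamma. A nonterminal that starts at u z t
    belongs to its own value under gamma, but under beta the first label starts
    at u z z. *)
Lemma tables_distinct : [/\ @table _ E t_al <> @table _ E t_be,
  @table _ E t_al <> @table _ E t_ga & @table _ E t_be <> @table _ E t_ga].
Proof.
have [e0 [e1 [h0 h1 ne]]] := two_blocks.
have [w1 [s1 d1]] := nt_loop h0 h0 h0.
have [w2 [s2 d2]] := nt_loop h1 h0 h0.
have [w3 [s3 d3]] := nt_loop h0 h0 h1.
have be1 : @table _ E t_be (inr w1) [:: inr w1].
  apply/table_beta; exists [:: e0; e0; e0; e0]; last by rewrite d1 /mark stretchE /= eqxx.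
  have sE : stretch [::] 1 (src w1) = [:: e0; e0; e0; e0] by rewrite s1 stretchE.
  by rewrite sE endpoint_cons1 /= ?d1 // /enabled /= s1 eqxx.
split=> tE.
- have : @table _ E t_al (inr w2) [:: inr w1].
    by change (@table _ E t_al (inr w1) [:: inr w1]); rewrite tE.
  by rewrite tE => /table_beta_src; rewrite s1 s2 stretchE /= => -[/ne].
- have : @table _ E t_al (inr w2) [:: inr w1].
    by change (@table _ E t_al (inr w1) [:: inr w1]); rewrite tE; exact: table_gamma_self.
  by rewrite tE => /table_gamma_src; rewrite s1 s2 => -[/ne].
have := table_gamma_self w3; rewrite -tE => /table_beta_src.
by rewrite s3 stretchE /= => -[/esym/ne].
Qed.

Lemma grammar_limiting : limiting E.
Proof.
exists t_al, t_be, t_ga; split.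
- have [h1 h2 h3] := tables_distinct; split=> // t; rewrite !inE.
  by case: t => -[|[|[|]]].
- by rewrite eqEsubset; split=> r => [/controlP [m ->]|[m _ <-]]; [exists m | apply/controlP; exists m].
- by move=> v /table_beta [y].
- by move=> v; exists [:: inr v]; exact: table_gamma_self.
move=> m w /rewrites_rho /al_limit [K mK h]; exists K => // j /h h'.
exact/rewrites_rho.
Qed.

End Grammar.

Notation al_wpE := (wp_regex c0 inp start_state src dst syms).
Notation al_coE := (co_regex c0 inp start_state src dst syms).
Notation wp_derivesE := (wp_derives [::] step triv start_state src dst (head_block inp) (period_block inp)).
Notation walkE := (endpoint moveE (enabledE false false) predT).

Lemma wp_al_derives m ws : al_derives al_wpE m ws <-> wp_derivesE m ws.
Proof.
by split=> -[us [wss [h F ->]]]; exists us, wss; split=> //; apply/wp_regexP.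
Qed.

Lemma co_al_derives m ws : al_derives al_coE m ws <->
  exists2 v', walkE ws (stretch [::] m base) = Some v' & (v' == stretch [::] m base) = false.
Proof.
rewrite (alpha_decomp [::] block_triv block_ok block_settle block_cycle src_size src_ok dst_size dst_ok nt_exists
  (erefl : size base = 3) base_ok).
split=> [[us [wss [/co_regexP [y f yN] F ->]]]|[us [wss [y [f /eqP yN F ->]]]]].
  by exists us, wss, y; split=> //; apply/eqP.
by exists us, wss; split=> //; apply/co_regexP; exists y.
Qed.

Lemma wp_path us : lang al_wpE us ->
  us = [::] \/ exists y, endpoint moveE (enabledE true false) predT us base = Some y.
Proof.
move=> /wp_regexP [->|f]; [by left | right; exists base].
exact: endpoint_mono enabled_diag_enabled _ f.
Qed.

Lemma co_path us : lang al_coE us ->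
  us = [::] \/ exists y, endpoint moveE (enabledE true false) predT us base = Some y.
Proof. by move=> /co_regexP [y f _]; right; exists y. Qed.

Lemma wp_limit m ws : al_derives al_wpE m ws ->
  exists2 K, m <= K & forall j, K <= j -> al_derives al_wpE j ws.
Proof.
move=> /wp_al_derives /(wp_derives_limit block_triv block_ok block_settle block_cycle src_size src_ok dst_size
  dst_ok nt_exists head_block_ok period_block_ok) [K mK h]; exists K => // j /h h'.
exact/wp_al_derives.
Qed.

(** A walk that ends away from the prefix of the ray does so on every deeper
    level. *)
Lemma co_limit m ws : al_derives al_coE m ws ->
  exists2 K, m <= K & forall j, K <= j -> al_derives al_coE j ws.
Proof.
move=> /co_al_derives h; exists m => // j mj; apply/co_al_derives.
exact: (moved_limit src_size dst_size mj h).
Qed.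

Definition word_act (w : seq 'I_n) : taut d := (\big[*%g/1%g]_(i <- w) X i)%g.

Lemma word_act_cons i w u : word_act (i :: w) u = word_act w (X i u).
Proof. by rewrite /word_act big_cons. Qed.

(** On words of generators, walks compute the group action. *)
Lemma word_walk w v : w != [::] -> v != [::] -> all good v -> exists v',
  [/\ walkE [seq inl i | i <- w] v = Some v', size v' = size v, all good v' &
      flatten v' = word_act w (flatten v)].
Proof.
elim: w v => [|i w IH] v // _ vn vo.
have oo : all good (bout i v) by exact: transduce_ok block_ok _ _ vo.
have so : size (bout i v) = size v by exact: size_out.
have fo : flatten (bout i v) = X i (flatten v) by have [] := block_run i v.
have [w0|wn] := altP (w =P [::]).
  exists (bout i v); rewrite w0 /= /enabled /= vn; split=> //.
  by rewrite fo word_act_cons /word_act big_nil.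
have on : bout i v != [::] by rewrite -size_eq0 so size_eq0.
have [v' [f s' o' fl]] := IH (bout i v) wn on oo.
have ei : enabledE false false (inl i) v by rewrite /enabled /= vn.
exists v'; split=> //; first exact: (endpoint_consS ei (isT : predT (moveE (inl i) v)) f).
  by rewrite s'.
by rewrite fl fo word_act_cons.
Qed.

Lemma flatten_ok_inj v v' : size v = size v' -> all good v -> all good v' ->
  flatten v = flatten v' -> v = v'.
Proof.
elim: v v' => [|u v IH] [|u' v'] //= [sv] /andP [/eqP su vo] /andP [/eqP su' vo'] /eqP.
by rewrite eqseq_cat ?su // => /andP [/eqP -> /eqP /(IH _ sv vo vo') ->].
Qed.

Lemma stretch_base_ok m : all good (stretch [::] m base). Proof. by rewrite stretch_ok ?base_ok. Qed.

Lemma word_moved m w :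
  (exists2 v', walkE [seq inl i | i <- w] (stretch [::] m base) = Some v' &
     (v' == stretch [::] m base) = false) <->
  word_act w (flatten (stretch [::] m base)) <> flatten (stretch [::] m base).
Proof.
have [->|wn] := altP (w =P [::]).
  by split=> [[]//|]; rewrite /word_act big_nil.
have [v' [f s' o' fl]] := word_walk wn (isT : stretch [::] m base != [::]) (stretch_base_ok m).
rewrite f -fl; split=> [[_ [<-] /eqP ne] E|ne].
  by apply: ne; apply: flatten_ok_inj E => //; exact: stretch_base_ok.
by exists v' => //; apply/eqP => E; apply: ne; rewrite E.
Qed.

Lemma word_fixed m w :
  endpoint_or_start step triv start_state src dst [seq inl i | i <- w] (stretch [::] m base) = Some (stretch [::] m base) <->
  word_act w (flatten (stretch [::] m base)) = flatten (stretch [::] m base).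
Proof.
have [->|wn] := altP (w =P [::]).
  by split=> // _; rewrite /word_act big_nil.
have [v' [f s' o' fl]] := word_walk wn (isT : stretch [::] m base != [::]) (stretch_base_ok m).
have -> : endpoint_or_start step triv start_state src dst [seq inl i | i <- w] (stretch [::] m base) = Some v'.
  by case: (w) wn f.
rewrite -fl; split=> [[->//]|E]; congr Some.
by apply: flatten_ok_inj E => //; exact: stretch_base_ok.
Qed.

Notation eta := (periodic_ray c0 a b).
Notation ray_prefix N := (a ++ flatten (nseq N b)).

Lemma size_ray_prefix N : size (ray_prefix N) = size a + N * size b.
Proof. by rewrite size_cat size_flatten /shape map_nseq sumn_nseq mulnC. Qed.

Lemma nth_ray_prefix N i : i < size (ray_prefix N) -> nth c0 (ray_prefix N) i = eta i.
Proof.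
have pre N1 N2 : N1 <= N2 -> i < size (ray_prefix N1) -> nth c0 (ray_prefix N2) i = nth c0 (ray_prefix N1) i.
  move=> /subnKC <- iN; rewrite nseqD flatten_cat catA nth_cat iN //.
have ii : i < size (ray_prefix i.+1).
  by rewrite size_ray_prefix; apply: leq_trans (leq_addl _ _); apply: leq_pmulr.
by move=> iN; rewrite /periodic_ray; case: (leqP N i.+1) => [/pre->|/ltnW/pre->].
Qed.

(** Shifting by a block preserves the ray from the first block on, because the
    block length is a multiple of [size b] and at least [size a]. *)
Lemma eta_period i : p <= i -> eta (p + i) = eta i.
Proof.
move=> pi; have ap : size a <= p.
  by apply: bound_leq; rewrite /size_bound /= -addnA leq_addr.
have /dvdnP [t tE] : size b %| p.
  by apply: bound_dvd => //; rewrite /size_bound /= addnAC leq_addl.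
have ai : size a <= i by exact: leq_trans pi.
have ib : i < size a + i.+1 * size b.
  by apply: leq_trans (leq_addl _ _); apply: leq_pmulr.
rewrite -(@nth_ray_prefix (t + i.+1)); last first.
  by rewrite size_ray_prefix mulnDl -tE addnCA ltn_add2l.
rewrite -(@nth_ray_prefix i.+1 i); last by rewrite size_ray_prefix.
have f1 : (p + i < size a) = false by rewrite ltnNge (leq_trans ai) ?leq_addl.
have f2 : (i < size a) = false by rewrite ltnNge ai.
have st' : size (flatten (nseq t b)) = p.
  by rewrite size_flatten /shape map_nseq sumn_nseq mulnC -tE.
rewrite [in RHS]nth_cat f2 [in LHS]nth_cat f1 nseqD flatten_cat [in LHS]nth_cat st' -addnBA // ltnNge leq_addr.
by rewrite [~~ true]/= addKn.
Qed.

Lemma head_blockE : head_block inp = mkseq eta p.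
Proof.
apply: (@eq_from_nth _ c0); first by rewrite size_mkseq (eqP head_block_ok).
move=> i; rewrite (eqP head_block_ok) => ip; rewrite nth_mkseq // nth_take //.
apply: nth_ray_prefix; apply: leq_trans size_ray_word; apply: leq_trans ip _.
by rewrite mul2n -addnn leq_addr.
Qed.

Lemma period_blockE : period_block inp = mkseq (fun i => eta (p + i)) p.
Proof.
apply: (@eq_from_nth _ c0); first by rewrite size_mkseq (eqP period_block_ok).
move=> i; rewrite (eqP period_block_ok) => ip; rewrite nth_mkseq // nth_take // nth_drop.
apply: nth_ray_prefix; apply: leq_trans size_ray_word.
by rewrite mul2n -addnn ltn_add2l.
Qed.

Lemma ray_blocks j : flatten (head_block inp :: nseq j (period_block inp)) = mkseq eta (p * j.+1).
Proof.
elim: j => [|j IH]; first by rewrite /= cats0 head_blockE muln1.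
rewrite -[j.+1]addn1 nseqD -cat_cons flatten_cat IH /= cats0 period_blockE addn1 [p * j.+2]mulnS.
rewrite addnC /mkseq iotaD map_cat; congr (_ ++ _).
rewrite add0n -[in RHS](addn0 (p * j.+1)) iotaDl -map_comp; apply: eq_map => i /=.
elim: j {IH} => [|j IH]; first by rewrite muln1.
rewrite mulnS -addnA [in RHS]eta_period -?IH //; apply: leq_trans (leq_addr _ _).
by rewrite mulnS leq_addr.
Qed.

(** To fix the ray is to fix its prefixes. *)
Definition fixes (g : taut d) := forall N, g (mkseq eta N) = mkseq eta N.

Lemma fixes_prefix (g : taut d) N N' : N' <= N -> g (mkseq eta N) = mkseq eta N ->
  g (mkseq eta N') = mkseq eta N'.
Proof.
move=> /subnKC <-; rewrite /mkseq iotaD map_cat section_funE => /eqP.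
by rewrite eqseq_cat ?size_act // => /andP [/eqP].
Qed.

Lemma ray_actP (g : taut d) : ray_act eta g =1 eta <-> fixes g.
Proof.
split=> [h N|h m]; last by rewrite /ray_act h /mkseq -addn1 iotaD map_cat last_cat.
elim: N => [|N IH]; first by have [_ ->] := tautP g.
have := h N; rewrite /ray_act /mkseq -[N.+1]addn1 iotaD map_cat /= add0n -/(mkseq eta N).
rewrite section_funE IH last_cat.
have := size_act g (mkseq eta N ++ [:: eta N]); rewrite section_funE !size_cat IH.
move=> /addnI; by case: (section_fun _ _ _) => [|c []] //= _ ->.
Qed.

Lemma word_act_generated w : generated (range X) (word_act w).
Proof.
move=> H [[H1 HM _] XH]; rewrite /word_act; elim: w => [|i w IH].
  by rewrite big_nil.
by rewrite big_cons; apply: HM => //; apply: XH; exists i.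
Qed.

Lemma WP_fixes w : WP X (Stab (generated (range X)) eta) w <-> fixes (word_act w).
Proof.
split=> [[_ /ray_actP]//|h]; split; first exact: word_act_generated.
exact/ray_actP.
Qed.

Lemma flatten_stretch m : flatten (stretch [::] m base) = mkseq eta (p * (m + 3)).
Proof.
by have := stretch_diag [::] m (head_block inp) (period_block inp) 0; rewrite cats0 => ->; rewrite addn0 ray_blocks !addnS.
Qed.

Lemma level_leq N : N <= p * (N + 3).
Proof.
by rewrite mulnDr; apply: leq_trans (leq_addr _ _); apply: leq_pmull; exact: block_len_gt0.
Qed.

Lemma lang_grammar al w : et0l_lang (grammar al) w <->
  exists m, al_derives al m [seq inl i | i <- w].
Proof.
split=> [[r /controlP [m ->] /rewrites_rho h]|[m /rewrites_rho h]]; first by exists m.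
by exists (rho m) => //; apply/controlP; exists m.
Qed.

Lemma lang_co : et0l_lang (grammar al_coE) = ~` WP X (Stab (generated (range X)) eta).
Proof.
rewrite eqEsubset; split=> w.
  move=> /lang_grammar [m /co_al_derives /word_moved h] /WP_fixes f.
  by apply: h; rewrite flatten_stretch f.
move=> nf; apply/lang_grammar.
have /existsNP [N h] : ~ fixes (word_act w) by move=> f; apply: nf; exact/WP_fixes.
exists N; apply/co_al_derives/word_moved; rewrite flatten_stretch => E; apply: h.
exact: fixes_prefix (level_leq N) E.
Qed.

(** Here [wp_complete] applies with m = 2 [size w] + 1. *)
Lemma lang_wp : et0l_lang (grammar al_wpE) = WP X (Stab (generated (range X)) eta).
Proof.
rewrite eqEsubset; split=> w.
  move=> /lang_grammar [m /wp_al_derives h]; apply/WP_fixes => N.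
  have := wp_derives_sound block_triv block_ok block_settle src_size src_ok dst_size dst_ok head_block_ok period_block_ok N h.
  move=> /word_fixed; rewrite flatten_stretch; apply: fixes_prefix.
  apply: leq_trans (level_leq N) _; rewrite leq_mul2l leq_add2r leq_addl orbT //.
move=> /WP_fixes f; apply/lang_grammar; exists (2 * size w).+1; apply/wp_al_derives.
apply: (wp_derives_complete block_triv block_ok block_settle block_cycle src_size src_ok dst_size dst_ok nt_exists head_block_ok period_block_ok).
  by rewrite size_map.
by apply/word_fixed; rewrite flatten_stretch f.
Qed.

Definition view (s : 'I_n + 'I_k) : nat + nat :=
  match s with inl i => inl (nat_of_ord i) | inr i => inr (nat_of_ord i) end.

Lemma view_syms : [seq view s | s <- syms] = sym_codes inp.
Proof.
rewrite /syms /sym_codes map_cat -!map_comp size_map size_enum_ord -!val_enum_ord -!map_comp.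
by [].
Qed.

Notation stepn := (bstep c0 inp).

Lemma view_alts (nodes0 l ends : seq (seq (seq 'I_d))) (en0 : 'I_n + 'I_k -> _) en1 x :
  (forall s v, en1 (view s) v = en0 s v) ->
  rmap view (alts [seq lookup (kleene_matrix en0 moveE syms nodes0 l) (x, y) | y <- ends]) =
  alts [seq lookup (kleene_matrix en1 (move stepn (initial_state inp) (nt_dst inp)) (sym_codes inp) nodes0 l) (x, y)
    | y <- ends].
Proof.
move=> eE; rewrite rmap_alts -map_comp; congr alts; apply: eq_map => y /=.
rewrite -view_syms (rmap_kleene_matrix eE (move := moveE)); last by case.
by rewrite rmap_lookup.
Qed.

Lemma view_first_return m q sp x o : rmap view (first_return_regex c0 inp start_state src dst syms m q sp x o) =
  first_return_regex c0 inp (initial_state inp) (nt_src inp) (nt_dst inp) (sym_codes inp) m q sp x o.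
Proof. by apply: view_alts; case. Qed.

Lemma view_co : rmap view al_coE = co_code c0 inp.
Proof. by apply: view_alts; case. Qed.

Lemma view_wp : rmap view al_wpE = wp_code c0 inp.
Proof.
rewrite /wp_regex /wp_code /wp_regex; apply: (congr1 (Alt Eps)).
rewrite -view_syms (rmap_kleene_matrix (enabled := enabled_diagE) (move := moveE)); try by case.
by rewrite rmap_lookup.
Qed.

Lemma enc_grammar al (alN : input d -> regex (nat + nat)) : rmap view al = alN inp ->
  enc (grammar_code c0 alN inp) = enc_et0l (grammar al).
Proof.
move=> alE; congr Pair; congr Pair.
have e3 A (f : 'I_3 -> A) : [seq f t | t <- enum 'I_3] = [:: f t_al; f t_be; f t_ga].
  by rewrite !enum_ordSl (size0nil (size_enum_ord 0)) /=; do ![congr (_ :: _)]; congr f; apply/val_inj.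
rewrite /enc_map e3.
have row (f : 'I_k -> regex ('I_n + 'I_k)) (g : nat -> regex (nat + nat)) :
    (forall i, rmap view (f i) = g (nat_of_ord i)) ->
    enc_seq (enc_regex (enc_sum enc_nat enc_nat)) [seq g i | i <- iota 0 k] =
    enc_seq (enc_regex (enc_sum (@enc_ord n) (@enc_ord k))) [seq f i | i <- enum 'I_k].
  move=> fg; rewrite -val_enum_ord -map_comp !enc_seq_map; congr enc_seq.
  apply/funext => i /=; rewrite -fg enc_rmap; congr enc_regex.
  by apply/funext; case.
by do 3 (congr Pair; first by apply: row => i; rewrite ?alE //; exact: view_first_return).
Qed.

Lemma wp_grammar : exists E : et0l 'I_n,
  [/\ enc (grammar_code c0 (wp_code c0) inp) = enc_et0l E,
      et0l_lang E = WP X (Stab (generated (range X)) eta), unambiguous E & limiting E].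
Proof.
exists (grammar al_wpE); split; [exact: enc_grammar view_wp | exact: lang_wp | |].
- exact: grammar_unambiguous wp_path.
- exact: grammar_limiting wp_limit.
Qed.

Lemma co_grammar : exists E : et0l 'I_n,
  [/\ enc (grammar_code c0 (co_code c0) inp) = enc_et0l E,
      et0l_lang E = ~` WP X (Stab (generated (range X)) eta), unambiguous E & limiting E].
Proof.
exists (grammar al_coE); split; [exact: enc_grammar view_co | exact: lang_co | |].
- exact: grammar_unambiguous co_path.
- exact: grammar_limiting co_limit.
Qed.

End Assembly.

Theorem theorem4p1 (d : nat) (hd : 2 <= d) :
  exists P Q : prog,
  forall (n : nat) (X : 'I_n -> taut d) (M : 'I_n -> mealy d) (a b : seq 'I_d),
    injective X ->
    (forall i, exists j, X j = (X i)^-1%g) ->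
    (forall i, bounded_automaton_aut (X i)) ->
    (forall i, section_automaton (M i) (X i)) ->
    1 <= size b ->
    let G := generated (range X) in
    let eta := periodic_ray (Ordinal hd) a b in
    (exists E : et0l 'I_n,
      [/\ computes P (enc_input M a b) (enc_et0l E),
          et0l_lang E = WP X (Stab G eta),
          unambiguous E & limiting E]) /\
    (exists E : et0l 'I_n,
      [/\ computes Q (enc_input M a b) (enc_et0l E),
          et0l_lang E = ~` WP X (Stab G eta),
          unambiguous E & limiting E]).
Proof.
have [P [F [PF FE]]] := computable_grammar_code (Ordinal hd) (computable_wp_code (Ordinal hd)).
have [Q [H [QH HE]]] := computable_grammar_code (Ordinal hd) (computable_co_code (Ordinal hd)).
exists P, Q => n X M a b _ _ X_bounded XM b1; split.
  have [E [encE lE uE limE]] := wp_grammar (Ordinal hd) a hd X_bounded XM b1.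
  exists E; split=> //; rewrite -encE -FE -enc_input_data; exact: PF.
have [E [encE lE uE limE]] := co_grammar (Ordinal hd) a hd X_bounded XM b1.
by exists E; split=> //; rewrite -encE -HE -enc_input_data; exact: QH.
Qed.
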